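(* Let $n\in\mathbb N$ and let $\gamma\in C^{0,1}(\mathbb R/\mathbb Z,\mathbb R^n)$ be a curve parametrized by arc-length (i.e. $|\gamma'|=1$ almost everywhere) such that O'Hara's Möbius energy $E_{\text{möb}}(\gamma)$ is finite. For $\varepsilon>0$ let $\gamma_\varepsilon=\gamma*\eta_\varepsilon$. Then there is a constant $\varepsilon_0>0$ such that $\gamma_\varepsilon$ is a smooth regular curve for all $0<\varepsilon<\varepsilon_0$, and, as $\varepsilon\to0$, $\gamma_\varepsilon$ converges to $\gamma$ in $W^{\frac32,2}(\mathbb R/\mathbb Z,\mathbb R^n)$ and in energy, i.e. $E_{\text{möb}}(\gamma_\varepsilon)\to E_{\text{möb}}(\gamma)$.
   Context: A Lipschitz curve $\gamma:\mathbb R/\mathbb Z\to\mathbb R^n$ is called regular if $|\gamma'|\ge c$ almost everywhere for some constant $c>0$ (for smooth curves: $\gamma'$ vanishes nowhere). For a regular curve $\gamma\in C^{0,1}(\mathbb R/\mathbb Z,\mathbb R^n)$ the Möbius energy is $$E_{\text{möb}}(\gamma)=\int_{\mathbb R/\mathbb Z}\int_{\mathbb R/\mathbb Z}\left(\frac1{|\gamma(x)-\gamma(y)|^2}-\frac1{d_\gamma(x,y)^2}\right)|\gamma'(x)||\gamma'(y)|\,dx\,dy\in[0,\infty],$$ where $d_\gamma(x,y)$ is the intrinsic distance along the curve, i.e. the length of the shorter of the two arcs of $\gamma$ between the parameters $x$ and $y$. Mollifier: $\eta\in C^\infty(\mathbb R,[0,\infty))$ is a fixed function with $\eta\equiv 0$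 on $\mathbb R\setminus(-1,1)$ and $\int_{\mathbb R}\eta\,dx=1$, and $\eta_\varepsilon(x)=\frac1\varepsilon\eta\left(\frac x\varepsilon\right)$. The convolution is $\gamma_\varepsilon(x)=\int_{\mathbb R}\gamma(x-y)\eta_\varepsilon(y)\,dy$, where $\gamma$ is regarded as a $1$-periodic function on $\mathbb R$. Fractional Sobolev space: $W^{\frac32,2}(\mathbb R/\mathbb Z,\mathbb R^n)$ consists of all $f\in W^{1,2}(\mathbb R/\mathbb Z,\mathbb R^n)$ for which $$|f'|_{W^{\frac12,2}}:=\left(\int_{\mathbb R/\mathbb Z}\int_{\mathbb R/\mathbb Z}\frac{|f'(x)-f'(y)|^2}{|x-y|^2}\,dx\,dy\right)^{1/2}<\infty,$$ where $|x-y|$ is the distance on $\mathbb R/\mathbb Z$; its norm is $\|f\|_{W^{\frac32,2}}=\|f\|_{W^{1,2}}+|f'|_{W^{\frac12,2}}$. *)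

(* Defs.v *)
From HB Require Import structures.
From mathcomp Require Import all_boot all_order all_algebra.
From mathcomp Require Import all_classical all_reals all_analysis.

Set Implicit Arguments.
Unset Strict Implicit.
Unset Printing Implicit Defensive.

Import Order.TTheory GRing.Theory Num.Theory.
Import numFieldNormedType.Exports.

Local Open Scope classical_set_scope.
Local Open Scope ring_scope.

(* Functions on R/Z are 1-periodic functions on R, and integrals over R/Z are
   integrals over [0, 1] for the Lebesgue measure. *)

Section Circle.
Context {R : realType}.

Definition fract (t : R) : R := t - (Num.floor t)%:~R.

Definition circle_dist (x y : R) : R :=
  Num.min (fract (x - y)) (1 - fract (x - y)).

(* The library norm on 'rV[R]_n is the sup norm. *)
Definition enorm (n : nat) (v : 'rV[R]_n) : R :=
  Num.sqrt (\sum_(i < n) v 0 i ^+ 2).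

Definition smooth (V : normedModType R) (f : R -> V) : Prop :=
  forall (k : nat) (x : R), derivable (derive1n k f) x 1.

End Circle.

Section Curves.
Context {R : realType} {n : nat}.
Notation mu := (@lebesgue_measure R).
Implicit Types gamma : R -> 'rV[R]_n.

Definition closed_lipschitz gamma : Prop :=
  periodic gamma 1 /\
  exists K : R, forall s t, enorm (gamma s - gamma t) <= K * `|s - t|.

Definition arc_length_parametrized gamma : Prop :=
  {ae mu, forall x, derivable gamma x 1 /\ enorm (derive1 gamma x) = 1}.

Definition regular_curve gamma : Prop :=
  closed_lipschitz gamma /\
  exists2 c : R, 0 < c &
    {ae mu, forall x, derivable gamma x 1 /\ c <= enorm (derive1 gamma x)}.

Definition arc_length gamma (a b : R) : \bar R :=
  (\int[mu]_(t in `[a, b]) (enorm (derive1 gamma t))%:E)%E.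

(* In R/Z, one arc between x and y is the image of [x, x + r] and the other
   that of [x + r, x + 1], where r in [0, 1[ is congruent to y - x modulo 1. *)
Definition intrinsic_dist gamma (x y : R) : \bar R :=
  let r := fract (y - x) in
  Order.min (arc_length gamma x (x + r)) (arc_length gamma (x + r) (x + 1)).

(* In \bar R the inverse of 0 is +oo, so that the integrand is +oo at a double
   point of a regular curve.  It is negative (+oo - +oo = -oo) only where x and
   y agree modulo 1, which is negligible. *)
Definition mobius_energy gamma : \bar R :=
  (\int[mu]_(x in `[0%R, 1%R]) \int[mu]_(y in `[0%R, 1%R])
     ((((enorm (gamma x - gamma y)%R)%:E ^+ 2)^-1
         - (intrinsic_dist gamma x y ^+ 2)^-1)
      * ((enorm (derive1 gamma x))%:E * (enorm (derive1 gamma y))%:E)))%E.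

End Curves.

Section Mollification.
Context {R : realType}.
Notation mu := (@lebesgue_measure R).

Definition is_mollifier (eta : R -> R) : Prop :=
  [/\ smooth eta,
      forall x, 0 <= eta x,
      forall x, ~~ (-1 < x < 1) -> eta x = 0
    & (\int[mu]_x (eta x)%:E)%E = 1%E].

Definition rescale (eta : R -> R) (e x : R) : R := e^-1 * eta (x / e).

Definition mollify (n : nat) (eta : R -> R) (e : R) (gamma : R -> 'rV[R]_n)
    (x : R) : 'rV[R]_n :=
  \row_(i < n) \int[mu]_y (gamma (x - y) 0 i * rescale eta e y).

End Mollification.

Section Sobolev.
Context {R : realType} {n : nat}.
Notation mu := (@lebesgue_measure R).
Implicit Types f g : R -> 'rV[R]_n.

Definition circle_integrable f : Prop :=
  periodic f 1 /\
  forall i : 'I_n, mu.-integrable `[(0 : R), 1] (fun x => (f x 0 i)%:E).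

Definition sqr_norm2 f : \bar R :=
  (\int[mu]_(x in `[0%R, 1%R]) (enorm (f x) ^+ 2)%:E)%E.

Definition in_L2 f : Prop :=
  [/\ periodic f 1,
      forall i : 'I_n, measurable_fun `[(0 : R), 1] (fun x => f x 0 i)
    & (sqr_norm2 f < +oo)%E].

Definition is_weak_deriv f g : Prop :=
  [/\ circle_integrable f, circle_integrable g &
      forall (phi : R -> R) (i : 'I_n), smooth phi -> periodic phi 1 ->
        \int[mu]_(x in `[0%R, 1%R]) (f x 0 i * derive1 phi x) =
        - \int[mu]_(x in `[0%R, 1%R]) (g x 0 i * phi x)].

(* Some weak derivative of f, if there is one.  Weak derivatives are unique up
   to equality almost everywhere, so the integrals below do not depend on the
   choice. *)
Definition weak_deriv f : R -> 'rV[R]_n := get (is_weak_deriv f).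

Definition in_W12 f : Prop :=
  in_L2 f /\ exists2 g, is_weak_deriv f g & in_L2 g.

Definition norm_W12 f : \bar R :=
  ((sqr_norm2 f + sqr_norm2 (weak_deriv f)) `^ (2^-1)%R)%E.

Definition seminorm_W_half g : \bar R :=
  ((\int[mu]_(x in `[0%R, 1%R]) \int[mu]_(y in `[0%R, 1%R])
      (enorm (g x - g y) ^+ 2 / circle_dist x y ^+ 2)%:E) `^ (2^-1)%R)%E.

Definition in_W32 f : Prop :=
  in_W12 f /\ (seminorm_W_half (weak_deriv f) < +oo)%E.

Definition norm_W32 f : \bar R :=
  (norm_W12 f + seminorm_W_half (weak_deriv f))%E.

Definition cvg_W32 (F : R -> R -> 'rV[R]_n) f : Prop :=
  [/\ in_W32 f,
      \forall e \near 0^'+, in_W32 (F e)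
    & norm_W32 (fun x => F e x - f x) @[e --> 0^'+] --> 0%E].

End Sobolev.

(* Main.v *)
(* Let [h] be a 1-periodic version of [gamma'] with [|h| = 1], and put
   [F u = \int_0^1 |h (x + u) - h x|^2 dx] and
   [Phi d = \int_{|u| <= d} F u / u^2 du].

   The energy controls [Phi]: by the parallelogram law the defect
   [w^2 - |gamma (x + w) - gamma x|^2] dominates the gap of [h] at distance
   [w / 2], so [Phi (1/4) <= 8 E].  Conversely, on a curve with speed in [c, 1]
   and chords at least [c |w|], the energy density at [(x, x + w)] is at most
   [c^-4 |w|^-3 \int_{|u| <= |w|} |h (x + u) - h x|^2 du], and by Tonelli the
   integral of this bound over [|w| <= d] is at most [Phi d].

   Convolution does not increase [F] (Jensen), so the part of the energy of
   [gamma_e] near the diagonal is at most [16 Phi d], uniformly in [e].  Away from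
   the diagonal the chords of [gamma] are bounded below, since a near
   self-contact of a unit speed curve makes the energy logarithmically large;
   there the densities converge uniformly.  The variance of [h] on an interval
   of length [2 e] is at most a multiple of [Phi (2 e)], which tends to 0, so
   [|gamma_e'|] tends to 1 uniformly.  Splitting the W^{3/2,2} seminorm of
   [gamma_e - gamma] at [|u| = d], the near part is at most [4 Phi d] and the far
   part is bounded by the L^2 norm of [gamma_e' - h]. *)

Require Import Defs.
From mathcomp Require Import all_boot all_order all_algebra.
From mathcomp Require Import all_classical all_reals all_analysis.
From mathcomp Require Import measurable_realfun.
From mathcomp Require Import ring lra.
Import Order.TTheory GRing.Theory Num.Theory.
Import numFieldNormedType.Exports.
Set Implicit Arguments.
Unset Strict Implicit.
Unset Printing Implicit Defensive.
Local Open Scope classical_set_scope.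
Local Open Scope ring_scope.

(** The derivative of the curve exists only almost everywhere, so everything is phrased through one
    bounded periodic [h] defined at every point (see [velocity]); null sets then matter only where
    the curve meets [h]. The link from geometry to analysis is that a chord is the integral of [h]
    over its arc: length squared minus chord squared is at most a variance of [h], hence at most a
    mean square deviation from any reference value, for instance [h x]. For the convergence of the
    energies no single integrable majorant of all the densities of [gamma_e] is at hand, so
    dominated convergence is replaced by a split at [|w| = d]: the near parts are all charged to the
    same [gap_energy h d], which is small by absolute continuity of the integral. Finite energy does
    not exclude double points at first sight, and there the integrand is [+oo]. The lower bound on
    chords is therefore obtained first, from a regularised kernel that stays finite, and only then
    is the energy rewritten with a real density. *)

(** * Comparison of integrals off null sets, without measurability *)

Section IntegralTools.
Local Open Scope ereal_scope.
Context d (T : measurableType d) {R : realType}.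
Context (mu : {measure set T -> \bar R}).
Import HBNNSimple.

(** A simple function below [f], once set to zero on [N], lies below [g] everywhere and keeps its
    integral; passing to the supremum compares the integrals. *)
Lemma ge0_le_integral_off_null (N : set T) (f g : T -> \bar R) :
  measurable N -> mu N = 0 -> (forall x, 0 <= f x) -> (forall x, 0 <= g x) ->
  (forall x, ~ N x -> f x <= g x) -> \int[mu]_x f x <= \int[mu]_x g x.
Proof.
move=> mN N0 f0 g0 fg; rewrite ge0_integralTE//; apply: ge_ereal_sup => _ [h hf <-].
pose k : {nnsfun T >-> R} := mul_nnsfun h (indic_nnsfun R (measurableC mN)).
have -> : sintegral mu h = sintegral mu k.
  rewrite -!integralT_nnsfun; apply: ge0_ae_eq_integral => //.
  - exact/measurable_EFinP.
  - exact/measurable_EFinP.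
  - by move=> x _; rewrite lee_fin.
  - by move=> x _; rewrite lee_fin.
  - exists N; split => // x /=; apply: contra_notP => Nx _.
    by rewrite /k /= mindicE mem_set ?mulr1.
rewrite ge0_integralTE//; apply: ereal_sup_ubound; exists k => //= x.
rewrite mindicE; case: (pselect (N x)) => Nx.
  by rewrite memNset ?mulr0//; exact.
by rewrite mem_set// mulr1 (le_trans (hf x))// fg.
Qed.

(* No measurability is required of [f] and [g]: the library integral of a
   nonnegative function is a supremum over simple functions. *)
Lemma integral_off_null (D N : set T) (f g : T -> \bar R) :
  measurable N -> mu N = 0 -> (forall x, D x -> ~ N x -> f x = g x) ->
  \int[mu]_(x in D) f x = \int[mu]_(x in D) g x.
Proof.
move=> mN N0 fg; rewrite integralE [RHS]integralE.
congr (_ - _); rewrite integral_mkcond [RHS]integral_mkcond.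
- by apply/eqP; rewrite eq_le; apply/andP; split;
    apply: (ge0_le_integral_off_null mN N0) => x;
    rewrite ?erestrict_ge0// => Nx; rewrite /patch le_eqVlt; apply/orP; left; apply/eqP;
    case: ifPn => // /set_mem Dx;
    rewrite !funeposE fg.
- by apply/eqP; rewrite eq_le; apply/andP; split;
    apply: (ge0_le_integral_off_null mN N0) => x;
    rewrite ?erestrict_ge0// => Nx; rewrite /patch le_eqVlt; apply/orP; left; apply/eqP;
    case: ifPn => // /set_mem Dx;
    rewrite !funenegE fg.
Qed.

Lemma eq_integral_ae (D : set T) (f g : T -> \bar R) :
  {ae mu, forall x, D x -> f x = g x} ->
  \int[mu]_(x in D) f x = \int[mu]_(x in D) g x.
Proof.
move=> [N [mN N0 NP]]; apply: (integral_off_null mN N0) => x Dx Nx.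
by apply: contrapT => fgx; apply: Nx; apply: NP => /=; apply: contra_not fgx; apply.
Qed.

Lemma ge0_le_integral_ae (D : set T) (f g : T -> \bar R) :
  (forall x, 0 <= f x) -> {ae mu, forall x, D x -> f x <= g x} ->
  \int[mu]_(x in D) f x <= \int[mu]_(x in D) g x.
Proof.
move=> f0 [N [mN N0 NP]].
have fg x : D x -> ~ N x -> f x <= g x.
  move=> Dx Nx; apply: contrapT => fgx; apply: Nx; apply: NP => /=.
  by apply: contra_not fgx; apply.
(* [g] may be negative on [N], so it is first replaced by its positive part; off [N] the two agree
   because [0 <= f <= g]. *)
rewrite (@integral_off_null D N g (fun x => maxe (g x) 0) mN N0); last first.
  by move=> x Dx Nx; apply/esym/max_idPl; exact: le_trans (f0 x) (fg x Dx Nx).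
rewrite integral_mkcond [leRHS]integral_mkcond.
apply: (ge0_le_integral_off_null mN N0) => x.
- by rewrite erestrict_ge0.
- by apply: erestrict_ge0 => y _; rewrite le_max lexx orbT.
- by move=> Nx; rewrite /patch; case: ifPn => // /set_mem Dx; rewrite le_max fg.
Qed.

End IntegralTools.

(** * Tonelli on products of measurable sets *)

Section Tonelli.
Local Open Scope ereal_scope.
Context d1 d2 (T1 : measurableType d1) (T2 : measurableType d2) {R : realType}.
Context (m1 : {sigma_finite_measure set T1 -> \bar R}).
Context (m2 : {sigma_finite_measure set T2 -> \bar R}).

Lemma integral_patch2 (A : set T1) (B : set T2) (f : T1 * T2 -> \bar R) :
  \int[m1]_(x in A) \int[m2]_(y in B) f (x, y) =
  \int[m1]_x \int[m2]_y (f \_ (A `*` B)) (x, y).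
Proof.
rewrite integral_mkcond; apply: eq_integral => x _; rewrite /patch.
case: ifPn => [/set_mem Ax|/negP Ax].
  rewrite integral_mkcond; apply: eq_integral => y _; rewrite /patch.
  have [By|By] := boolP (y \in B).
    by rewrite mem_set//; split => //; exact: set_mem By.
  by rewrite memNset// => -[_ /mem_set]; rewrite (negPf By).
rewrite integral0_eq// => y _; rewrite memNset// => -[/mem_set] //.
Qed.

Lemma tonelli_in (A : set T1) (B : set T2) (f : T1 * T2 -> \bar R) :
  measurable A -> measurable B -> measurable_fun setT f -> (forall z, 0 <= f z) ->
  \int[m1]_(x in A) \int[m2]_(y in B) f (x, y) =
  \int[m2]_(y in B) \int[m1]_(x in A) f (x, y).
Proof.
move=> mA mB mf f0; rewrite integral_patch2.
rewrite (@fubini_tonelli _ _ _ _ _ m1 m2 (f \_ (A `*` B))); last 2 first.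
- apply/(measurable_restrictT _ _).1; first exact: measurableX.
  exact: measurable_funTS.
- by move=> z; rewrite erestrict_ge0.
rewrite [RHS]integral_mkcond; apply: eq_integral => y _; rewrite /patch.
case: ifPn => [/set_mem By|/negP By].
  rewrite [RHS]integral_mkcond; apply: eq_integral => x _; rewrite /patch.
  have [Ax|Ax] := boolP (x \in A).
    by rewrite mem_set//; split => //; exact: set_mem Ax.
  by rewrite memNset// => -[/mem_set]; rewrite (negPf Ax).
by rewrite integral0_eq// => x _; rewrite memNset// => -[_ /mem_set].
Qed.

Lemma measurable_integral_snd (B : set T2) (f : T1 * T2 -> \bar R) :
  measurable B -> measurable_fun setT f -> (forall z, 0 <= f z) ->
  measurable_fun setT (fun x => \int[m2]_(y in B) f (x, y)).
Proof.
move=> mB mf f0.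
have -> : (fun x => \int[m2]_(y in B) f (x, y)) =
    (fun x => \int[m2]_y (f \_ (setT `*` B)) (x, y)).
  apply/funext => x; rewrite integral_mkcond; apply: eq_integral => y _.
  by rewrite /patch in_setX in_setT.
apply: measurable_fun_fubini_tonelli_F.
- apply/(measurable_restrictT _ _).1; first exact: measurableX.
  exact: measurable_funTS.
- by move=> z; rewrite erestrict_ge0.
Qed.

End Tonelli.

(** * Affine changes of variable and integrals over a period *)

Section AffineSubstitution.
Context {R : realType}.
Notation mu := (@lebesgue_measure R).

Let aff (k c : R) : measurableTypeR R -> measurableTypeR R := fun x => k * x + c.

Let measurable_aff k c : measurable_fun setT (aff k c).
Proof. by apply: measurable_funD => //; exact: mulrl_measurable. Qed.

Let preimage_aff_gt0 (k c a b : R) (b0 b1 : bool) : 0 < k ->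
  aff k c @^-1` [set` Interval (BSide b0 a) (BSide b1 b)] =
  [set` Interval (BSide b0 ((a - c) / k)) (BSide b1 ((b - c) / k))].
Proof.
move=> k0; apply/seteqP; split => x /=; rewrite /aff !in_itv/=;
  by case: b0; case: b1; rewrite /= ?ltr_pdivrMr ?ltr_pdivlMr ?ler_pdivrMr
    ?ler_pdivlMr// ?ltrBlDr ?lerBlDr ?ltrBrDr ?lerBrDr mulrC.
Qed.

Let preimage_aff_lt0 (k c a b : R) (b0 b1 : bool) : k < 0 ->
  aff k c @^-1` [set` Interval (BSide b0 a) (BSide b1 b)] =
  [set` Interval (BSide (~~ b1) ((b - c) / k)) (BSide (~~ b0) ((a - c) / k))].
Proof.
move=> k0; apply/seteqP; split => x /=; rewrite /aff !in_itv/= andbC;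
  by case: b0; case: b1; rewrite /= ?ltr_ndivrMr ?ltr_ndivlMr ?ler_ndivrMr
    ?ler_ndivlMr// ?ltrBlDr ?lerBlDr ?ltrBrDr ?lerBrDr mulrC.
Qed.

(** The measure [m], which is [|k|] times the image of Lebesgue measure under [x |-> k * x + c],
    gives half-open intervals their length. By uniqueness it is Lebesgue measure, and the formula is
    integration against an image measure. *)
Lemma ge0_integral_affine_set (k c : R) (D : set R) (f : R -> \bar R) :
  k != 0 -> measurable D -> measurable_fun D f -> (forall x, D x -> 0 <= f x)%E ->
  (\int[mu]_(y in D) f y =
   `|k|%:E * \int[mu]_(x in [set x | D (k * x + c)%R]) f (k * x + c)%R)%E.
Proof.
move=> k0 mD mf f0.
have mA := measurable_aff k c.
have k_ge0 : 0 <= `|k| by [].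
pose p := (pushforward mu (aff k c) : {measure set (measurableTypeR R) -> \bar R}).
pose m : {measure set (measurableTypeR R) -> \bar R} :=
  mscale (NngNum k_ge0) (p mA).
transitivity (\int[m]_(y in D) f y)%E.
  apply: eq_measure_integral => A mAA AD.
  apply: lebesgue_measure_unique => // _ [[u v]] _ <-.
  transitivity (`|k|%:E * mu (aff k c @^-1` [set` Interval (BRight u) (BRight v)]))%E; last by [].
  have [k_lt0|k_gt0|/eqP] := ltgtP k 0; last by rewrite (negPf k0).
  - rewrite preimage_aff_lt0// !lebesgue_measure_itv/= !lte_fin.
    rewrite ltr_nM2r ?invr_lt0// ltrD2r; case: ifPn => _; last by rewrite mule0.
    by rewrite -EFinB -EFinM ltr0_norm//; congr EFin; field.
  - rewrite preimage_aff_gt0// !lebesgue_measure_itv/= !lte_fin.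
    rewrite ltr_pM2r ?invr_gt0// ltrD2r; case: ifPn => _; last by rewrite mule0.
    by rewrite -EFinB -EFinM gtr0_norm//; congr EFin; field.
rewrite ge0_integral_mscale//=; congr (_ * _)%E.
by rewrite ge0_integral_pushforward// => y /set_mem; exact: f0.
Qed.

Lemma ge0_integral_affine (k c : R) (f : R -> \bar R) : k != 0 ->
  measurable_fun setT f -> (forall x, 0 <= f x)%E ->
  (\int[mu]_y f y = `|k|%:E * \int[mu]_x f (k * x + c)%R)%E.
Proof.
move=> k0 mf f0; rewrite (@ge0_integral_affine_set k c setT)//.
Qed.

Lemma ge0_integral_shift (c a b : R) (f : R -> \bar R) :
  measurable_fun setT f -> (forall x, 0 <= f x)%E ->
  (\int[mu]_(x in `[a, b]) f (x + c)%R = \int[mu]_(x in `[(a + c)%R, (b + c)%R]) f x)%E.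
Proof.
move=> mf f0; rewrite [RHS](@ge0_integral_affine_set 1 c)//; last first.
  exact: measurable_funTS.
rewrite normr1 mul1e; under [RHS]eq_integral do rewrite mul1r.
congr (integral _ _ _); apply/seteqP; split => x /=; rewrite !in_itv/= mul1r;
  by rewrite !lerD2r.
Qed.

Lemma integral_comp_opp_shift (c : R) (f : R -> R) :
  measurable_fun setT f ->
  \int[mu]_y f y = \int[mu]_x f (c - x).
Proof.
move=> mf; rewrite /Rintegral integralE [in RHS]integralE; congr (fine (_ - _)).
- rewrite (@ge0_integral_affine (-1) c)//; last first.
    by apply: measurable_funepos; exact/measurable_EFinP.
  rewrite normrN1 mul1e; apply: eq_integral => x _.
  by rewrite !funeposE mulN1r addrC.
- rewrite (@ge0_integral_affine (-1) c)//; last first.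
    by apply: measurable_funeneg; exact/measurable_EFinP.
  rewrite normrN1 mul1e; apply: eq_integral => x _.
  by rewrite !funenegE mulN1r addrC.
Qed.

Lemma ge0_integral_itv_cat (a b c : R) (f : R -> \bar R) : a <= b -> b <= c ->
  measurable_fun setT f -> (forall x, 0 <= f x)%E ->
  (\int[mu]_(x in `[a, c]) f x =
   \int[mu]_(x in `[a, b]) f x + \int[mu]_(x in `[b, c]) f x)%E.
Proof.
move=> ab bc mf f0.
rewrite -[X in (X + _)%E]integral_itv_bndo_bndc; last exact: measurable_funTS.
rewrite -ge0_integral_setU//.
- by rewrite -itv_bndbnd_setU// bnd_simp.
- exact: measurable_funTS.
- apply/disj_setPRL => x /=; rewrite !in_itv/= => /andP[bx _].
  by rewrite ltNge bx andbF.
Qed.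

Lemma ge0_integral_period_int (z : int) (a b : R) (f : R -> \bar R) :
  measurable_fun setT f -> (forall x, 0 <= f x)%E -> (forall x, f (x + 1)%R = f x) ->
  (\int[mu]_(x in `[(a + z%:~R)%R, (b + z%:~R)%R]) f x = \int[mu]_(x in `[a, b]) f x)%E.
Proof.
move=> mf f0 pf.
have fn (n : nat) x : f (x + n%:R) = f x.
  by elim: n => [|n IHn]; rewrite ?addr0// -natr1 addrA pf.
have fz x : f (x + z%:~R) = f x.
  case: z => n; first exact: fn.
  by rewrite -(fn n.+1) NegzE mulrNz subrK.
by rewrite -ge0_integral_shift//; apply: eq_integral => x _; rewrite fz.
Qed.

Lemma ge0_integral_period (a : R) (f : R -> \bar R) :
  measurable_fun setT f -> (forall x, 0 <= f x)%E -> (forall x, f (x + 1)%R = f x) ->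
  (\int[mu]_(x in `[a, (a + 1)%R]) f x = \int[mu]_(x in `[0%R, 1%R]) f x)%E.
Proof.
move=> mf f0 pf.
pose r := a - (Num.floor a)%:~R.
have /andP[r0 r1] : (0 <= r < 1).
  by rewrite /r subr_ge0 ltrBlDr floor_le addrC; have := floorD1_gt a; rewrite intrD.
have -> : a = r + (Num.floor a)%:~R by rewrite /r subrK.
move: (Num.floor a) r r0 r1 => z r r0 r1.
rewrite addrAC ge0_integral_period_int//.
(* After removal of the integer part of [a], the piece of [[r, r + 1]] beyond [1] is moved back by
   one period onto [[0, r]]. *)
rewrite (@ge0_integral_itv_cat r 1 (r + 1))//; [|exact: ltW|by rewrite lerDr].
have := @ge0_integral_period_int 1 0 r f mf f0 pf; rewrite add0r => ->.
by rewrite addeC -ge0_integral_itv_cat//; exact: ltW.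
Qed.

Lemma ge0_integral_periodic_shift (c : R) (f : R -> \bar R) :
  measurable_fun setT f -> (forall x, 0 <= f x)%E -> (forall x, f (x + 1)%R = f x) ->
  (\int[mu]_(x in `[0%R, 1%R]) f (x + c)%R = \int[mu]_(x in `[0%R, 1%R]) f x)%E.
Proof.
by move=> mf f0 pf; rewrite ge0_integral_shift// add0r addrC ge0_integral_period.
Qed.

End AffineSubstitution.

(** * Bounded measurable functions and integrable weights *)

Section BoundedMeasurable.
Context {R : realType}.
Notation mu := (@lebesgue_measure R).

Definition bounded_measurable (f : R -> R) : Prop :=
  measurable_fun setT f /\ exists M : R, forall x, `|f x| <= M.

Lemma bounded_measurable_cst (c : R) : bounded_measurable (fun=> c).
Proof. by split => //; exists `|c|. Qed.

Lemma bounded_measurableD (f g : R -> R) :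
  bounded_measurable f -> bounded_measurable g ->
  bounded_measurable (fun x => f x + g x).
Proof.
move=> [mf [M fM]] [mg [N gN]]; split; first exact: measurable_funD.
by exists (M + N) => x; rewrite (le_trans (ler_normD _ _))// lerD.
Qed.

Lemma bounded_measurableN (f : R -> R) :
  bounded_measurable f -> bounded_measurable (fun x => - f x).
Proof.
move=> [mf [M fM]]; split; first exact: measurable_funN.
by exists M => x; rewrite normrN.
Qed.

Lemma bounded_measurableB (f g : R -> R) :
  bounded_measurable f -> bounded_measurable g ->
  bounded_measurable (fun x => f x - g x).
Proof. by move=> bf bg; exact/bounded_measurableD/bounded_measurableN. Qed.

Lemma bounded_measurableM (f g : R -> R) :
  bounded_measurable f -> bounded_measurable g ->
  bounded_measurable (fun x => f x * g x).
Proof.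
move=> [mf [M fM]] [mg [N gN]]; split; first exact: measurable_funM.
by exists (M * N) => x; rewrite normrM ler_pM.
Qed.

Lemma bounded_measurable_sum (I : Type) (s : seq I) (f : I -> R -> R) :
  (forall i, bounded_measurable (f i)) ->
  bounded_measurable (fun x => \sum_(i <- s) f i x).
Proof.
move=> bf; elim: s => [|i s IHs].
  by under eq_fun do rewrite big_nil; exact: bounded_measurable_cst.
by under eq_fun do rewrite big_cons; exact: bounded_measurableD.
Qed.

Lemma bounded_measurable_comp (f k : R -> R) :
  measurable_fun setT k -> bounded_measurable f -> bounded_measurable (f \o k).
Proof.
move=> mk [mf [M fM]]; split; first exact: measurableT_comp.
by exists M => x; exact: fM.
Qed.

Lemma bounded_measurable_indic (A : set R) :
  measurable A -> bounded_measurable (\1_A : R -> R).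
Proof.
move=> mA; split; first exact: measurable_indic.
by exists 1 => x; rewrite indicE; case: (_ \in _); rewrite ?normr1// normr0.
Qed.

(* A finite measure given by its density. *)
Definition weight (rho : R -> R) : Prop :=
  [/\ measurable_fun setT rho, forall x, 0 <= rho x &
      mu.-integrable setT (EFin \o rho)].

Lemma weighted_integrable (rho f : R -> R) : weight rho ->
  bounded_measurable f -> mu.-integrable setT (EFin \o (fun x => f x * rho x)).
Proof.
move=> [mr r0 ir] [mf [M fM]].
apply: (@le_integrable _ _ _ mu setT measurableT _ (EFin \o (fun x => M * rho x))) => //.
- by apply/measurable_EFinP; exact: measurable_funM.
- move=> x _ /=; rewrite lee_fin normrM (ger0_norm (r0 x)) [leRHS]ger0_norm.
    by rewrite ler_wpM2r.
  by rewrite mulr_ge0// (le_trans _ (fM x)).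
- rewrite (_ : EFin \o _ = (fun x => M%:E * (EFin \o rho) x)%E)//.
  exact: integrableZl.
Qed.

Lemma weight_indic (a b : R) : weight (\1_`[a, b] : R -> R).
Proof.
split; first exact: measurable_indic.
- by move=> x; rewrite indicE.
- exact: integrable_indic_itv.
Qed.

Lemma Rintegral_indic_itv (f : R -> R) (a b : R) :
  \int[mu]_x (f x * \1_`[a, b] x) = \int[mu]_(x in `[a, b]) f x.
Proof.
rewrite [RHS]Rintegral_mkcond; apply: eq_Rintegral => x _.
by rewrite patch_indic.
Qed.

Lemma Rintegral_sum (rho : R -> R) (I : Type) (s : seq I) (f : I -> R -> R) :
  weight rho -> (forall i, bounded_measurable (f i)) ->
  \int[mu]_x ((\sum_(i <- s) f i x) * rho x) =
  \sum_(i <- s) \int[mu]_x (f i x * rho x).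
Proof.
move=> wr bf; elim: s => [|i s IHs].
  rewrite big_nil; under eq_Rintegral do rewrite big_nil mul0r.
  by rewrite Rintegral_cst// mul0r.
rewrite big_cons -IHs -RintegralD//; last 2 first.
- exact: weighted_integrable.
- exact/(weighted_integrable wr)/bounded_measurable_sum.
by apply: eq_Rintegral => x _; rewrite big_cons mulrDl.
Qed.

(** The bias-variance identity, multiplied by the mass [m] so that it involves no division and holds
    for [m = 0] as well. *)
Lemma weighted_variance_scalar (rho f : R -> R) (c : R) : weight rho ->
  bounded_measurable f ->
  let m := \int[mu]_x rho x in let F := \int[mu]_x (f x * rho x) in
  m * \int[mu]_x ((f x - c) ^+ 2 * rho x) =
  m * \int[mu]_x (f x ^+ 2 * rho x) - F ^+ 2 + (F - m * c) ^+ 2.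
Proof.
move=> wr bf m F.
have bff : bounded_measurable (fun x => f x ^+ 2).
  by under eq_fun do rewrite expr2; exact: bounded_measurableM.
have bc := bounded_measurable_cst.
have bcf : bounded_measurable (fun x => c *+ 2 * f x).
  exact: bounded_measurableM.
have -> : \int[mu]_x ((f x - c) ^+ 2 * rho x) =
    \int[mu]_x (f x ^+ 2 * rho x) - c *+ 2 * F + c ^+ 2 * m.
  rewrite /F /m -!RintegralZl//; last 2 first.
  - have := weighted_integrable wr (bc 1).
    by under [X in EFin \o X]eq_fun do rewrite mul1r.
  - exact: weighted_integrable.
  rewrite -RintegralB//; last 2 first.
  - exact: weighted_integrable.
  - apply: eq_integrable (weighted_integrable wr bcf) => //.
    by move=> x _ /=; congr EFin; ring.
  rewrite -RintegralD//; last 2 first.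
  - apply: eq_integrable (weighted_integrable wr (bounded_measurableB bff bcf)) => //.
    by move=> x _ /=; congr EFin; ring.
  - exact: (weighted_integrable wr (bc (c ^+ 2))).
  apply: eq_Rintegral => x _; ring.
by ring.
Qed.

End BoundedMeasurable.

(** * Weighted means and variances of vector functions *)

Section WeightedVariance.
Context {R : realType} {n : nat}.
Notation mu := (@lebesgue_measure R).
Implicit Types (h : R -> 'rV[R]_n) (v c : 'rV[R]_n) (rho : R -> R).

Definition sqn v : R := \sum_(i < n) v 0 i ^+ 2.

Lemma sqn_ge0 v : 0 <= sqn v.
Proof. by apply: sumr_ge0 => i _; exact: sqr_ge0. Qed.

Lemma enormE v : enorm v = Num.sqrt (sqn v). Proof. by []. Qed.

Lemma enorm_sqr v : enorm v ^+ 2 = sqn v.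
Proof. by rewrite sqr_sqrtr// sqn_ge0. Qed.

Lemma enorm_ge0 v : 0 <= enorm v. Proof. exact: sqrtr_ge0. Qed.

Lemma sqn0 : sqn 0 = 0.
Proof. by rewrite /sqn big1// => i _; rewrite mxE expr0n. Qed.

Lemma sqnN v : sqn (- v) = sqn v.
Proof. by apply: eq_bigr => i _; rewrite mxE sqrrN. Qed.

Lemma sqnB v c : sqn (v - c) = sqn (c - v).
Proof. by rewrite -sqnN opprB. Qed.

Lemma sqnD_le v c : sqn (v + c) <= 2 * sqn v + 2 * sqn c.
Proof.
rewrite /sqn !mulr_sumr -big_split/=; apply: ler_sum => i _; rewrite mxE.
by have := sqr_ge0 (v 0 i - c 0 i); rewrite sqrrB sqrrD; lra.
Qed.

Lemma sqnB_le v c : sqn (v - c) <= 2 * sqn v + 2 * sqn c.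
Proof. by rewrite -(sqnN c) sqnD_le. Qed.

Definition bounded_measurable_rV h : Prop :=
  forall i, bounded_measurable (fun x => h x 0 i).

(** Not divided by the mass of [rho]: for the indicator of an interval and the velocity of a curve
    this is exactly the chord ([chordE]). *)
Definition wmean rho h : 'rV[R]_n := \row_i \int[mu]_x (h x 0 i * rho x).

Lemma bounded_measurable_sqn h :
  bounded_measurable_rV h -> bounded_measurable (fun x => sqn (h x)).
Proof.
move=> bh; apply: bounded_measurable_sum => i.
by under eq_fun do rewrite expr2; exact: bounded_measurableM.
Qed.

Lemma bounded_measurable_rVB h c :
  bounded_measurable_rV h -> bounded_measurable_rV (fun x => h x - c).
Proof.
move=> bh i; under eq_fun do rewrite !mxE.
by apply: bounded_measurableB => //; exact: bounded_measurable_cst.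
Qed.

Lemma weighted_variance rho h c : weight rho -> bounded_measurable_rV h ->
  let m := \int[mu]_x rho x in
  m * \int[mu]_x (sqn (h x - c) * rho x) =
  m * \int[mu]_x (sqn (h x) * rho x) - sqn (wmean rho h)
    + sqn (wmean rho h - m *: c).
Proof.
move=> wr bh m; rewrite !Rintegral_sum//; last 2 first.
- by move=> i; under eq_fun do rewrite expr2; exact: bounded_measurableM.
- have bc := bounded_measurable_rVB c bh.
  by move=> i; under eq_fun do rewrite expr2; exact: bounded_measurableM.
rewrite /sqn !mulr_sumr -sumrB -big_split/=; apply: eq_bigr => i _.
rewrite !mxE -weighted_variance_scalar//; congr (_ * _).
by apply: eq_Rintegral => x _; rewrite !mxE.
Qed.

Lemma sqn_wmean_le rho h : weight rho -> bounded_measurable_rV h ->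
  0 < \int[mu]_x rho x ->
  sqn (wmean rho h) <=
  (\int[mu]_x rho x) * \int[mu]_x (sqn (h x) * rho x).
Proof.
move=> wr bh m0; set m := Rintegral _ _ _ in m0 *.
(* Centred at the true mean, the last term of the identity vanishes and what remains is a
   nonnegative variance. *)
have /= := weighted_variance (m^-1 *: wmean rho h) wr bh; rewrite -/m.
rewrite scalerA divff ?gt_eqF// scale1r subrr sqn0 addr0 => H.
rewrite -subr_ge0 -H; apply: mulr_ge0; first exact: ltW.
by apply: Rintegral_ge0 => x _; rewrite mulr_ge0 ?sqn_ge0//; case: wr.
Qed.

Lemma weighted_variance_le rho h c : weight rho -> bounded_measurable_rV h ->
  (\int[mu]_x rho x) * \int[mu]_x (sqn (h x) * rho x) - sqn (wmean rho h) <=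
  (\int[mu]_x rho x) * \int[mu]_x (sqn (h x - c) * rho x).
Proof. by move=> wr bh; rewrite weighted_variance// lerDl sqn_ge0. Qed.

Lemma EFin_Rintegral rho (f : R -> R) : weight rho -> bounded_measurable f ->
  (\int[mu]_x (f x * rho x))%:E = (\int[mu]_x (f x * rho x)%:E)%E.
Proof.
move=> wr bf; rewrite fineK//.
exact/integrable_fin_num/weighted_integrable.
Qed.

End WeightedVariance.

(** * Differentiation under the integral and the fundamental theorem for Lipschitz functions *)

Section LipschitzCalculus.
Context {R : realType}.
Notation mu := (@lebesgue_measure R).

Lemma ae_imply (P Q : R -> Prop) : (forall x, P x -> Q x) ->
  {ae mu, forall x, P x} -> {ae mu, forall x, Q x}.
Proof.
by move=> PQ; apply: filterS; first exact: (ae_filter_ringOfSetsType mu).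
Qed.

(** Along any sequence [t n] tending to [0] the difference quotients are bounded by [G], so
    dominated convergence applies; the derivative in the parameter is needed at the single point [a]
    and for almost every [y]. *)
Lemma is_derive_integral (f : R -> R -> R) (a : R) (df G : R -> R) :
  (forall x, mu.-integrable setT (EFin \o f x)) ->
  mu.-integrable setT (EFin \o G) ->
  (forall x y, `|f x y - f a y| <= `|x - a| * G y) ->
  measurable_fun setT df ->
  {ae mu, forall y, is_derive a (1 : R) (f ^~ y) (df y)} ->
  is_derive a (1 : R) (fun x => \int[mu]_y f x y) (\int[mu]_y df y).
Proof.
move=> intf intG fG mdf dfae.
suff H : (fun h => h^-1 *: (\int[mu]_y f (h *: 1 + a) y - \int[mu]_y f a y))
    @ 0^' --> \int[mu]_y df y.
  apply: DeriveDef; first by apply/cvg_ex; eexists; exact: H.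
  by apply/cvg_lim => //; exact: H.
apply/cvgr_dnbhsP => t [t0 tcvg].
pose g n y : R := (t n)^-1 * (f (t n *: 1 + a) y - f a y).
have intB n : mu.-integrable setT (fun y => (f (t n *: 1 + a) y)%:E - (f a y)%:E)%E.
  exact: (integrableB measurableT (intf (t n *: 1 + a)) (intf a)).
have mg n : measurable_fun setT (fun y => (g n y)%:E).
  apply/measurable_EFinP/measurable_funM => //.
  by apply: measurable_funB; [have /integrableP[/measurable_EFinP] := intf (t n *: 1 + a)
    |have /integrableP[/measurable_EFinP] := intf a].
have gG n y : `|g n y| <= G y.
  rewrite /g normrM normfV ler_pdivrMl ?normr_gt0//.
  by rewrite (le_trans (fG _ _))// addrK scaler1.
have gcvg : {ae mu, forall y, setT y ->
    (fun n => (g n y)%:E) @ \oo --> (df y)%:E}.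
  apply: ae_imply dfae => y dfy _; apply: cvg_EFin; first exact: nearW.
  have [/cvg_ex[/= l hl] e] := dfy.
  have le : l = df y by rewrite -e; apply/esym/cvg_lim.
  by move/cvgr_dnbhsP : hl; rewrite -le; apply.
have gGE : {ae mu, forall y n, setT y -> (`|(g n y)%:E| <= (EFin \o G) y)%E}.
  by apply: aeW => y n _; rewrite lee_fin.
have [ig _] := @dominated_convergence _ _ R mu setT measurableT
  (fun n y => (g n y)%:E) (EFin \o df) (EFin \o G) mg
  ((measurable_EFinP _ _).2 mdf) gcvg intG gGE.
move=> /= cv.
have : fine (\int[mu]_y (g n y)%:E)%E @[n --> \oo] --> fine (\int[mu]_y (df y)%:E)%E.
  apply: fine_cvg; rewrite fineK//; exact: integrable_fin_num.
apply: cvg_trans; apply: near_eq_cvg; apply: nearW => n /=.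
rewrite -RintegralB// /Rintegral.
have -> : (\int[mu]_y (g n y)%:E)%E =
    ((t n)^-1%:E * \int[mu]_y (f (t n *: 1 + a)%R y - f a y)%:E)%E.
  rewrite -(integralZl measurableT (intB n)).
  by apply: eq_integral => y _; rewrite /g EFinM.
rewrite fineM//; exact: integrable_fin_num (intB n).
Qed.

Lemma is_derive_comp_addr (f : R -> R) (c x df : R) :
  is_derive (x + c) (1 : R) f df ->
  is_derive x (1 : R) (fun t => f (t + c)) df.
Proof.
move=> [fd <-].
have e : (fun h => h^-1 *: (((fun t => f (t + c)) \o shift x) (h *: 1) - f (x + c))) =
    (fun h => h^-1 *: ((f \o shift (x + c)) (h *: 1) - f (x + c))).
  by apply/funext => h /=; rewrite addrA.
by apply: DeriveDef; [rewrite /derivable e|rewrite /derive e].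
Qed.

Lemma lipschitz_continuous (f : R -> R) (K : R) :
  (forall s t, `|f s - f t| <= K * `|s - t|) -> continuous f.
Proof.
move=> fK x; apply/cvgrPdist_le => /= e e0.
have K0 : 0 < `|K| + 1 by rewrite ltr_wpDl.
near=> y; rewrite (le_trans (fK _ _))//.
rewrite (@le_trans _ _ ((`|K| + 1) * `|x - y|))//.
  by rewrite ler_wpM2r// (le_trans (ler_norm _))// lerDl.
rewrite -ler_pdivlMl// mulrC.
by near: y; apply: cvgr_dist_le; [exact: cvg_id|rewrite divr_gt0].
Unshelve. all: by end_near. Qed.

Lemma continuous_antiderivative (f : R -> R) (c : R) : continuous f ->
  exists P : R -> R, forall x, c < x -> is_derive x (1 : R) P (f x).
Proof.
move=> cf; exists (fun x => \int[mu]_(t in `[c, x]) f t) => x cx.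
have xx1 : x < x + 1 by rewrite ltrDl.
have fi : mu.-integrable `[c, x + 1] (EFin \o f).
  apply: continuous_compact_integrable; first exact: segment_compact.
  exact: continuous_subspaceT.
have [dP eP] := continuous_FTC1_closed xx1 fi cx (cf x).
by rewrite -eP; apply: DeriveDef; [exact: dP|rewrite derive1E].
Qed.

Lemma Rintegral_FTC (f P : R -> R) (a b : R) : a <= b -> continuous f ->
  (forall x, a <= x -> is_derive x (1 : R) P (f x)) ->
  \int[mu]_(x in `[a, b]) f x = P b - P a.
Proof.
rewrite le_eqVlt => /predU1P[->|ab] cf dP.
  by rewrite set_itv1 Rintegral_set1 subrr.
have cP x : a <= x -> {for x, continuous P}.
  by move=> ax; apply/differentiable_continuous/derivable1_diffP; case: (dP x ax).
rewrite /Rintegral (@continuous_FTC2 _ f P)//.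
- exact: continuous_subspaceT.
- split.
  + by move=> x; rewrite in_itv/= => /andP[/ltW/dP[]].
  + by apply/cvg_at_right_filter/cP.
  + by apply/cvg_at_left_filter/cP/ltW.
- by move=> x; rewrite in_itv/= => /andP[/ltW/dP[? <-] _]; rewrite derive1E.
Qed.

(** The function [Phi s], the integral of [f] over [[a + s, b + s]], is differentiated at [0] in two
    ways: under the integral sign, which gives the integral of [h], and through a primitive [P] of
    the continuous [f], which gives [f b - f a]. This bypasses the theory of absolutely continuous
    functions. *)
Lemma lipschitz_FTC (f h : R -> R) (K a b : R) : a <= b ->
  (forall s t, `|f s - f t| <= K * `|s - t|) -> bounded_measurable h ->
  {ae mu, forall x, is_derive x (1 : R) f (h x)} ->
  \int[mu]_(x in `[a, b]) h x = f b - f a.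
Proof.
move=> ab fK bh fh; have cf := lipschitz_continuous fK.
pose Phi s := \int[mu]_y (f (s + y) * \1_`[a, b] y).
have integrable_f s : mu.-integrable setT (EFin \o (fun y => f (s + y) * \1_`[a, b] y)).
  have : mu.-integrable `[a, b] (EFin \o (fun y => f (s + y))).
    apply: continuous_compact_integrable; first exact: segment_compact.
    apply: continuous_subspaceT => y; apply: (@continuous_comp _ _ _ (fun y => s + y) f).
      by apply: cvgD; [exact: cvg_cst|exact: cvg_id].
    exact: cf.
  rewrite integrable_mkcond//; apply: eq_integrable => // y _.
  by rewrite restrict_EFin/= patch_indic.
have dPhi : is_derive 0 (1 : R) Phi (\int[mu]_y (h y * \1_`[a, b] y)).
  apply: (is_derive_integral (G := fun y => K * \1_`[a, b] y)) => //.
  - exact: (weighted_integrable (weight_indic a b) (bounded_measurable_cst K)).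
  - move=> s y; rewrite -mulrBl normrM subr0 [leRHS]mulrA.
    rewrite [`|\1_ _ _|]ger0_norm ?ler_wpM2r//.
    by rewrite (le_trans (fK _ _))// mulrC add0r addrK.
  - by apply: measurable_funM; [case: bh|exact: measurable_indic].
  - apply: ae_imply fh => y fhy.
    have H : is_derive (0 : R) (1 : R) (fun s => f (s + y)) (h y).
      by apply: is_derive_comp_addr; rewrite add0r.
    rewrite mulrC (_ : (fun x => _) = (\1_`[a, b] y \*: (fun s => f (s + y)))); last first.
      by apply/funext => s; rewrite /= mulrC.
    exact: is_deriveZ.
(* The base point [a - 1] makes [P] differentiable at every [y + s] with [a <= y] and [|s| < 1]. *)
have [P dP] := continuous_antiderivative (a - 1) cf.
have PhiE : \forall s \near (0 : R), P (b + s) - P (a + s) = Phi s.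
  near=> s; apply/esym.
  have sa : `|s| < 1
    by near: s; apply/nbhs_ballP; exists 1 => //= y; rewrite /ball/= sub0r normrN.
  rewrite /Phi Rintegral_indic_itv.
  refine (@Rintegral_FTC (fun y => f (s + y)) (fun y => P (y + s)) _ _ ab _ _).
  - move=> y; apply: (@continuous_comp _ _ _ (fun y => s + y) f).
      by apply: cvgD; [exact: cvg_cst|exact: cvg_id].
    exact: cf.
  - move=> y ay; rewrite addrC; apply: is_derive_comp_addr; apply: dP.
    by move: sa; rewrite ltr_norml => /andP[]; lra.
have dPhi' : is_derive 0 (1 : R) Phi (f b - f a).
  apply: (near_eq_is_derive PhiE).
  apply: is_deriveB; [under eq_fun do rewrite addrC|under eq_fun do rewrite addrC];
    by apply: is_derive_comp_addr; rewrite add0r; apply: dP; lra.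
rewrite -Rintegral_indic_itv.
have [_ <-] := dPhi; have [_ <-] := dPhi'; by [].
Unshelve. all: by end_near. Qed.

End LipschitzCalculus.

(** * Derivatives of row vectors, coordinate by coordinate *)

Section RowVectorDerivative.
Context {R : realType} {n : nat}.

Lemma is_derive_rV (f : R -> 'rV[R]_n) (x : R) (v : 'rV[R]_n) :
  (derivable f x 1 /\ derive1 f x = v) <->
  (forall i, is_derive x (1 : R) (fun t => f t 0 i) (v 0 i)).
Proof.
split=> [[df fv] i|H].
  apply: DeriveDef; first exact/(derivable_mxP f x 1).1.
  by rewrite -fv derive1E derive_mx// mxE.
have df : derivable f x 1.
  by apply/derivable_mxP => j i; rewrite (ord1 j); case: (H i).
split => //; rewrite derive1E derive_mx//.
by apply/rowP => i; rewrite mxE; case: (H i).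
Qed.

End RowVectorDerivative.

(** * Measurability of inverses and of squared distances *)

Section MeasurabilityTools.
Context {d} {T : measurableType d} {R : realType}.

Lemma measurable_invr (f : T -> R) :
  measurable_fun setT f -> measurable_fun setT (fun x => (f x)^-1).
Proof.
(* The power function is measurable on all of [R], and the factor [f x] restores the sign and the
   value [0^-1 = 0]. *)
move=> mf; have -> : (fun x => (f x)^-1) = (fun x => f x * (f x ^+ 2) `^ (-1)).
  apply/funext => x; rewrite powR_inv1 ?sqr_ge0//.
  have [->|fx0] := eqVneq (f x) 0; first by rewrite mul0r invr0.
  by rewrite expr2 invfM mulVKf.
apply: measurable_funM => //; apply: measurableT_comp (measurable_powR _) _.
exact: measurable_funX.
Qed.

Lemma measurable_sqnB n (f g : T -> 'rV[R]_n) :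
  (forall i, measurable_fun setT (fun x => f x 0 i)) ->
  (forall i, measurable_fun setT (fun x => g x 0 i)) ->
  measurable_fun setT (fun x => sqn (f x - g x)).
Proof.
move=> mf mg; rewrite /sqn; apply: measurable_sum => i.
under eq_fun do rewrite !mxE; apply: measurable_funX; exact: measurable_funB.
Qed.

End MeasurabilityTools.

(** * Absolute continuity of the integral at a point, and the integral of an inverse cube *)

Section RealIntegralTools.
Context {R : realType}.
Notation mu := (@lebesgue_measure R).

Lemma integralZl_itv (a b k : R) (f : R -> \bar R) :
  measurable_fun setT f -> (forall x, 0 <= f x)%E -> 0 <= k ->
  (\int[mu]_(x in `[a, b]) (k%:E * f x) = k%:E * \int[mu]_(x in `[a, b]) f x)%E.
Proof.
move=> mf f0 k0; have mf' : measurable_fun `[a, b]%classic f by exact: measurable_funTS.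
exact: (@ge0_integralZl _ _ _ mu _ (measurable_itv _) _ mf' k%:E (fun x _ => f0 x)).
Qed.

Lemma le_integral_itv (a b : R) (f g : R -> \bar R) :
  measurable_fun setT f -> measurable_fun setT g -> (forall x, 0 <= f x)%E ->
  (forall x, (a <= x <= b)%R -> f x <= g x)%E ->
  (\int[mu]_(x in `[a, b]) f x <= \int[mu]_(x in `[a, b]) g x)%E.
Proof.
move=> mf mg f0 fg; apply: ge0_le_integral.
- exact: measurable_itv.
- by move=> x _; exact: f0.
- exact: measurable_funTS.
- exact: measurable_funTS.
- by move=> x /=; rewrite in_itv/=; exact: fg.
Qed.

Lemma le_integral_subitv (a b c d : R) (f : R -> \bar R) : c <= a -> b <= d ->
  measurable_fun setT f -> (forall x, 0 <= f x)%E ->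
  (\int[mu]_(x in `[a, b]) f x <= \int[mu]_(x in `[c, d]) f x)%E.
Proof.
move=> ca bd mf f0; apply: ge0_subset_integral.
- exact: measurable_itv.
- exact: measurable_itv.
- exact: measurable_funTS.
- by move=> x _; exact: f0.
- by apply: subset_itvScc; rewrite bnd_simp.
Qed.

(** The intervals [[- a / (n + 1), a / (n + 1)]] shrink to [{0}], a null set, so the restrictions of
    [f] tend to [0] almost everywhere while dominated by the restriction to [[- a, a]]. *)
Lemma ge0_integral_small_itv (f : R -> \bar R) (a : R) : 0 < a ->
  measurable_fun setT f -> (forall x, 0 <= f x)%E ->
  (\int[mu]_(x in `[(- a)%R, a]) f x < +oo)%E ->
  forall e, 0 < e -> exists d : R, [/\ 0 < d, d <= a &
    (\int[mu]_(x in `[(- d)%R, d]) f x < e%:E)%E].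
Proof.
move=> a0 mf f0 foo e e0.
pose A n : set R := `[- (a / n.+1%:R), a / n.+1%:R]%classic.
have an n : a / n.+1%:R <= a.
  by rewrite ler_pdivrMr// ler_peMr ?ler1n// ltW.
have AS n : A n `<=` `[- a, a].
  move=> x; rewrite /A /= !in_itv/= => /andP[xa ax].
  by rewrite (le_trans _ xa) ?(le_trans ax)// lerN2.
have mfA n : measurable_fun setT (f \_ (A n)).
  by apply/(measurable_restrictT _ _).1; [exact: measurable_itv|exact: measurable_funTS].
have cv : {ae mu, forall x, setT x -> (f \_ (A n)) x @[n --> \oo] --> 0%E}.
  exists [set 0]; split => //; first exact: lebesgue_measure_set1.
  move=> x /= H; apply: contrapT => x0; apply: H => _.
  have {}x0 : x != 0 by apply/eqP.
  apply: cvg_near_cst; near=> n; rewrite /patch memNset//= /A/= in_itv/=.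
  rewrite -ler_norml => xn.
  have : `|x| * n.+1%:R <= a by rewrite -ler_pdivlMr.
  apply/negP; rewrite -ltNge -ltr_pdivrMl ?normr_gt0// mulrC.
  rewrite (@lt_trans _ _ n%:R) ?ltr_nat//.
  by near: n; exact: nbhs_infty_gtr.
have ig : mu.-integrable setT (f \_ (`[- a, a]%classic)).
  apply/integrableP; split.
    by apply/(measurable_restrictT _ _).1 => //; exact: measurable_funTS.
  under eq_integral do rewrite gee0_abs ?erestrict_ge0//.
  by rewrite -integral_mkcond.
have dom : {ae mu, forall x n, setT x ->
    (`|(f \_ (A n)) x| <= (f \_ (`[(- a)%R, a]%classic)) x)%E}.
  apply: aeW => x n _; rewrite gee0_abs ?erestrict_ge0//.
  rewrite /patch; case: ifPn => [/set_mem xA|_]; last by case: ifPn.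
  by rewrite mem_set//; exact: AS xA.
have [_ _] := @dominated_convergence _ _ R mu setT measurableT
  (fun n => f \_ (A n)) (cst 0%E) _ mfA (measurable_cst _) cv ig dom.
rewrite integral0 => /fine_cvgP[_] /= /cvgrPdist_lt/(_ e e0)[n _ /(_ n (leqnn n))/=].
rewrite sub0r normrN -integral_mkcond => H.
have I0 : (0 <= \int[mu]_(x in A n) f x)%E by apply: integral_ge0.
have Ifin : (\int[mu]_(x in A n) f x)%E \is a fin_num.
  rewrite ge0_fin_numE//; apply: le_lt_trans foo.
  by apply: ge0_subset_integral;
    [exact: measurable_itv|by []|exact: measurable_funTS|by []|exact: AS].
exists (a / n.+1%:R); split; [by rewrite divr_gt0| exact: an|].
rewrite -/(A n) -(fineK Ifin) lte_fin (le_lt_trans _ H)// ler_norm.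
Unshelve. all: by end_near. Qed.

Lemma integral_inv_cube_le (a b : R) : 0 < a ->
  (\int[mu]_(w in `[a, b]) ((w ^+ 3)^-1)%:E <= ((2 * a ^+ 2)^-1)%:E)%E.
Proof.
move=> a0; have [ab|ba] := ltP a b; last first.
  apply: (@le_trans _ _ 0%E); last by rewrite lee_fin invr_ge0 mulr_ge0// sqr_ge0.
  rewrite (@integral_Sset1 _ _ _ a)// => x /=; rewrite in_itv/= => /andP[ax xb].
  by apply/eqP; rewrite eq_le ax (le_trans xb ba).
pose P (w : R) := - 2^-1 * (w ^+ 2)^-1.
have dP x : a <= x -> is_derive x (1 : R) P ((x ^+ 3)^-1).
  move=> ax; have x0 : x != 0 by rewrite gt_eqF// (lt_le_trans a0).
  have d2 : is_derive x (1 : R) (fun w : R => w ^+ 2) (2 * x).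
    have := is_deriveX 2 (is_derive_id x (1 : R)).
    rewrite expr1 (_ : (id ^+ 2 : R -> R) = (fun w => w ^+ 2)); last first.
      by apply/funext => w; rewrite !expr2.
    by rewrite -[_ *: _]/(_ * _) mulr1.
  have x20 : x ^+ 2 != 0 by rewrite expf_neq0.
  have := is_deriveZ (- 2^-1) (@is_deriveV _ (fun w => w ^+ 2) x (2 * x) 1 x20 d2).
  by move=> H; apply: (is_derive_eq H); rewrite /= -[_ *: _]/(_ * _) -[_ *: _]/(_ * _); field.
have cf : {within `[a, b], continuous (fun w : R => (w ^+ 3)^-1)}.
  apply: derivable_within_continuous => x; rewrite in_itv/= => /andP[ax _].
  apply: derivableV; last exact: exprn_derivable.
  by rewrite expf_neq0// gt_eqF// (lt_le_trans a0).
have cP x : a <= x -> {for x, continuous P}.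
  by move=> ax; apply/differentiable_continuous/derivable1_diffP; case: (dP x ax).
rewrite (@continuous_FTC2 _ (fun w => (w ^+ 3)^-1) P)//.
- rewrite -EFinB lee_fin /P.
  have : 0 <= (b ^+ 2)^-1 by rewrite invr_ge0 sqr_ge0.
  by rewrite invfM; lra.
- split.
  + by move=> x; rewrite in_itv/= => /andP[/ltW/dP[]].
  + by apply/cvg_at_right_filter/cP.
  + by apply/cvg_at_left_filter/cP/ltW.
- by move=> x; rewrite in_itv/= => /andP[/ltW/dP[? <-] _]; rewrite derive1E.
Qed.

Lemma ge0_integral_opp (a b : R) (f : R -> \bar R) :
  measurable_fun setT f -> (forall x, 0 <= f x)%E ->
  (\int[mu]_(x in `[a, b]) f (- x)%R = \int[mu]_(x in `[(- b)%R, (- a)%R]) f x)%E.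
Proof.
move=> mf f0; rewrite [RHS](@ge0_integral_affine_set _ (-1) 0)//; last first.
  exact: measurable_funTS.
rewrite normrN1 mul1e; under [RHS]eq_integral do rewrite mulN1r addr0.
congr (integral _ _ _); apply/seteqP; split => x /=; rewrite !in_itv/= mulN1r addr0;
  by rewrite !lerN2 andbC.
Qed.

(** Each side of the origin contributes at most [(2 * u ^+ 2)^-1], uniformly in [b]. This is the
    inner integral once Tonelli has been applied in [hardy_gap_le]. *)
Lemma integral_inv_cube_sym_le (u b : R) : u != 0 ->
  (\int[mu]_(w in `[(- b)%R, b])
     (if `|u| <= `|w| then (`|w| ^+ 3)^-1 else 0)%:E <= ((u ^+ 2)^-1)%:E)%E.
Proof.
move=> u0; have [b0|b0] := ltP b 0.
  rewrite set_itv_ge ?integral_set0; first by rewrite lee_fin invr_ge0 sqr_ge0.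
  by rewrite bnd_simp -ltNge; lra.
set f := fun w : R => (if `|u| <= `|w| then (`|w| ^+ 3)^-1 else 0)%:E.
have f0 w : (0 <= f w)%E.
  by rewrite /f lee_fin; case: ifP => // _; rewrite invr_ge0 exprn_ge0.
have mf : measurable_fun setT f.
  apply/measurable_EFinP/measurable_fun_ifT => //.
  - by apply: measurable_fun_ler => //; exact: normr_measurable.
  - by apply: measurable_invr; apply: measurable_funX; exact: normr_measurable.
have fN w : f (- w) = f w by rewrite /f normrN.
have half : (\int[mu]_(w in `[0%R, b]) f w <= ((2 * u ^+ 2)^-1)%:E)%E.
  rewrite -(real_normK (num_real u)).
  apply: le_trans (integral_inv_cube_le b _); last by rewrite normr_gt0.
  rewrite integral_mkcond [leRHS]integral_mkcond.
  apply: ge0_le_integral => //.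
  - by move=> x _; rewrite erestrict_ge0.
  - by apply/(measurable_restrictT _ _).1 => //; exact: measurable_funTS.
  - apply/(measurable_restrictT _ _).1 => //; apply: measurable_funTS.
    by apply/measurable_EFinP/measurable_invr/measurable_funX.
  - move=> x _; rewrite /patch; case: ifPn => [/set_mem/=|_].
      rewrite in_itv/= => /andP[x0 xb]; rewrite /f (ger0_norm x0).
      case: ifPn => [ux|_]; last by case: ifPn => // _; rewrite lee_fin invr_ge0 exprn_ge0.
      by rewrite mem_set//= in_itv/= ux xb.
    case: ifPn => // /set_mem/=; rewrite in_itv/= => /andP[ux _].
    by rewrite lee_fin invr_ge0 exprn_ge0// (le_trans _ ux).
rewrite (@ge0_integral_itv_cat _ (- b) 0 b) ?oppr_le0//.
have -> : (\int[mu]_(x in `[(- b)%R, 0%R]) f x = \int[mu]_(x in `[0%R, b]) f x)%E.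
  rewrite -[in LHS]oppr0 -ge0_integral_opp//.
  by apply: eq_integral => x _; rewrite fN.
apply: (le_trans (leeD half half)); rewrite -EFinD lee_fin le_eqVlt; apply/orP; left.
by apply/eqP; field.
Qed.

End RealIntegralTools.

(** * Translation gaps of the velocity and their energy *)

Section GapEnergy.
Context {R : realType} {n : nat}.
Notation mu := (@lebesgue_measure R).
Implicit Types h : R -> 'rV[R]_n.

Definition measurable_rV h : Prop :=
  forall i, measurable_fun setT (fun x => h x 0 i).

(* Mean squared translation gap, and its integral against [u ^- 2] (where
   [0 ^- 2 = 0]): the W^{1/2,2} seminorm localised at gaps at most [w]. *)
Definition shift_gap h (u : R) : \bar R :=
  (\int[mu]_(x in `[0%R, 1%R]) (sqn (h (x + u) - h x))%:E)%E.

Definition gap_energy h (w : R) : \bar R :=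
  (\int[mu]_(u in `[(- w)%R, w]) (shift_gap h u * ((u ^+ 2)^-1)%:E))%E.

Lemma measurable_rV_comp d (T : measurableType d) h (f : T -> R) :
  measurable_rV h -> measurable_fun setT f ->
  forall i, measurable_fun setT (fun x => h (f x) 0 i).
Proof. by move=> mh mf i; exact: (measurableT_comp (mh i)). Qed.

Lemma measurable_gap d (T : measurableType d) h (f g : T -> R) :
  measurable_rV h -> measurable_fun setT f -> measurable_fun setT g ->
  measurable_fun setT (fun x => (sqn (h (f x) - h (g x)))%:E).
Proof.
move=> mh mf mg; apply/measurable_EFinP.
by apply: measurable_sqnB; exact: measurable_rV_comp.
Qed.

Lemma shift_gap_ge0 h u : (0 <= shift_gap h u)%E.
Proof. by apply: integral_ge0 => x _; rewrite lee_fin sqn_ge0. Qed.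

Lemma shift_gap0 h : shift_gap h 0 = 0%E.
Proof.
by apply: integral0_eq => x _; rewrite addr0 subrr sqn0.
Qed.

Lemma measurable_shift_gap h : measurable_rV h -> measurable_fun setT (shift_gap h).
Proof.
move=> mh.
apply: (@measurable_integral_snd _ _ _ _ R mu `[0%R, 1%R]%classic
  (fun p : R * R => (sqn (h (p.2 + p.1) - h p.2))%:E)) => //.
- apply: measurable_gap => //; exact: measurable_funD.
- by move=> z; rewrite lee_fin sqn_ge0.
Qed.

Lemma shift_gap_translate h a u : measurable_rV h -> periodic h 1 ->
  (\int[mu]_(x in `[0%R, 1%R]) (sqn (h (x + a + u) - h (x + a)))%:E)%E = shift_gap h u.
Proof.
move=> mh ph.
rewrite (@ge0_integral_periodic_shift _ a
  (fun x => (sqn (h (x + u) - h x))%:E))//.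
- by apply: measurable_gap => //; exact: measurable_funD.
- by move=> x; rewrite lee_fin sqn_ge0.
- by move=> x; rewrite addrAC !ph.
Qed.

Lemma shift_gap_period h a u : measurable_rV h -> periodic h 1 ->
  (\int[mu]_(x in `[a, (a + 1)%R]) (sqn (h (x + u) - h x))%:E)%E = shift_gap h u.
Proof.
move=> mh ph.
rewrite (@ge0_integral_period _ a (fun x => (sqn (h (x + u) - h x))%:E))//.
- by apply: measurable_gap => //; exact: measurable_funD.
- by move=> x; rewrite lee_fin sqn_ge0.
- by move=> x; rewrite addrAC !ph.
Qed.

Lemma shift_gapN h u : measurable_rV h -> periodic h 1 ->
  shift_gap h (- u) = shift_gap h u.
Proof.
move=> mh ph; rewrite -(shift_gap_translate (- u) u mh ph).
by apply: eq_integral => x _; rewrite subrK sqnB.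
Qed.

Lemma shift_gap_abs h u : measurable_rV h -> periodic h 1 ->
  shift_gap h `|u| = shift_gap h u.
Proof.
move=> mh ph; have [u0|u0] := leP 0 u; first by rewrite ger0_norm.
by rewrite ltr0_norm//; exact: shift_gapN.
Qed.

Let gap_integrand_ge0 h u : (0 <= shift_gap h u * ((u ^+ 2)^-1)%:E)%E.
Proof. by rewrite mule_ge0 ?shift_gap_ge0// lee_fin invr_ge0 sqr_ge0. Qed.

Let measurable_gap_integrand h : measurable_rV h ->
  measurable_fun setT (fun u => shift_gap h u * ((u ^+ 2)^-1)%:E)%E.
Proof.
move=> mh; apply: emeasurable_funM; first exact: measurable_shift_gap.
by apply/measurable_EFinP/measurable_invr/measurable_funX.
Qed.

Lemma gap_energy_ge0 h w : (0 <= gap_energy h w)%E.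
Proof. exact: integral_ge0. Qed.

Lemma gap_energy_le h w v : measurable_rV h -> w <= v ->
  (gap_energy h w <= gap_energy h v)%E.
Proof.
move=> mh wv; apply: ge0_subset_integral => //.
- by apply: measurable_funTS; exact: measurable_gap_integrand.
- move=> x /=; rewrite !in_itv/= => /andP[wx xw].
  by rewrite (le_trans _ wx) ?(le_trans xw)// lerN2.
Qed.

Lemma gap_energy_mono h k w (c : R) : measurable_rV h -> measurable_rV k -> 0 <= c ->
  (forall u, shift_gap h u <= c%:E * shift_gap k u)%E ->
  (gap_energy h w <= c%:E * gap_energy k w)%E.
Proof.
move=> mh mk c0 hk; rewrite /gap_energy -ge0_integralZl//.
- apply: ge0_le_integral => //.
  + by apply: measurable_funTS; exact: measurable_gap_integrand.
  + by apply: measurable_funeM; apply: measurable_funTS; exact: measurable_gap_integrand.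
  + by move=> u _; rewrite muleA lee_wpmul2r// lee_fin invr_ge0 sqr_ge0.
- by apply: measurable_funTS; exact: measurable_gap_integrand.
Qed.

Lemma gap_energy_small h w : measurable_rV h -> 0 < w ->
  (gap_energy h w < +oo)%E -> forall e, 0 < e ->
  exists d : R, [/\ 0 < d, d <= w & (gap_energy h d < e%:E)%E].
Proof.
by move=> mh w0 foo; apply: ge0_integral_small_itv => //; exact: measurable_gap_integrand.
Qed.

(** With [t = s + u] one has [|u| <= w], so [1 <= w ^+ 2 / u ^+ 2]; enlarging the range of [s] to a
    full period then turns the inner integral into [shift_gap h u]. *)
Lemma square_gap_le h a w : measurable_rV h -> periodic h 1 -> 0 <= w <= 1 ->
  (\int[mu]_(s in `[a, (a + w)%R]) \int[mu]_(t in `[a, (a + w)%R])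
     (sqn (h t - h s))%:E <= (w ^+ 2)%:E * gap_energy h w)%E.
Proof.
move=> mh ph /andP[w0 w1].
pose k (p : R * R) := ((w ^+ 2)%:E * (((p.2 ^+ 2)^-1)%:E *
   (sqn (h (p.1 + p.2)%R - h p.1))%:E))%E.
have k0 p : (0 <= k p)%E.
  by rewrite /k !mule_ge0// lee_fin ?sqn_ge0 ?invr_ge0 ?sqr_ge0.
have mk : measurable_fun setT k.
  apply: emeasurable_funM => //; apply: emeasurable_funM.
    by apply/measurable_EFinP/measurable_invr/measurable_funX.
  by apply: measurable_gap => //; exact: measurable_funD.
have mS : measurable_fun setT (fun s =>
    \int[mu]_(u in `[(- w)%R, w]) k (s, u))%E.
  exact: (@measurable_integral_snd _ _ _ _ R mu).
apply: (@le_trans _ _ (\int[mu]_(s in `[a, (a + w)%R])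
    \int[mu]_(u in `[(- w)%R, w]) k (s, u))%E).
  apply: ge0_le_integral => //.
  - by move=> s _; apply: integral_ge0 => t _; rewrite lee_fin sqn_ge0.
  - apply: measurable_funTS.
    apply: (@measurable_integral_snd _ _ _ _ R mu _
      (fun p : R * R => (sqn (h p.2 - h p.1))%:E)) => //.
    + exact: measurable_gap.
    + by move=> z; rewrite lee_fin sqn_ge0.
  - exact: measurable_funTS.
  - move=> s /=; rewrite in_itv/= => /andP[as_ sw].
    have -> : (\int[mu]_(t in `[a, (a + w)%R]) (sqn (h t - h s))%:E =
        \int[mu]_(u in `[(a - s)%R, (a + w - s)%R]) (sqn (h (u + s)%R - h s))%:E)%E.
      rewrite (@ge0_integral_shift _ s _ _ (fun t => (sqn (h t - h s))%:E)) ?subrK//.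
      - exact: measurable_gap.
      - by move=> z; rewrite lee_fin sqn_ge0.
    have mg : measurable_fun setT (fun u : R => (sqn (h (u + s)%R - h s))%:E).
      by apply: measurable_gap => //; exact: measurable_funD.
    apply: (@le_trans _ _ (\int[mu]_(u in `[(- w)%R, w]) (sqn (h (u + s)%R - h s))%:E)%E).
      apply: ge0_subset_integral => //.
      - exact: measurable_funTS.
      - by move=> x _; rewrite lee_fin sqn_ge0.
      - by move=> x /=; rewrite !in_itv/= => /andP[? ?]; apply/andP; split; lra.
    apply: ge0_le_integral => //.
    - by move=> x _; rewrite lee_fin sqn_ge0.
    - exact: measurable_funTS.
    - by apply: measurable_funTS; apply: measurableT_comp mk _; exact: measurable_fun_pair.
    - move=> u /=; rewrite in_itv/= => /andP[wu uw]; rewrite /k/= [s + u]addrC -!EFinM lee_fin.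
      (* At [u = 0] the weight [(u ^+ 2)^-1] is [0] by convention, which is harmless because the gap
         vanishes too. *)
      have [->|u0] := eqVneq u 0; first by rewrite add0r subrr sqn0 !mulr0.
      rewrite mulrA -[leLHS]mul1r ler_wpM2r ?sqn_ge0//.
      rewrite ler_pdivlMr ?exprn_even_gt0// mul1r -(real_normK (num_real u)).
      by rewrite lerXn2r ?nnegrE// ler_norml wu.
apply: (@le_trans _ _ (\int[mu]_(s in `[a, (a + 1)%R])
    \int[mu]_(u in `[(- w)%R, w]) k (s, u))%E).
  apply: ge0_subset_integral => //.
  - exact: measurable_funTS.
  - by move=> s _; exact: integral_ge0.
  - by move=> x /=; rewrite !in_itv/= => /andP[-> ?] /=; lra.
rewrite (@tonelli_in _ _ _ _ R mu mu)// /gap_energy.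
have mG : measurable_fun `[- w, w]%classic (fun u => shift_gap h u * ((u ^+ 2)^-1)%:E)%E.
  by apply: measurable_funTS; exact: measurable_gap_integrand.
rewrite -(@ge0_integralZl _ _ _ mu _ (measurable_itv _) _ mG); last 2 first.
- by move=> u _; exact: gap_integrand_ge0.
- by rewrite lee_fin sqr_ge0.
apply: (@ge0_le_integral _ _ _ mu _ (measurable_itv _)).
- by move=> u _; exact: integral_ge0.
- apply: measurable_funTS.
  apply: (@measurable_integral_snd _ _ _ _ R mu _ (fun p => k (p.2, p.1)) (measurable_itv _));
    last by move=> p; exact: k0.
  by apply: measurableT_comp mk _; exact: measurable_fun_pair.
- by apply: measurable_funeM; apply: measurable_funTS; exact: measurable_gap_integrand.
- move=> u _; rewrite /k/=.
  have mg : measurable_fun setT (fun x : R => (sqn (h (x + u)%R - h x))%:E).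
    by apply: measurable_gap => //; exact: measurable_funD.
  have g0 x : (0 <= (sqn (h (x + u)%R - h x))%:E)%E by rewrite lee_fin sqn_ge0.
  have u0 : 0 <= (u ^+ 2)^-1 by rewrite invr_ge0 sqr_ge0.
  rewrite integralZl_itv ?sqr_ge0//; last 2 first.
  - exact: measurable_funeM.
  - by move=> x; rewrite mule_ge0.
  rewrite integralZl_itv//.
  by rewrite shift_gap_period// [X in (_ * X <= _)%E]muleC.
Qed.

(* Tonelli and [\int_{|w| >= |u|} |w| ^- 3 dw = u ^- 2]. *)
Lemma hardy_gap_le h d : measurable_rV h ->
  (\int[mu]_(w in `[(- d)%R, d])
     (((`|w| ^+ 3)^-1)%:E * \int[mu]_(u in `[(- `|w|)%R, `|w|%R]) shift_gap h u) <=
   gap_energy h d)%E.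
Proof.
move=> mh.
pose c (w u : R) := if `|u| <= `|w| then (`|w| ^+ 3)^-1 else 0.
pose k (p : R * R) := ((c p.1 p.2)%:E * shift_gap h p.2)%E.
have c0 w u : 0 <= c w u.
  by rewrite /c; case: ifP => // _; rewrite invr_ge0 exprn_ge0.
have mc : measurable_fun setT (fun p : R * R => c p.1 p.2).
  apply: measurable_fun_ifT => //.
  - by apply: measurable_fun_ler; exact: measurableT_comp.
  - by apply: measurable_invr; apply: measurable_funX; exact: measurableT_comp.
have k0 p : (0 <= k p)%E by rewrite mule_ge0 ?shift_gap_ge0// lee_fin.
have mk : measurable_fun setT k.
  apply: emeasurable_funM; first exact/measurable_EFinP.
  by apply: measurableT_comp; [exact: measurable_shift_gap|].
have mF := measurable_shift_gap mh.
apply: (@le_trans _ _ (\int[mu]_(w in `[(- d)%R, d])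
    \int[mu]_(u in `[(- d)%R, d]) k (w, u))%E).
  rewrite le_eqVlt; apply/orP; left; apply/eqP; apply: eq_integral => w.
  rewrite inE/= in_itv/= => /andP[dw wd].
  have mFw : measurable_fun `[- `|w|, `|w|]%classic (shift_gap h).
    exact: measurable_funTS.
  rewrite -(@ge0_integralZl _ _ _ mu _ (measurable_itv _) _ mFw _
    (fun u _ => shift_gap_ge0 h u)); last by rewrite lee_fin invr_ge0 exprn_ge0.
  rewrite integral_mkcond [RHS]integral_mkcond; apply: eq_integral => u _.
  rewrite /patch /k /c/=; have -> : (u \in `[- `|w|, `|w|]%classic) = (`|u| <= `|w|).
    by apply/idP/idP; rewrite inE/= in_itv/= ler_norml.
  case: ifPn => uw; last by rewrite mul0e if_same.
  rewrite mem_set//= in_itv/= -ler_norml (le_trans uw)// ler_norml dw.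
  by rewrite wd.
rewrite (@tonelli_in _ _ _ _ R mu mu)//.
apply: (@ge0_le_integral _ _ _ mu _ (measurable_itv _)).
- by move=> u _; exact: integral_ge0.
- apply: measurable_funTS.
  apply: (@measurable_integral_snd _ _ _ _ R mu _ (fun p => k (p.2, p.1)) (measurable_itv _));
    last by move=> p; exact: k0.
  by apply: measurableT_comp mk _; exact: measurable_fun_pair.
- by apply: measurable_funTS; exact: measurable_gap_integrand.
- move=> u _; rewrite /k/=.
  rewrite ge0_integralZr//; last 3 first.
  - apply/measurable_funTS/measurable_EFinP.
    rewrite -[X in measurable_fun _ X]/((fun p : R * R => c p.1 p.2) \o (fun x : R => (x, u))).
    by apply: measurableT_comp mc _; exact: measurable_fun_pair.
  - by move=> x _; rewrite lee_fin.
  - exact: shift_gap_ge0.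
  (* The bound on the inverse cube requires [u != 0]; at [u = 0] the factor [shift_gap h 0] is
     zero. *)
  have [->|u0] := eqVneq u 0; first by rewrite shift_gap0 mule0 mul0e.
  by rewrite muleC lee_wpmul2l ?shift_gap_ge0//; exact: integral_inv_cube_sym_le.
Qed.

End GapEnergy.

(** * Translation of real-valued integrals *)

Section RealIntegralShift.
Context {R : realType}.
Notation mu := (@lebesgue_measure R).

Lemma Rintegral_shift (c : R) (f : R -> R) : measurable_fun setT f ->
  \int[mu]_x f (x + c) = \int[mu]_x f x.
Proof.
(* A translation is the composite of two reflections. *)
move=> mf; rewrite [RHS](integral_comp_opp_shift c)//.
rewrite (integral_comp_opp_shift 0); last first.
  by apply: measurableT_comp => //; exact: measurable_funD.
by apply: eq_Rintegral => x _; rewrite sub0r addrC.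
Qed.

Lemma Rintegral_itv_shift (a b c : R) (f : R -> R) : measurable_fun setT f ->
  \int[mu]_x (f (x + c) * \1_`[a, b] x) = \int[mu]_x (f x * \1_`[a + c, b + c] x).
Proof.
move=> mf; rewrite -[RHS](Rintegral_shift c); last first.
  by apply: measurable_funM => //; exact: measurable_indic.
apply: eq_Rintegral => x _; congr (_ * _); rewrite !indicE; congr (_%:R).
by congr nat_of_bool; apply/idP/idP; rewrite !inE/= !in_itv/= !lerD2r.
Qed.

Lemma integral_itv_indic (f : R -> R) (a b : R) :
  (\int[mu]_(x in `[a, b]) (f x)%:E = \int[mu]_x (f x * \1_`[a, b] x)%:E)%E.
Proof.
rewrite [LHS]integral_mkcond; apply: eq_integral => t _.
by rewrite /patch indicE; case: ifPn => _ /=; rewrite ?mulr1 ?mulr0.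
Qed.

Lemma Rintegral_indic_mass (a b : R) : a <= b -> \int[mu]_x (\1_`[a, b] x : R) = b - a.
Proof.
move=> ab; have := @Rintegral_indic_itv R (fun=> 1) a b.
under eq_Rintegral do rewrite mul1r.
move=> ->; rewrite Rintegral_cst//= mul1r lebesgue_measure_itv/= lte_fin.
by case: ltgtP ab => // ->; rewrite subrr.
Qed.

End RealIntegralShift.

(** * Chords as averages of the velocity *)

Section Velocity.
Context {R : realType} {n : nat}.
Notation mu := (@lebesgue_measure R).
Implicit Types h z : R -> 'rV[R]_n.

Lemma bounded_measurable_rV_measurable h :
  bounded_measurable_rV h -> measurable_rV h.
Proof. by move=> bh i; case: (bh i). Qed.

(** For every reference point [s] the left side [K] is at most [m] times the [rho]-mean of
    [|h - h s|^2]. Averaging over [s] in [[a, a + w]] produces the double integral of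
    [square_gap_le]. The lemma serves twice: with an indicator for chords, with a mollifier for the
    speed of the mollified curve. *)
Lemma weighted_mean_gap h (rho : R -> R) (a w L c2 : R) :
  bounded_measurable_rV h -> periodic h 1 -> weight rho ->
  0 < w <= 1 -> 0 <= L -> (forall x, rho x <= L * \1_`[a, a + w] x) ->
  (forall x, c2 <= sqn (h x)) ->
  (((\int[mu]_x rho x) ^+ 2 * c2 - sqn (wmean rho h))%:E <=
   ((\int[mu]_x rho x) * L * w)%:E * gap_energy h w)%E.
Proof.
move=> bh ph wr /andP[w0 w1] L0 rhoL hc; set m := Rintegral _ _ _.
have mh := bounded_measurable_rV_measurable bh.
have m0 : 0 <= m by apply: Rintegral_ge0 => x _; case: wr.
set K := _ - _.
(* The averaging over [s] below compares integrals of nonnegative functions, hence the separate case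
   [K <= 0]. *)
have [K0|K0] := leP K 0.
  apply: (@le_trans _ _ 0%E); first by rewrite lee_fin.
  by rewrite mule_ge0 ?gap_energy_ge0// lee_fin !mulr_ge0// ltW.
have bq : bounded_measurable (fun x => sqn (h x)) by exact: bounded_measurable_sqn.
have mc2 : m * c2 <= \int[mu]_x (sqn (h x) * rho x).
  have -> : m * c2 = \int[mu]_x (c2 * rho x).
    by rewrite RintegralZl ?(mulrC m)//; case: wr.
  apply: le_Rintegral => //.
  - exact/weighted_integrable/bounded_measurable_cst.
  - exact: weighted_integrable.
  - by move=> x _; rewrite ler_wpM2r//; case: wr.
have Ks s : (K%:E <= (m * L)%:E * \int[mu]_(t in `[a, (a + w)%R]) (sqn (h t - h s))%:E)%E.
  have bs : bounded_measurable (fun t => sqn (h t - h s)).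
    exact/bounded_measurable_sqn/bounded_measurable_rVB.
  have KV : K <= m * \int[mu]_x (sqn (h x - h s) * rho x).
    apply: le_trans (weighted_variance_le (h s) wr bh).
    by rewrite /K lerB// expr2 -mulrA ler_wpM2l.
  apply: (@le_trans _ _ (m * \int[mu]_x (sqn (h x - h s) * rho x))%:E).
    by rewrite lee_fin.
  rewrite [leRHS](_ : _ = (m * (L * \int[mu]_x (sqn (h x - h s) * \1_`[a, a + w] x)))%:E).
    rewrite lee_fin ler_wpM2l// -RintegralZl//; last first.
      exact: (weighted_integrable (weight_indic _ _)).
    apply: le_Rintegral => //.
    - exact: weighted_integrable.
    - have := integrableZl measurableT L (weighted_integrable (weight_indic a (a + w)) bs).
      by apply: eq_integrable.
    - by move=> x _; rewrite mulrCA ler_wpM2l// sqn_ge0.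
  rewrite [X in _ = X%:E]mulrA [RHS]EFinM EFin_Rintegral//; last exact: weight_indic.
  by rewrite integral_itv_indic.
have mD : measurable_fun setT (fun p : R * R => (sqn (h p.2 - h p.1))%:E).
  exact: measurable_gap.
have mI : measurable_fun setT
    (fun s => \int[mu]_(t in `[a, (a + w)%R]) (sqn (h t - h s))%:E)%E.
  apply: (@measurable_integral_snd _ _ _ _ R mu _
    (fun p : R * R => (sqn (h p.2 - h p.1))%:E)) => //.
  by move=> z; rewrite lee_fin sqn_ge0.
have I0 s : (0 <= \int[mu]_(t in `[a, (a + w)%R]) (sqn (h t - h s))%:E)%E.
  by apply: integral_ge0 => t _; rewrite lee_fin sqn_ge0.
have Kw : ((K * w)%:E <= (m * L)%:E * ((w ^+ 2)%:E * gap_energy h w))%E.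
  apply: le_trans (lee_wpmul2l _ (square_gap_le a mh ph _)); last 2 first.
  - by rewrite lee_fin mulr_ge0.
  - by rewrite ltW.
  rewrite -integralZl_itv ?mulr_ge0//.
  have -> : (K * w)%:E = (\int[mu]_(s in `[a, (a + w)%R]) K%:E)%E.
    rewrite integral_cst//= lebesgue_measure_itv/= lte_fin ltrDl w0.
    by rewrite -EFinB addrAC subrr add0r.
  apply: le_integral_itv => //.
  - by apply: measurable_funeM.
  - by move=> x; rewrite lee_fin ltW.
rewrite -(@lee_pmul2l _ w%:E) ?lte_fin// -EFinM mulrC (le_trans Kw)//.
by rewrite le_eqVlt; apply/orP; left; apply/eqP; rewrite !muleA -!EFinM;
  congr (_%:E * _)%E; ring.
Qed.

(** [h] is a version of the derivative that is total, bounded and periodic, so that suprema and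
    translations make sense pointwise; only the last clause involves a null set. *)
Definition velocity z h : Prop :=
  [/\ closed_lipschitz z, periodic h 1, bounded_measurable_rV h &
      {ae mu, forall x, derivable z x 1 /\ derive1 z x = h x}].

Lemma coord_sqr_le (v : 'rV[R]_n) i : v 0 i ^+ 2 <= sqn v.
Proof.
by rewrite /sqn (bigD1 i)//= lerDl; apply: sumr_ge0 => j _; exact: sqr_ge0.
Qed.

Lemma coord_le_enorm (v : 'rV[R]_n) i : `|v 0 i| <= enorm v.
Proof. by rewrite -sqrtr_sqr ler_sqrt ?sqn_ge0// coord_sqr_le. Qed.

Lemma chordE z h a b : velocity z h -> a <= b -> z b - z a = wmean (\1_`[a, b]) h.
Proof.
move=> [[_ [K zK]] _ bh dz] ab; apply/rowP => i; rewrite !mxE.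
rewrite Rintegral_indic_itv (@lipschitz_FTC _ (fun t => z t 0 i) _ K)//.
  move=> s t; have := zK s t; apply: le_trans.
  by have := coord_le_enorm (z s - z t) i; rewrite !mxE.
by apply: ae_imply dz => x /is_derive_rV.
Qed.

Lemma chord_variance z h a b c : velocity z h -> a <= b ->
  (b - a) * \int[mu]_x (sqn (h x) * \1_`[a, b] x) - sqn (z b - z a) <=
  (b - a) * \int[mu]_x (sqn (h x - c) * \1_`[a, b] x).
Proof.
move=> vz ab; rewrite (chordE vz ab).
have := @weighted_variance_le _ _ _ h c (weight_indic a b).
by rewrite Rintegral_indic_mass//; apply; case: vz.
Qed.

(** [weighted_mean_gap] for the indicator of [[a, a + w]]. Once the gap energy at scale [w] is below
    [c2], this is a lower bound on chords proportional to [w]. *)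
Lemma chord_ge z h a w c2 : velocity z h -> 0 < w <= 1 ->
  (forall x, c2 <= sqn (h x)) ->
  ((w ^+ 2 * c2)%:E <= (sqn (z (a + w) - z a))%:E + (w ^+ 2)%:E * gap_energy h w)%E.
Proof.
move=> vz /[dup] w01 /andP[w0 w1] hc; have [_ ph bh _] := vz.
have aw : a <= a + w by rewrite lerDl ltW.
have := @weighted_mean_gap h _ a w 1 c2 bh ph (weight_indic a (a + w)) w01 ler01 _ hc.
rewrite Rintegral_indic_mass// -(chordE vz)// [a + w - a]addrAC subrr add0r mulr1 -expr2.
move=> H; rewrite addeC -leeBlDr// -EFinB; apply: H => x.
by rewrite mul1r.
Qed.

Lemma wmeanD rho h k : weight rho -> bounded_measurable_rV h -> bounded_measurable_rV k ->
  wmean rho (fun x => h x + k x) = wmean rho h + wmean rho k.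
Proof.
move=> wr bh bk; apply/rowP => i; rewrite !mxE -RintegralD//; last 2 first.
- exact: weighted_integrable.
- exact: weighted_integrable.
by apply: eq_Rintegral => x _; rewrite mxE mulrDl.
Qed.

(* Cauchy-Schwarz on the sum of the two halves of the arc, and the
   parallelogram law for the unit vectors [h x] and [h (x + v)]. *)
Lemma half_chord_gap z h a v : velocity z h -> 0 < v -> (forall x, sqn (h x) = 1) ->
  v * \int[mu]_x (sqn (h (x + v) - h x) * \1_`[a, a + v] x) <=
  (2 * v) ^+ 2 - sqn (z (a + 2 * v) - z a).
Proof.
move=> vz v0 h1; have [_ ph bh _] := vz.
pose k x := h (x + v).
have bk : bounded_measurable_rV k.
  by move=> i; apply: bounded_measurable_comp (bh i); exact: measurable_funD.
have wr := weight_indic a (a + v).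
have av : a <= a + v by rewrite lerDl ltW.
have av2 : a + v <= a + v + v by rewrite lerDl ltW.
have E : z (a + 2 * v) - z a = wmean (\1_`[a, a + v]) (fun x => h x + k x).
  rewrite wmeanD// -(chordE vz)//.
  have -> : wmean (\1_`[a, a + v]) k = wmean (\1_`[a + v, a + v + v]) h.
    apply/rowP => i; rewrite !mxE (@Rintegral_itv_shift _ _ _ _ (fun x => h x 0 i))//.
    by case: (bh i).
  rewrite -(chordE vz)// (_ : a + 2 * v = a + v + v); last by ring.
  by apply/rowP => i; rewrite !mxE; ring.
have bs : bounded_measurable_rV (fun x => h x + k x).
  by move=> i; under eq_fun do rewrite mxE; exact: bounded_measurableD.
have bd : bounded_measurable (fun x => sqn (k x - h x)).
  apply: bounded_measurable_sqn => i; under eq_fun do rewrite !mxE.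
  exact: bounded_measurableB.
have := sqn_wmean_le wr bs; rewrite Rintegral_indic_mass//.
rewrite -E [a + v - a]addrAC subrr add0r => /(_ v0) H.
have P x : sqn (h x + k x) = 4 - sqn (k x - h x).
  have -> : sqn (h x + k x) = 2 * sqn (h x) + 2 * sqn (k x) - sqn (k x - h x).
    rewrite /sqn !mulr_sumr -big_split/= -sumrB; apply: eq_bigr => i _.
    by rewrite !mxE; ring.
  by rewrite /k !h1; ring.
have I : \int[mu]_x (sqn (h x + k x) * \1_`[a, a + v] x) =
    4 * v - \int[mu]_x (sqn (k x - h x) * \1_`[a, a + v] x).
  have -> : 4 * v = \int[mu]_x (4 * \1_`[a, a + v] x).
    rewrite RintegralZl//; last by case: wr.
    by rewrite Rintegral_indic_mass// [a + v - a]addrAC subrr add0r.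
  rewrite -RintegralB//; last 2 first.
  - exact/weighted_integrable/bounded_measurable_cst.
  - exact: weighted_integrable.
  by apply: eq_Rintegral => x _; rewrite P mulrBl.
rewrite I in H.
rewrite lerBrDr (le_trans (lerD (lexx _) H))// /k.
by rewrite le_eqVlt; apply/orP; left; apply/eqP; ring.
Qed.

End Velocity.

(** * Cauchy-Schwarz and triangle inequality for the Euclidean norm *)

Section EuclideanNorm.
Context {R : realType} {n : nat}.
Implicit Types u v : 'rV[R]_n.

Lemma sqn_eq0 v : sqn v = 0 -> v = 0.
Proof.
move=> v0; apply/rowP => i; rewrite mxE; apply/eqP; rewrite -sqrf_eq0 eq_le sqr_ge0.
by rewrite andbT -v0 coord_sqr_le.
Qed.

Lemma enormN v : enorm (- v) = enorm v.
Proof. by rewrite !enormE sqnN. Qed.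

Lemma enorm_eq0 v : enorm v = 0 -> v = 0.
Proof. by move=> v0; apply: sqn_eq0; rewrite -enorm_sqr v0 expr0n. Qed.

Lemma dot_le_enorm u v : \sum_(i < n) u 0 i * v 0 i <= enorm u * enorm v.
Proof.
have [u0|u0] := eqVneq (enorm u) 0.
  rewrite u0 mul0r (enorm_eq0 u0) big1// => i _; by rewrite mxE mul0r.
have [v0|v0] := eqVneq (enorm v) 0.
  rewrite v0 mulr0 (enorm_eq0 v0) big1// => i _; by rewrite mxE mulr0.
have uv : 0 < enorm u * enorm v by rewrite mulr_gt0// lt_def enorm_ge0 ?u0 ?v0.
set d := \sum_(i < n) _.
(* Both rescaled vectors have norm [|u| |v|], so expanding this square gives Cauchy-Schwarz after
   division by [2 |u| |v|]. *)
have : 0 <= sqn (enorm v *: u - enorm u *: v) by exact: sqn_ge0.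
have -> : sqn (enorm v *: u - enorm u *: v) =
    enorm v ^+ 2 * sqn u + enorm u ^+ 2 * sqn v - (enorm u * enorm v) *+ 2 * d.
  rewrite /sqn /d !mulr_sumr -big_split/= -sumrB; apply: eq_bigr => i _.
  by rewrite !mxE; ring.
rewrite -!enorm_sqr => H.
rewrite -(ler_pM2l uv) -subr_ge0.
by move: H; rewrite mulr2n; set a := enorm u; set b := enorm v; lra.
Qed.

Lemma sqnD u v : sqn (u + v) = sqn u + 2 * \sum_(i < n) u 0 i * v 0 i + sqn v.
Proof.
rewrite /sqn mulr_sumr -!big_split/=; apply: eq_bigr => i _; rewrite mxE; ring.
Qed.

Lemma enormD u v : enorm (u + v) <= enorm u + enorm v.
Proof.
rewrite -(@ler_pXn2r _ 2)// ?nnegrE ?addr_ge0 ?enorm_ge0//.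
rewrite enorm_sqr sqnD -!enorm_sqr sqrrD.
by have := dot_le_enorm u v; lra.
Qed.

Lemma enormB u v : enorm (u - v) <= enorm u + enorm v.
Proof. by rewrite -(enormN v) enormD. Qed.

Lemma ler_dist_enorm u v : `|enorm u - enorm v| <= enorm (u - v).
Proof.
rewrite ler_norml; apply/andP; split.
  have := enormD (v - u) u; rewrite subrK -opprB enormN; lra.
by have := enormD (u - v) v; rewrite subrK; lra.
Qed.

End EuclideanNorm.

(** * Fractional parts and integer periods *)

Section Fract.
Context {R : realType}.

Lemma period_int (V : Type) (f : R -> V) (z : int) (x : R) :
  (forall x, f (x + 1) = f x) -> f (x + z%:~R) = f x.
Proof.
move=> pf; have fn (m : nat) t : f (t + m%:R) = f t.
  by elim: m => [|m IHm]; rewrite ?addr0// -natr1 addrA pf.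
case: z => m; first exact: fn.
by rewrite -(fn m.+1) NegzE mulrNz subrK.
Qed.

Lemma fract_itv (t : R) : 0 <= fract t < 1.
Proof.
by rewrite /fract subr_ge0 ltrBlDr floor_le addrC; have := floorD1_gt t; rewrite intrD.
Qed.

Lemma fract_id (t : R) : 0 <= t < 1 -> fract t = t.
Proof.
move=> t01; rewrite /fract (_ : Num.floor t = 0) ?subr0//.
by apply/eqP; rewrite floor_eq.
Qed.

Lemma fract_int (t : R) (z : int) : fract (t + z%:~R) = fract t.
Proof. by rewrite /fract floorDrz ?intr_int// intrKfloor intrD; ring. Qed.

Lemma fract1 (t : R) : fract (t + 1) = fract t.
Proof. exact: (fract_int t 1). Qed.

Lemma fractE (t : R) : exists z : int, fract t = t + z%:~R.
Proof. by exists (- Num.floor t); rewrite mulrNz. Qed.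

Lemma measurable_fract d (T : measurableType d) (f : T -> R) :
  measurable_fun setT f -> measurable_fun setT (fun x => fract (f x)).
Proof.
move=> mf; have mfr : measurable_fun setT (@fract R).
  apply: measurable_funB => //; apply: nondecreasing_measurable => // x y xy.
  by rewrite ler_int le_floor.
exact: measurableT_comp mfr mf.
Qed.

End Fract.

(** * Arc length against chord length *)

Section Arcs.
Context {R : realType} {n : nat}.
Notation mu := (@lebesgue_measure R).
Implicit Types h z : R -> 'rV[R]_n.

Definition arc_real h (a b : R) : R := \int[mu]_t (enorm (h t) * \1_`[a, b] t).

Lemma bounded_measurable_enorm h :
  bounded_measurable_rV h -> bounded_measurable (fun x => enorm (h x)).
Proof.
move=> bh; have [mq [M qM]] := bounded_measurable_sqn bh; split.
  apply: measurableT_comp mq; apply: continuous_measurable_fun.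
  exact: sqrt_continuous.
exists (Num.sqrt M) => x; rewrite ger0_norm ?enorm_ge0// enormE ler_wsqrtr//.
exact: le_trans (ler_norm _) (qM x).
Qed.

Lemma arc_realE h a b : bounded_measurable_rV h ->
  (\int[mu]_(t in `[a, b]) (enorm (h t))%:E)%E = (arc_real h a b)%:E.
Proof.
move=> bh; rewrite integral_itv_indic EFin_Rintegral//; first exact: weight_indic.
exact: bounded_measurable_enorm.
Qed.

Lemma arc_length_velocity z h a b : velocity z h -> arc_length z a b = (arc_real h a b)%:E.
Proof.
move=> [_ _ bh dz]; rewrite -arc_realE//; apply: eq_integral_ae.
by apply: ae_imply dz => x [_ ->] _.
Qed.

Lemma arc_real_ge0 h a b : 0 <= arc_real h a b.
Proof. by apply: Rintegral_ge0 => x _; rewrite mulr_ge0// enorm_ge0. Qed.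

Lemma arc_real_le h a b c : bounded_measurable_rV h -> a <= b ->
  (forall x, enorm (h x) <= c) -> arc_real h a b <= c * (b - a).
Proof.
move=> bh ab hc; rewrite -(Rintegral_indic_mass ab) -RintegralZl//; last first.
  by case: (weight_indic a b).
apply: le_Rintegral => //.
- exact: (weighted_integrable (weight_indic a b) (bounded_measurable_enorm bh)).
- exact: (weighted_integrable (weight_indic a b) (bounded_measurable_cst c)).
- by move=> x _; rewrite ler_wpM2r.
Qed.

Lemma arc_real_ge h a b c : bounded_measurable_rV h -> a <= b ->
  (forall x, c <= enorm (h x)) -> c * (b - a) <= arc_real h a b.
Proof.
move=> bh ab hc; rewrite -(Rintegral_indic_mass ab) -RintegralZl//; last first.
  by case: (weight_indic a b).
apply: le_Rintegral => //.
- exact: (weighted_integrable (weight_indic a b) (bounded_measurable_cst c)).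
- exact: (weighted_integrable (weight_indic a b) (bounded_measurable_enorm bh)).
- by move=> x _; rewrite ler_wpM2r.
Qed.

(** Pairing with the mean [H] itself gives [|H|^2], the integral of the scalar products of [H] and
    [h x], which Cauchy-Schwarz bounds by [|H|] times the right side. *)
Lemma enorm_wmean_le (rho : R -> R) h : weight rho -> bounded_measurable_rV h ->
  enorm (wmean rho h) <= \int[mu]_x (enorm (h x) * rho x).
Proof.
move=> wr bh; set H := wmean rho h; set I := Rintegral _ _ _.
have I0 : 0 <= I.
  by apply: Rintegral_ge0 => x _; rewrite mulr_ge0 ?enorm_ge0//; case: wr.
have [->//|H0] := eqVneq (enorm H) 0.
have {}H0 : 0 < enorm H by rewrite lt_def H0 enorm_ge0.
rewrite -(ler_pM2l H0) -expr2 enorm_sqr.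
have be := bounded_measurable_enorm bh.
have bd i : bounded_measurable (fun x => H 0 i * h x 0 i).
  by apply: bounded_measurableM => //; exact: bounded_measurable_cst.
have -> : sqn H = \int[mu]_x ((\sum_(i < n) H 0 i * h x 0 i) * rho x).
  rewrite Rintegral_sum//; apply: eq_bigr => i _.
  under eq_Rintegral do rewrite -mulrA.
  rewrite RintegralZl//; last exact: weighted_integrable.
  by rewrite expr2 [in X in _ * X]mxE.
rewrite /I -RintegralZl//; last exact: weighted_integrable.
apply: le_Rintegral => //.
- exact/weighted_integrable/bounded_measurable_sum.
- apply: eq_integrable
    (weighted_integrable wr (bounded_measurableM (bounded_measurable_cst (enorm H)) be)) => //.
  by move=> x _ /=; rewrite mulrA.
- by move=> x _; rewrite mulrA ler_wpM2r//; [case: wr|exact: dot_le_enorm].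
Qed.

Lemma chord_le_arc z h a b : velocity z h -> a <= b ->
  enorm (z b - z a) <= arc_real h a b.
Proof.
move=> vz ab; rewrite (chordE vz ab); apply: enorm_wmean_le; first exact: weight_indic.
by case: vz.
Qed.

Lemma arc_sqr_le h a b : bounded_measurable_rV h -> a <= b ->
  arc_real h a b ^+ 2 <= (b - a) * \int[mu]_x (sqn (h x) * \1_`[a, b] x).
Proof.
move=> bh ab; have be := bounded_measurable_enorm bh.
have [ba|ba] := eqVneq b a.
  have H : arc_real h a b <= 0.
    have [_ [M hM]] := be.
    rewrite (le_trans (@arc_real_le h a b M bh ab _)) ?ba ?subrr ?mulr0// => x.
    exact: le_trans (ler_norm _) (hM x).
  have -> : arc_real h a b = 0 by apply/eqP; rewrite eq_le H arc_real_ge0.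
  by rewrite ba subrr mul0r expr0n.
have m0 : 0 < b - a by rewrite subr_gt0 lt_def ba.
have := weighted_variance_scalar ((b - a)^-1 * arc_real h a b) (weight_indic a b) be.
rewrite /= Rintegral_indic_mass// -/(arc_real h a b) mulVKf ?gt_eqF//.
rewrite subrr expr0n addr0 => H.
under eq_Rintegral do rewrite -enorm_sqr.
rewrite -subr_ge0 -H mulr_ge0//; first exact: ltW.
by apply: Rintegral_ge0 => x _; rewrite mulr_ge0// sqr_ge0.
Qed.

Lemma arc_real_shift1 h a b : bounded_measurable_rV h -> periodic h 1 ->
  arc_real h (a + 1) (b + 1) = arc_real h a b.
Proof.
move=> bh ph; rewrite /arc_real.
rewrite -(@Rintegral_itv_shift _ _ _ _ (fun t => enorm (h t))); last first.
  by case: (bounded_measurable_enorm bh).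
by apply: eq_Rintegral => x _; rewrite ph.
Qed.

(** [arc_sqr_le] replaces the squared length by [b - a] times the integral of [|h|^2], and
    [chord_variance] centred at [h x] bounds the difference to the squared chord. The two conditions
    on [x] place [[a, b]] inside the interval of radius [b - a] around [x], so [x] may be either
    endpoint. *)
Lemma arc_excess z h a b x : velocity z h -> a <= b -> b - a <= 1 ->
  x - (b - a) <= a -> b <= x + (b - a) ->
  ((arc_real h a b ^+ 2 - sqn (z b - z a))%:E <=
   (b - a)%:E * \int[mu]_(u in `[(- (b - a))%R, (b - a)%R]) (sqn (h (x + u)%R - h x))%:E)%E.
Proof.
move=> vz ab ba1 xa bx; have [_ ph bh _] := vz.
have mh := bounded_measurable_rV_measurable bh.
have bs : bounded_measurable (fun t => sqn (h t - h x)).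
  exact/bounded_measurable_sqn/bounded_measurable_rVB.
have ms : measurable_fun setT (fun t => (sqn (h t - h x))%:E).
  by apply/measurable_EFinP; case: bs.
have H := le_trans (lerB (arc_sqr_le bh ab) (lexx _)) (chord_variance (h x) vz ab).
apply: (@le_trans _ _ ((b - a) * \int[mu]_t (sqn (h t - h x) * \1_`[a, b] t))%:E).
  by rewrite lee_fin.
rewrite EFinM lee_wpmul2l ?lee_fin ?subr_ge0// EFin_Rintegral//; last exact: weight_indic.
rewrite -integral_itv_indic.
have -> : (\int[mu]_(u in `[(- (b - a))%R, (b - a)%R]) (sqn (h (x + u)%R - h x))%:E =
    \int[mu]_(t in `[(- (b - a) + x)%R, (b - a + x)%R]) (sqn (h t - h x))%:E)%E.
  rewrite -(@ge0_integral_shift _ x _ _ (fun t => (sqn (h t - h x))%:E))//.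
  - by apply: eq_integral => u _; rewrite (addrC x).
  - by move=> t; rewrite lee_fin sqn_ge0.
apply: le_integral_subitv => //.
- by rewrite addrC.
- by rewrite addrC.
- by move=> t; rewrite lee_fin sqn_ge0.
Qed.

End Arcs.

(** * The energy as an integral of a real density *)

Section EnergyDensity.
Context {R : realType} {n : nat}.
Notation mu := (@lebesgue_measure R).
Implicit Types h z : R -> 'rV[R]_n.

Definition rdist h (x y : R) : R :=
  Num.min (arc_real h x (x + fract (y - x))) (arc_real h (x + fract (y - x)) (x + 1)).

Definition energy_kernel z h (x y : R) : \bar R :=
  ((((enorm (z x - z y)%R)%:E ^+ 2)^-1 - ((rdist h x y)%:E ^+ 2)^-1)
   * ((enorm (h x))%:E * (enorm (h y))%:E))%E.

(** Truncation at [0] makes this total and nonnegative. At a double point the real inverse of [0] is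
    [0], so the value there is not that of [energy_kernel]; the two are identified only under
    injectivity, in [mobius_energy_repr]. *)
Definition energy_density z h (x y : R) : R :=
  Num.max 0 (((sqn (z x - z y))^-1 - (rdist h x y ^+ 2)^-1)
             * (enorm (h x) * enorm (h y))).

Lemma energy_density_ge0 z h x y : 0 <= energy_density z h x y.
Proof. by rewrite /energy_density le_max lexx. Qed.

Lemma intrinsic_dist_velocity z h x y : velocity z h ->
  intrinsic_dist z x y = (rdist h x y)%:E.
Proof.
by move=> vz; rewrite /intrinsic_dist !(arc_length_velocity _ _ vz) -EFin_min.
Qed.

Lemma mobius_energyE z h : velocity z h ->
  mobius_energy z = (\int[mu]_(x in `[0%R, 1%R]) \int[mu]_(y in `[0%R, 1%R])
    energy_kernel z h x y)%E.
Proof.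
move=> vz; have [_ _ _ dz] := vz.
apply: eq_integral_ae; apply: ae_imply dz => x [_ hx] _.
apply: eq_integral_ae; have [_ _ _ dz'] := vz.
by apply: ae_imply dz' => y [_ hy] _; rewrite (intrinsic_dist_velocity _ _ vz) hx hy.
Qed.

Lemma ae_fract_neq0 (x : R) : {ae mu, forall y, fract (y - x) != 0}.
Proof.
have cA : countable (range (fun k : int => x + k%:~R)).
  by apply: (sub_countable (card_image_le _ _)); exact: countableP.
exists (range (fun k : int => x + k%:~R)); split.
- exact: countable_measurable.
- exact: countable_lebesgue_measure0.
- move=> y /= /negP; rewrite negbK => /eqP y0; have [k yk] := fractE (y - x).
  by exists (- k) => //; rewrite mulrNz; move: yk; rewrite y0; lra.
Qed.

(** For each [x] the excluded [y] form a countable set. The bound is available before injectivity is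
    known, when the kernel may still be infinite. *)
Lemma mobius_energy_ge z h (k : R -> R -> R) : velocity z h ->
  (forall x y, 0 <= k x y) ->
  (forall x y, fract (y - x) != 0 -> ((k x y)%:E <= energy_kernel z h x y)%E) ->
  (\int[mu]_(x in `[0%R, 1%R]) \int[mu]_(y in `[0%R, 1%R]) (k x y)%:E
   <= mobius_energy z)%E.
Proof.
move=> vz k0 kz; rewrite (mobius_energyE vz).
apply: ge0_le_integral_ae => [x|]; first by apply: integral_ge0 => y _; rewrite lee_fin.
apply: aeW => x _; apply: ge0_le_integral_ae => [y|]; first by rewrite lee_fin.
by apply: ae_imply (ae_fract_neq0 x) => y /kz.
Qed.

Lemma mobius_energy_eq z h (k : R -> R -> R) : velocity z h ->
  (forall x y, fract (y - x) != 0 -> (k x y)%:E = energy_kernel z h x y) ->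
  mobius_energy z =
  (\int[mu]_(x in `[0%R, 1%R]) \int[mu]_(y in `[0%R, 1%R]) (k x y)%:E)%E.
Proof.
move=> vz kz; rewrite (mobius_energyE vz).
apply: eq_integral_ae; apply: aeW => x _; apply: eq_integral_ae.
by apply: ae_imply (ae_fract_neq0 x) => y /kz.
Qed.

Lemma rdistE h x r : 0 <= r < 1 ->
  rdist h x (x + r) = Num.min (arc_real h x (x + r)) (arc_real h (x + r) (x + 1)).
Proof. by move=> r01; rewrite /rdist [x + r - x]addrAC subrr add0r fract_id. Qed.

Lemma rdist_int h x y (k : int) : rdist h x (y + k%:~R) = rdist h x y.
Proof. by rewrite /rdist [y + _ - x]addrAC fract_int. Qed.

Lemma rdist1l h x y : bounded_measurable_rV h -> periodic h 1 ->
  rdist h (x + 1) y = rdist h x y.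
Proof.
move=> bh ph; rewrite /rdist.
have -> : fract (y - (x + 1)) = fract (y - x).
  by rewrite -[RHS](fract_int _ (- 1)) opprD addrA.
by rewrite [x + 1 + _]addrAC !arc_real_shift1.
Qed.

Lemma rdist_ge h x c m r : bounded_measurable_rV h -> 0 <= r < 1 -> 0 <= c ->
  (forall t, c <= enorm (h t)) -> m <= r -> m <= 1 - r ->
  c * m <= rdist h x (x + r).
Proof.
move=> bh r01 c0 hc mr mr1; rewrite rdistE// le_min.
have /andP[r0 r1] := r01; apply/andP; split.
- apply: le_trans (arc_real_ge bh _ hc); first by rewrite [x + r - x]addrAC subrr add0r ler_wpM2l.
  by rewrite lerDl.
- apply: le_trans (arc_real_ge bh _ hc).
    by rewrite ler_wpM2l// (le_trans mr1)// lerBrDr; lra.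
  by rewrite lerD2l ltW.
Qed.

Lemma chord_le_rdist z h x r : velocity z h -> 0 <= r < 1 ->
  enorm (z (x + r) - z x) <= rdist h x (x + r).
Proof.
move=> vz r01; rewrite rdistE// le_min; have /andP[r0 r1] := r01.
have [[pz _] _ _ _] := vz.
apply/andP; split; first by apply: (chord_le_arc vz); rewrite lerDl.
rewrite -enormN opprB -(pz x); apply: (chord_le_arc vz).
by rewrite lerD2l ltW.
Qed.

(** The sign of [w] decides which of the two arcs is used: it has parameter length [|w|] and, up to
    a period, [x] as an endpoint. The distance is at most the length of that arc, so [arc_excess]
    applies to it; the lower bound uses that [|w| <= 2^-1] makes the other arc at least as long in
    parameter. *)
Lemma rdist_spec z h c x w : velocity z h -> 0 <= c ->
  (forall t, c <= enorm (h t) <= 1) -> `|w| <= 2^-1 ->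
  [/\ c * `|w| <= rdist h x (x + w) <= `|w|,
      enorm (z (x + w) - z x) <= rdist h x (x + w) &
      ((rdist h x (x + w) ^+ 2 - sqn (z (x + w) - z x))%:E <=
       `|w|%:E * \int[mu]_(u in `[(- `|w|)%R, `|w|%R])
          (sqn (h (x + u)%R - h x))%:E)%E].
Proof.
move=> vz c0 hc w12; have [[pz _] ph bh _] := vz.
have hc1 t : c <= enorm (h t) by case/andP: (hc t).
have hc2 t : enorm (h t) <= 1 by case/andP: (hc t).
have arcle a b : a <= b -> arc_real h a b <= b - a.
  by move=> ab; have := arc_real_le bh ab hc2; rewrite mul1r.
have rd0 y : 0 <= rdist h x y by rewrite /rdist le_min !arc_real_ge0.
have [w0|w0] := leP 0 w.
- rewrite (ger0_norm w0) in w12 *.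
  have w1 : 0 <= w < 1 by rewrite w0; lra.
  have xw : x <= x + w by rewrite lerDl.
  have e : x + w - x = w by rewrite addrAC subrr add0r.
  have D1 : rdist h x (x + w) <= arc_real h x (x + w).
    by rewrite rdistE// ge_min lexx.
  split.
  + apply/andP; split; first by apply: (rdist_ge _ bh) => //; lra.
    by rewrite (le_trans D1)// (le_trans (arcle _ _ xw))// e.
  + exact: chord_le_rdist.
  + have := @arc_excess _ _ z h x (x + w) x vz xw.
    have h1 : w <= 1 by lra.
    have h2 : x - w <= x by lra.
    rewrite e => /(_ h1 h2 (lexx _)); apply: le_trans.
    by rewrite lee_fin lerB// lerXn2r ?nnegrE// ?arc_real_ge0.
- rewrite (ltr0_norm w0) in w12 *.
  (* For [w < 0] the point [x + w] is represented by [x + (1 + w)], and the short arc becomes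
     [[x + (1 + w), x + 1]]. *)
  have w1 : 0 <= 1 + w < 1 by apply/andP; split; lra.
  have xwE : x + (1 + w) = x + w + 1 by ring.
  have rE : rdist h x (x + w) = rdist h x (x + (1 + w)).
    by rewrite xwE (rdist_int _ _ _ 1).
  have zE : z (x + w) = z (x + (1 + w)) by rewrite xwE pz.
  have ab : x + (1 + w) <= x + 1 by rewrite lerD2l; lra.
  have e : x + 1 - (x + (1 + w)) = - w by ring.
  have D1 : rdist h x (x + (1 + w)) <= arc_real h (x + (1 + w)) (x + 1).
    by rewrite rdistE// ge_min lexx orbT.
  rewrite rE zE; split.
  + apply/andP; split; first by apply: (rdist_ge _ bh) => //; lra.
    by rewrite (le_trans D1)// (le_trans (arcle _ _ ab))// e.
  + exact: chord_le_rdist.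
  + have := @arc_excess _ _ z h (x + (1 + w)) (x + 1) (x + 1) vz ab.
    rewrite e pz ph sqnB => H.
    have -> : (\int[mu]_(u in `[(- - w)%R, (- w)%R]) (sqn (h (x + u)%R - h x))%:E =
      \int[mu]_(u in `[(- - w)%R, (- w)%R]) (sqn (h (x + 1 + u)%R - h x))%:E)%E.
      by apply: eq_integral => u _; rewrite (addrAC x) ph.
    have h1 : - w <= 1 by lra.
    have h2 : x + 1 - - w <= x + (1 + w) by lra.
    have h3 : x + 1 <= x + 1 + - w by lra.
    apply: le_trans (H h1 h2 h3).
    by rewrite lee_fin lerB// lerXn2r ?nnegrE// ?arc_real_ge0.
Qed.

Lemma measurable_arc_real d (T : measurableType d) h (f g : T -> R) :
  bounded_measurable_rV h -> measurable_fun setT f -> measurable_fun setT g ->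
  measurable_fun setT (fun p => arc_real h (f p) (g p)).
Proof.
move=> bh mf mg.
have me : measurable_fun setT (fun x => enorm (h x)).
  by case: (bounded_measurable_enorm bh).
(* The moving endpoints are absorbed into the integrand, so that measurability in the parameter
   follows from Tonelli. *)
pose k (p : T * R) : \bar R :=
  (if (f p.1 <= p.2) && (p.2 <= g p.1) then enorm (h p.2) else 0)%:E.
have mk : measurable_fun setT k.
  apply/measurable_EFinP/measurable_fun_ifT => //.
  - apply: measurable_and; apply: measurable_fun_ler => //; exact: measurableT_comp.
  - exact: (measurableT_comp me measurable_snd).
have -> : (fun p => arc_real h (f p) (g p)) =
    fine \o (fun p => \int[mu]_(t in setT) k (p, t))%E.
  apply/funext => p; rewrite /arc_real /Rintegral /=; congr fine.
  apply: eq_integral => t _; rewrite /k/= indicE.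
  have -> : (t \in `[f p, g p]%classic) = (f p <= t) && (t <= g p).
    by apply/idP/idP; rewrite inE/= in_itv.
  by case: ifPn => _; rewrite ?mulr1 ?mulr0.
apply: measurableT_comp; first exact: fine_measurable.
apply: (@measurable_integral_snd _ _ _ _ R mu setT k) => // p.
by rewrite /k lee_fin; case: ifP => // _; exact: enorm_ge0.
Qed.

Lemma measurable_rdist d (T : measurableType d) h (f g : T -> R) :
  bounded_measurable_rV h -> measurable_fun setT f -> measurable_fun setT g ->
  measurable_fun setT (fun p => rdist h (f p) (g p)).
Proof.
move=> bh mf mg.
have mr : measurable_fun setT (fun p => f p + fract (g p - f p)).
  by apply: measurable_funD => //; apply: measurable_fract; exact: measurable_funB.
apply: measurable_minr; apply: measurable_arc_real => //.
exact: measurable_funD.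
Qed.

Lemma velocity_continuous z h i : velocity z h -> continuous (fun x => z x 0 i).
Proof.
move=> [[_ [K zK]] _ _ _]; apply: (@lipschitz_continuous _ _ K) => s t.
apply: le_trans (zK s t).
by have := coord_le_enorm (z s - z t) i; rewrite !mxE.
Qed.

Lemma velocity_measurable z h : velocity z h -> measurable_rV z.
Proof.
by move=> vz i; apply: continuous_measurable_fun; exact: velocity_continuous vz.
Qed.

Lemma measurable_energy_density d (T : measurableType d) z h (f g : T -> R) :
  velocity z h -> measurable_fun setT f -> measurable_fun setT g ->
  measurable_fun setT (fun p => energy_density z h (f p) (g p)).
Proof.
move=> vz mf mg; have [_ _ bh _] := vz; have mz := velocity_measurable vz.
have me : measurable_fun setT (fun x => enorm (h x)).
  by case: (bounded_measurable_enorm bh).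
apply: measurable_maxr => //; apply: measurable_funM.
  apply: measurable_funB; apply: measurable_invr.
    by apply: measurable_sqnB; exact: measurable_rV_comp.
  by apply: measurable_funX; exact: measurable_rdist.
by apply: measurable_funM;
  [exact: (measurableT_comp me mf)|exact: (measurableT_comp me mg)].
Qed.

Lemma energy_kernel_int z h x t (k : int) : velocity z h ->
  energy_kernel z h x (t + k%:~R) = energy_kernel z h x t.
Proof.
move=> [[pz _] ph _ _].
by rewrite /energy_kernel rdist_int (period_int k t pz) (period_int k t ph).
Qed.

Lemma energy_density_int z h x t (k : int) : velocity z h ->
  energy_density z h x (t + k%:~R) = energy_density z h x t.
Proof.
move=> [[pz _] ph _ _].
by rewrite /energy_density rdist_int (period_int k t pz) (period_int k t ph).
Qed.

Lemma fract_neq0_half (x y : R) : fract (y - x) != 0 ->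
  exists w (k : int), [/\ w != 0, `|w| <= 2^-1 & y = x + w + k%:~R].
Proof.
have [k yk] := fractE (y - x); have /andP[f0 f1] := fract_itv (y - x).
set r := fract _ in yk f0 f1 * => r0.
have [r12|r12] := leP r 2^-1.
  by exists r, (- k); split => //; [rewrite ger0_norm|rewrite yk mulrNz; ring].
exists (r - 1), (1 - k); split.
- by rewrite subr_eq0 lt_eqF.
- by rewrite ltr0_norm ?subr_lt0//; lra.
- by rewrite intrB yk; ring.
Qed.

Lemma integral_energy_density_shift z h x : velocity z h ->
  (\int[mu]_(y in `[0%R, 1%R]) (energy_density z h x y)%:E =
   \int[mu]_(w in `[(- 2^-1)%R, 2^-1%R]) (energy_density z h x (x + w)%R)%:E)%E.
Proof.
move=> vz; pose f y := (energy_density z h x y)%:E.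
have mf : measurable_fun setT f.
  by apply/measurable_EFinP; exact: measurable_energy_density.
have f0 y : (0 <= f y)%E by rewrite lee_fin energy_density_ge0.
have pf y : f (y + 1) = f y.
  by rewrite /f; congr EFin; exact: (energy_density_int x y 1 vz).
rewrite -/f -(@ge0_integral_period _ (x - 2^-1) f mf f0 pf).
have -> : (\int[mu]_(w in `[(- 2^-1)%R, 2^-1%R]) (energy_density z h x (x + w)%R)%:E =
    \int[mu]_(w in `[(- 2^-1)%R, 2^-1%R]) f (w + x)%R)%E.
  by apply: eq_integral => w _; rewrite /f (addrC x).
have -> : x - 2^-1 + 1 = 2^-1 + x by field.
by rewrite (@ge0_integral_shift _ x _ _ f mf f0) (addrC x).
Qed.

Lemma energy_kernel_fin z h x w : velocity z h ->
  0 < sqn (z (x + w) - z x) -> 0 < rdist h x (x + w) ->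
  energy_kernel z h x (x + w) =
  ((((sqn (z x - z (x + w)))^-1 - (rdist h x (x + w) ^+ 2)^-1)
     * (enorm (h x) * enorm (h (x + w))))%:E).
Proof.
move=> vz z0 d0; rewrite /energy_kernel -!EFin_expe enorm_sqr.
rewrite !inver !gt_eqF//.
- by rewrite exprn_gt0.
- by rewrite sqnB.
Qed.

(** Injectivity makes the kernel finite off the diagonal, and chords not exceeding arcs make it
    nonnegative, so the truncation is invisible; the period in [y] is then centred at [x]. *)
Lemma mobius_energy_repr z h c : velocity z h -> 0 < c ->
  (forall t, c <= enorm (h t) <= 1) ->
  (forall x w, w != 0 -> `|w| <= 2^-1 -> 0 < sqn (z (x + w) - z x)) ->
  mobius_energy z = (\int[mu]_(x in `[0%R, 1%R])
    \int[mu]_(w in `[(- 2^-1)%R, 2^-1%R]) (energy_density z h x (x + w)%R)%:E)%E.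
Proof.
move=> vz c0 hc zinj.
rewrite (@mobius_energy_eq z h (energy_density z h) vz).
  by apply: eq_integral => x _; exact: integral_energy_density_shift.
move=> x y /fract_neq0_half[w [k [w0 w12 ->]]].
rewrite energy_kernel_int// energy_density_int//.
have [/andP[rc _] zr _] := rdist_spec x vz (ltW c0) hc w12.
have z0 := zinj x w w0 w12.
have r0 : 0 < rdist h x (x + w).
  by rewrite (lt_le_trans _ rc)// mulr_gt0// normr_gt0.
rewrite energy_kernel_fin// /energy_density; congr EFin; apply/max_idPr.
rewrite mulr_ge0 ?mulr_ge0 ?enorm_ge0// subr_ge0 lef_pV2 ?posrE ?exprn_gt0//.
  by rewrite sqnB -enorm_sqr lerXn2r ?nnegrE ?enorm_ge0// ltW.
by rewrite sqnB.
Qed.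

End EnergyDensity.

(** * The energy and the gap energy control each other *)

Section EnergyBounds.
Context {R : realType} {n : nat}.
Notation mu := (@lebesgue_measure R).
Implicit Types h z : R -> 'rV[R]_n.

Lemma integral_inv_ge (a b : R) : 0 < a -> a < b ->
  (\int[mu]_(s in `[a, b]) (s^-1)%:E = (ln b - ln a)%:E)%E.
Proof.
move=> a0 ab.
have dl x : a <= x -> is_derive x (1 : R) (@ln R) x^-1.
  by move=> ax; apply: is_derive1_ln; exact: lt_le_trans ax.
have cP x : a <= x -> {for x, continuous (@ln R)}.
  by move=> ax; apply/differentiable_continuous/derivable1_diffP; case: (dl x ax).
rewrite (@continuous_FTC2 _ (fun w => w^-1) (@ln R))//.
- apply: derivable_within_continuous => x; rewrite in_itv/= => /andP[ax _].
  by apply: derivableV => //; rewrite gt_eqF// (lt_le_trans a0).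
- split.
  + by move=> x; rewrite in_itv/= => /andP[/ltW/dl[]].
  + by apply/cvg_at_right_filter/cP.
  + by apply/cvg_at_left_filter/cP/ltW.
- by move=> x; rewrite in_itv/= => /andP[/ltW/dl[? <-] _]; rewrite derive1E.
Qed.

(** Adding [r > 0] to the squared chord keeps the value finite at double points, which cannot be
    excluded yet. The speeds are omitted because it is used only for unit velocity. *)
Definition regularized_density z h (r x y : R) : R :=
  Num.max 0 ((sqn (z x - z y) + r)^-1 - (rdist h x y ^+ 2)^-1).

Lemma regularized_density_le z h r x y : velocity z h ->
  (forall t, enorm (h t) = 1) -> 0 < r -> fract (y - x) != 0 ->
  ((regularized_density z h r x y)%:E <= energy_kernel z h x y)%E.
Proof.
move=> vz h1 r0 /fract_neq0_half[w [k [w0 w12 ->]]].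
have [[pz _] ph _ _] := vz.
rewrite energy_kernel_int// /regularized_density rdist_int (period_int k _ pz).
have hb t : 1 <= enorm (h t) <= 1 by rewrite h1 lexx.
have [/andP[rc _] zr _] := rdist_spec x vz ler01 hb w12.
rewrite mul1r in rc.
have d0 : 0 < rdist h x (x + w) by rewrite (lt_le_trans _ rc)// normr_gt0.
have A0 := sqn_ge0 (z (x + w) - z x).
have [A1|A1] := eqVneq (sqn (z (x + w) - z x)) 0.
  have e0 : enorm (z x - z (x + w)) = 0 by rewrite enormE sqnB A1 sqrtr0.
  rewrite /energy_kernel e0 !h1 -!EFin_expe expr0n/= inve0 inver gt_eqF ?exprn_gt0//.
  by rewrite mule1 mule1 addye// leey.
have {}A0 : 0 < sqn (z (x + w) - z x) by rewrite lt_def A1.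
rewrite energy_kernel_fin// !h1 !mulr1 lee_fin ge_max sqnB subr_ge0; apply/andP; split.
  rewrite lef_pV2 ?posrE ?exprn_gt0// -enorm_sqr lerXn2r ?nnegrE ?enorm_ge0//.
  exact: ltW.
by rewrite lerB// lef_pV2 ?posrE ?addr_gt0// lerDl ltW.
Qed.

(** From a chord shorter than [rho <= s], moving the ends by [s] and [t <= s] gives a chord of at
    most [3 s], so the regularised square is at most [10 s^2]. The parameters stay [11 kap] apart on
    the circle, so the intrinsic distance is at least [6 s]; and [1/10 - 1/36 >= 1/36]. *)
Lemma regularized_density_ge z h rho kap d x0 r0 s t : velocity z h ->
  (forall t, enorm (h t) = 1) -> 0 < rho -> d = 12 * kap -> d <= r0 <= 1 - d ->
  enorm (z (x0 + r0) - z x0) < rho -> rho <= s <= kap -> 0 <= t <= s ->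
  (36 * s ^+ 2)^-1 <= regularized_density z h (rho ^+ 2) (s + x0) (t + (x0 + r0)).
Proof.
move=> vz h1 rho0 dk /andP[dr0 r0d] chord_lt /andP[rs sk] /andP[t0 ts].
have [_ _ bh _] := vz.
have hb u : enorm (h u) <= 1 by rewrite h1.
have s0 : 0 < s by exact: lt_le_trans rs.
have step a u : 0 <= u -> enorm (z (a + u) - z a) <= u.
  move=> u0; have au : a <= a + u by rewrite lerDl.
  apply: (le_trans (chord_le_arc vz au)); have := arc_real_le bh au hb.
  by rewrite mul1r [a + u - a]addrAC subrr add0r.
have A3 : enorm (z (s + x0) - z (t + (x0 + r0))) <= 3 * s.
  have -> : z (s + x0) - z (t + (x0 + r0)) =
      (z (x0 + s) - z x0) - (z (x0 + r0) - z x0) - (z (x0 + r0 + t) - z (x0 + r0)).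
    by rewrite (addrC s) (addrC t); apply/rowP => i; rewrite !mxE; ring.
  apply: (le_trans (enormB _ _)).
  have := enormB (z (x0 + s) - z x0) (z (x0 + r0) - z x0).
  have := step x0 s (ltW s0); have := step (x0 + r0) t t0.
  by move: chord_lt rs ts; lra.
have A9 : sqn (z (s + x0) - z (t + (x0 + r0))) <= 9 * s ^+ 2.
  rewrite -enorm_sqr (le_trans (_ : _ <= (3 * s) ^+ 2))//.
    by rewrite lerXn2r ?nnegrE ?enorm_ge0// mulr_ge0// ltW.
  by rewrite exprMn; lra.
have rE : t + (x0 + r0) = s + x0 + (r0 + t - s) by ring.
have r01 : 0 <= r0 + t - s < 1 by apply/andP; split; lra.
have D6 : 6 * s <= rdist h (s + x0) (t + (x0 + r0)).
  have := @rdist_ge _ _ h (s + x0) 1 (6 * s) (r0 + t - s) bh r01 ler01.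
  rewrite mul1r -rE; apply => [u||]; first by rewrite h1.
  - lra.
  - lra.
rewrite le_max; apply/orP; right.
have q1 : (rdist h (s + x0) (t + (x0 + r0)) ^+ 2)^-1 <= (36 * s ^+ 2)^-1.
  have D0 : 0 < rdist h (s + x0) (t + (x0 + r0)) by rewrite (lt_le_trans _ D6)// mulr_gt0.
  rewrite lef_pV2 ?posrE ?mulr_gt0 ?exprn_gt0//.
  rewrite (_ : 36 * s ^+ 2 = (6 * s) ^+ 2); last by ring.
  by rewrite lerXn2r ?nnegrE// ltW// mulr_gt0.
have rs2 : rho ^+ 2 <= s ^+ 2 by rewrite lerXn2r// nnegrE ltW.
have q2 : (10 * s ^+ 2)^-1 <= (sqn (z (s + x0) - z (t + (x0 + r0))) + rho ^+ 2)^-1.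
  rewrite lef_pV2 ?posrE ?mulr_gt0 ?ltr_wpDl ?exprn_gt0 ?sqn_ge0//.
  by lra.
have s2 : 0 < (s ^+ 2)^-1 by rewrite invr_gt0 exprn_gt0.
by move: q1 q2; rewrite !invfM; lra.
Qed.

(** On the triangle [0 <= t <= s] the inner integral is at least [s * (36 * s ^+ 2)^-1], which
    leaves [s^-1] to be integrated over [[rho, kap]]. *)
Lemma log_lower_bound (k : R -> R -> \bar R) (rho kap : R) : 0 < rho < kap -> kap <= 1 ->
  (forall s t, 0 <= k s t)%E -> measurable_fun setT (fun p : R * R => k p.1 p.2) ->
  (forall s t, rho <= s <= kap -> 0 <= t <= s ->
    (((36 * s ^+ 2)^-1)%:E <= k s t)%E) ->
  (((36 : R)^-1 * (ln kap - ln rho))%:E <=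
   \int[mu]_(s in `[0%R, 1%R]) \int[mu]_(t in `[0%R, 1%R]) k s t)%E.
Proof.
move=> /andP[rho0 rhok] kap1 k0 mk kge.
have mi : measurable_fun setT (fun s : R => (s^-1)%:E).
  by apply/measurable_EFinP; exact: measurable_invr.
have mi' : measurable_fun `[rho, kap]%classic (fun s : R => (s^-1)%:E).
  exact: measurable_funTS.
have mI : measurable_fun setT (fun s : R => \int[mu]_(t in `[0%R, 1%R]) k s t)%E.
  apply: (@measurable_integral_snd _ _ _ _ R mu _ (fun p : R * R => k p.1 p.2)) => //.
have mks s : measurable_fun setT (k s).
  have -> : k s = (fun p : R * R => k p.1 p.2) \o (fun t : R => (s, t)) by [].
  by apply: measurableT_comp mk _; exact: measurable_fun_pair.
have I0 s : (0 <= \int[mu]_(t in `[0%R, 1%R]) k s t)%E.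
  by apply: integral_ge0 => t _; exact: k0.
apply: (@le_trans _ _ (\int[mu]_(s in `[rho, kap]) \int[mu]_(t in `[0%R, 1%R]) k s t)%E);
    last by apply: le_integral_subitv; [exact: ltW| |exact: mI|exact: I0].
rewrite EFinM -(integral_inv_ge rho0 rhok).
rewrite -(@ge0_integralZl _ _ _ mu _ (measurable_itv _) _ mi'); last 2 first.
- move=> s /=; rewrite in_itv/= => /andP[rs _].
  by rewrite lee_fin invr_ge0 (le_trans (ltW rho0)).
- by rewrite lee_fin invr_ge0.
apply: ge0_le_integral.
- exact: measurable_itv.
- move=> s /=; rewrite in_itv/= => /andP[rs _].
  by rewrite -EFinM lee_fin mulr_ge0 ?invr_ge0// (le_trans (ltW rho0)).
- by apply: measurable_funTS; exact: measurable_funeM.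
- exact: measurable_funTS.
- move=> s /=; rewrite in_itv/= => /andP[rs sk].
  have s0 : 0 < s by exact: lt_le_trans rs.
  apply: (@le_trans _ _ (\int[mu]_(t in `[0%R, s]) k s t)%E); last first.
    apply: le_integral_subitv; [exact: lexx| |exact: mks|exact: k0].
    exact: le_trans kap1.
  have -> : ((36 : R)^-1%:E * (s^-1)%:E = \int[mu]_(t in `[0%R, s]) ((36 * s ^+ 2)^-1)%:E)%E.
    rewrite integral_cst//= lebesgue_measure_itv/= lte_fin s0 -EFinB subr0 -!EFinM.
    by congr EFin; field; rewrite gt_eqF.
  apply: le_integral_itv.
  - exact: measurable_cst.
  - exact: mks.
  - by move=> _; rewrite lee_fin invr_ge0 mulr_ge0// sqr_ge0.
  - by move=> t t0s; apply: kge t0s; rewrite rs.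
Qed.

Lemma chord_lower_bound z h d : velocity z h -> (forall t, enorm (h t) = 1) ->
  (mobius_energy z < +oo)%E -> 0 < d <= 2^-1 ->
  exists2 rho : R, 0 < rho &
    forall x r, d <= r <= 1 - d -> rho <= enorm (z (x + r) - z x).
Proof.
move=> vz h1 Efin /andP[d0 d12]; have [[pz _] ph bh _] := vz.
have hb t : enorm (h t) <= 1 by rewrite h1.
(* Nonnegativity is read off from a regularised kernel; the parameter [1] is arbitrary. *)
have E0 : (0 <= mobius_energy z)%E.
  apply: le_trans (mobius_energy_ge (k := regularized_density z h 1) vz _ _).
  - by apply: integral_ge0 => x _; apply: integral_ge0 => y _; rewrite lee_fin le_max lexx.
  - by move=> x y; rewrite le_max lexx.
  - by move=> x y; exact: regularized_density_le.
have [e [e0 eE]] : exists e, 0 <= e /\ mobius_energy z = e%:E.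
  exists (fine (mobius_energy z)); rewrite fine_ge0//; split => //.
  by rewrite fineK// ge0_fin_numE.
clear E0 Efin.
have [kap [kap0 dk]] : exists kap, 0 < kap /\ d = 12 * kap.
  by exists (d / 12); rewrite divr_gt0// mulrC divfK.
(* [rho] is chosen so that the logarithmic lower bound equals [e + 1], which exceeds the energy
   [e]. *)
have [rho [rho0 rhok lnE]] :
    exists rho, [/\ 0 < rho, rho < kap & ln kap - ln rho = 36 * (e + 1)].
  exists (kap * expR (- (36 * (e + 1)))); split.
  - by rewrite mulr_gt0// expR_gt0.
  - have e1 : 0 < e + 1 by lra.
    by rewrite -[ltRHS]mulr1 ltr_pM2l// expR_lt1 oppr_lt0 mulr_gt0.
  - by rewrite lnM ?posrE ?expR_gt0// expRK; lra.
exists rho => // x0 r0 dr; rewrite leNgt; apply/negP => chord_lt.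
have [y0 y0E] : exists y0, y0 = x0 + r0 by exists (x0 + r0).
pose k (x y : R) := (regularized_density z h (rho ^+ 2) x y)%:E.
have k0 x y : (0 <= k x y)%E by rewrite lee_fin le_max lexx.
have mz := velocity_measurable vz.
have mk2 d' (T : measurableType d') (f g : T -> R) : measurable_fun setT f ->
    measurable_fun setT g -> measurable_fun setT (fun p => k (f p) (g p)).
  move=> mf mg; apply/measurable_EFinP/measurable_maxr => //.
  apply: measurable_funB; apply: measurable_invr.
    apply: measurable_funD => //.
    by apply: measurable_sqnB; exact: measurable_rV_comp.
  by apply: measurable_funX; exact: measurable_rdist.
have mk1 x : measurable_fun setT (k x).
  exact: (mk2 _ _ (fun _ : R => x) (fun y : R => y)).
have kpy x y : k x (y + 1) = k x y.
  by rewrite /k /regularized_density pz (rdist_int h x y 1).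
have kpx x y : k (x + 1) y = k x y.
  by rewrite /k /regularized_density pz rdist1l.
pose G x := (\int[mu]_(y in `[0%R, 1%R]) k x y)%E.
(* By periodicity the base points [x0] and [y0] of the near contact may be moved to the origin
   without changing the iterated integral. *)
have GE : (\int[mu]_(s in `[0%R, 1%R]) G (s + x0)%R = \int[mu]_(s in `[0%R, 1%R]) G s)%E.
  apply: ge0_integral_periodic_shift.
  - apply: (@measurable_integral_snd _ _ _ _ R mu _ (fun p : R * R => k p.1 p.2)) => //.
    exact: (mk2 _ _ _ _ (@measurable_fst _ _ R R) (@measurable_snd _ _ R R)).
  - by move=> x; apply: integral_ge0.
  - by move=> x; apply: eq_integral => y _; rewrite kpx.
have kge s t : rho <= s <= kap -> 0 <= t <= s ->
    (((36 * s ^+ 2)^-1)%:E <= k (s + x0)%R (t + y0)%R)%E.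
  move=> rsk t0s; rewrite lee_fin y0E.
  exact: (regularized_density_ge vz h1 rho0 dk dr chord_lt rsk t0s).
have LB : (((36 : R)^-1 * (ln kap - ln rho))%:E <= \int[mu]_(s in `[0%R, 1%R])
    \int[mu]_(t in `[0%R, 1%R]) k (s + x0)%R (t + y0)%R)%E.
  apply: (@log_lower_bound (fun s t => k (s + x0) (t + y0))) kge.
  - by rewrite rho0.
  - by lra.
  - by move=> s t; exact: k0.
  - apply: (mk2 _ _ (fun p : R * R => p.1 + x0) (fun p : R * R => p.2 + y0));
      exact: measurable_funD.
suff EK : (\int[mu]_(s in `[0%R, 1%R]) \int[mu]_(t in `[0%R, 1%R])
    k (s + x0)%R (t + y0)%R <= mobius_energy z)%E.
  by move: (le_trans LB EK); rewrite eE lee_fin lnE; lra.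
move: LB => _.
apply: le_trans (mobius_energy_ge (k := regularized_density z h (rho ^+ 2)) vz _ _).
- rewrite le_eqVlt; apply/orP; left; apply/eqP.
  transitivity (\int[mu]_(s in `[0%R, 1%R]) G (s + x0)%R)%E; last exact: GE.
  apply: eq_integral => s _.
  exact: (ge0_integral_periodic_shift y0 (mk1 (s + x0)) (k0 (s + x0)) (kpy (s + x0))).
- by move=> x y; rewrite le_max lexx.
- by move=> x y; exact: (regularized_density_le vz h1 (exprn_gt0 2 rho0)).
Qed.

Lemma ge0_integral_dilate2 (a : R) (f : R -> \bar R) : measurable_fun setT f ->
  (forall x, 0 <= f x)%E ->
  (\int[mu]_(y in `[(- (2 * a))%R, (2 * a)%R]) f y =
   2%:E * \int[mu]_(x in `[(- a)%R, a]) f (2 * x)%R)%E.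
Proof.
move=> mf f0; rewrite (@ge0_integral_affine_set _ 2 0)//; last exact: measurable_funTS.
rewrite ger0_norm//; congr (_ * _)%E.
under eq_integral do rewrite addr0.
congr (integral _ _ _); apply/seteqP; split => x /=; rewrite !in_itv/= addr0;
  by move=> /andP[? ?]; apply/andP; split; lra.
Qed.

(** [chord_lower_bound] at [d = |w|]; a negative [w] is replaced by [1 + w]. *)
Lemma injective_chord z h : velocity z h -> (forall t, enorm (h t) = 1) ->
  (mobius_energy z < +oo)%E ->
  forall x w, w != 0 -> `|w| <= 2^-1 -> 0 < sqn (z (x + w) - z x).
Proof.
move=> vz h1 Efin x w w0 w12; have [[pz _] _ _ _] := vz.
have wd : 0 < `|w| <= 2^-1 by rewrite normr_gt0 w0.
have [rho rho0 H] := chord_lower_bound vz h1 Efin wd.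
rewrite -enorm_sqr exprn_gt0// (lt_le_trans rho0)//.
have [w_ge0|w_lt0] := leP 0 w.
  by apply: H; rewrite ger0_norm// lexx; rewrite ger0_norm// in w12; lra.
have -> : z (x + w) = z (x + (1 + w)) by rewrite -(pz (x + w)); congr z; ring.
apply: H; rewrite (ltr0_norm w_lt0); rewrite (ltr0_norm w_lt0) in w12.
by apply/andP; split; lra.
Qed.

(* The density dominates [(w^2 - |z (x + w) - z x|^2) / w^4], which controls the
   gap at distance [w / 2]. *)
Lemma density_slice_ge z h w : velocity z h -> (forall t, enorm (h t) = 1) ->
  (mobius_energy z < +oo)%E -> `|w| <= 2^-1 ->
  (((4 * w ^+ 2)^-1)%:E * shift_gap h (w / 2)%R <=
   \int[mu]_(x in `[0%R, 1%R]) (energy_density z h x (x + w)%R)%:E)%E.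
Proof.
move=> vz h1 Efin w12; have [_ ph bh _] := vz.
have mh := bounded_measurable_rV_measurable bh.
have [->|w0] := eqVneq w 0.
  rewrite expr0n mulr0 invr0 mul0e; apply: integral_ge0 => x _.
  by rewrite lee_fin energy_density_ge0.
have hb t : 1 <= enorm (h t) <= 1 by rewrite h1 lexx.
have sh1 t : sqn (h t) = 1 by rewrite -enorm_sqr h1 expr1n.
(* [x + b] is the left end of the arc between [x] and [x + w] for either sign of [w], and [v] is
   half its length. *)
pose v := `|w| / 2; pose b := Num.min 0 w.
have wn0 : 0 < `|w| by rewrite normr_gt0.
have v0 : 0 < v by rewrite divr_gt0.
have wv : `|w| = 2 * v by rewrite /v mulrC divfK.
pose D x t := (sqn (h (x + (b + t) + v) - h (x + (b + t))))%:E.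
have D0 x t : (0 <= D x t)%E by rewrite lee_fin sqn_ge0.
have mD : measurable_fun setT (fun p : R * R => D p.1 p.2).
  apply: measurable_gap => //.
    by do 2 apply: measurable_funD => //; exact: measurable_funD.
  by apply: measurable_funD => //; exact: measurable_funD.
have key x : ((v / w ^+ 4)%:E * \int[mu]_(t in `[0%R, v]) D x t <=
    (energy_density z h x (x + w)%R)%:E)%E.
  have [/andP[r1 r2] zr _] := rdist_spec x vz ler01 hb w12.
  rewrite mul1r in r1.
  have rw : rdist h x (x + w) = `|w| by apply/eqP; rewrite eq_le r1 r2.
  have A0 := injective_chord vz h1 Efin x w0 w12.
  have Aw : sqn (z (x + w) - z x) <= w ^+ 2.
    by rewrite -enorm_sqr -(real_normK (num_real w)) -rw lerXn2r ?nnegrE ?enorm_ge0// rw.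
  have chordE' : sqn (z (x + b + 2 * v) - z (x + b)) = sqn (z (x + w) - z x).
    rewrite -wv /b; have [w_ge0|w_lt0] := leP 0 w.
      by rewrite ger0_norm// addr0.
    by rewrite ltr0_norm// -[x + w - w]addrA subrr addr0 sqnB.
  have := half_chord_gap (x + b) vz v0 sh1; rewrite chordE' -wv real_normK ?num_real// => H.
  apply: (@le_trans _ _ ((w ^+ 2 - sqn (z (x + w) - z x)) / w ^+ 4)%:E).
    set I := integral _ _ _.
    have -> : ((v / w ^+ 4)%:E * I = ((w ^+ 4)^-1)%:E * (v%:E * I))%E.
      by rewrite muleA -EFinM (mulrC v).
    have -> : ((w ^+ 2 - sqn (z (x + w) - z x)) / w ^+ 4)%:E =
        (((w ^+ 4)^-1)%:E * (w ^+ 2 - sqn (z (x + w) - z x))%:E)%E.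
      by rewrite -EFinM mulrC.
    apply: lee_wpmul2l.
      by rewrite lee_fin invr_ge0 exprn_even_ge0.
    apply: (@le_trans _ _ (v * \int[mu]_y (sqn (h (y + v) - h y) *
        \1_`[x + b, x + b + v] y))%:E); last by rewrite lee_fin.
    rewrite [leRHS]EFinM; apply: lee_wpmul2l; first by rewrite lee_fin ltW.
    rewrite EFin_Rintegral; last 2 first.
    - exact: weight_indic.
    - apply: bounded_measurable_sqn => i; under eq_fun do rewrite !mxE.
      apply: bounded_measurableB => //; apply: bounded_measurable_comp (bh i).
      exact: measurable_funD.
    rewrite -integral_itv_indic.
    rewrite le_eqVlt; apply/orP; left; apply/eqP.
    have := @ge0_integral_shift _ (x + b) 0 v (fun y => (sqn (h (y + v) - h y))%:E).
    rewrite add0r (addrC v) => <-.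
    - by apply: eq_integral => t _; rewrite /D addrA (addrC t).
    - by apply: measurable_gap => //; exact: measurable_funD.
    - by move=> y; rewrite lee_fin sqn_ge0.
  rewrite lee_fin /energy_density le_max !h1 !mulr1 rw real_normK ?num_real// (sqnB (z x)).
  apply/orP; right; set A := sqn _ in A0 Aw *.
  have w2 : 0 < w ^+ 2 by rewrite exprn_even_gt0.
  have -> : A^-1 - (w ^+ 2)^-1 = (w ^+ 2 - A) * (A * w ^+ 2)^-1.
    by field; rewrite w0 gt_eqF.
  apply: ler_wpM2l; first by rewrite subr_ge0.
  have w4 : w ^+ 4 = w ^+ 2 * w ^+ 2 by rewrite -exprD.
  have w40 : 0 < w ^+ 4 by rewrite w4 mulr_gt0.
  have Aw0 : 0 < A * w ^+ 2 by rewrite mulr_gt0.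
  by rewrite lef_pV2 ?posrE// w4 ler_pM2r.
have mDx x : measurable_fun setT (D x).
  have : measurable_fun setT ((fun p : R * R => D p.1 p.2) \o (fun t : R => (x, t))).
    by apply: measurableT_comp mD _; exact: measurable_fun_pair.
  by [].
have mI : measurable_fun setT (fun x => \int[mu]_(t in `[0%R, v]) D x t)%E.
  exact: (@measurable_integral_snd _ _ _ _ R mu _ (fun p : R * R => D p.1 p.2)).
apply: (@le_trans _ _ (\int[mu]_(x in `[0%R, 1%R])
    ((v / w ^+ 4)%:E * \int[mu]_(t in `[0%R, v]) D x t))%E); last first.
  apply: le_integral_itv => //.
  - exact: measurable_funeM.
  - apply/measurable_EFinP; apply: measurable_energy_density => //.
    exact: measurable_funD.
  - move=> x; rewrite mule_ge0 ?integral_ge0// lee_fin divr_ge0 ?(ltW v0)//.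
    exact: exprn_even_ge0.
have vw0 : 0 <= v / w ^+ 4 by rewrite divr_ge0 ?(ltW v0)// exprn_even_ge0.
rewrite integralZl_itv//; last by move=> x; exact: integral_ge0.
(* For fixed [t] the translation by [b + t] drops out of the integral over a period, so every slice
   equals [shift_gap h v]. The resulting factor is [v ^+ 2 / w ^+ 4 = (4 * w ^+ 2)^-1], as
   [|w| = 2 * v]. *)
rewrite (@tonelli_in _ _ _ _ R mu mu _ _ (fun p : R * R => D p.1 p.2))//.
under [X in (_ <= _ * X)%E]eq_integral => t _ do rewrite /D/= shift_gap_translate//.
rewrite (_ : shift_gap h v = shift_gap h (w / 2)); last first.
  by rewrite -(shift_gap_abs (w / 2))// normrM normfV (ger0_norm (ler0n _ 2)).
have -> : (\int[mu]_(t in `[0%R, v]) shift_gap h (w / 2)%R =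
    v%:E * shift_gap h (w / 2)%R)%E.
  rewrite integral_cst//= lebesgue_measure_itv/= lte_fin v0 -EFinB subr0.
  by rewrite muleC.
rewrite muleA -EFinM le_eqVlt; apply/orP; left; apply/eqP; congr (_%:E * _)%E.
have w2 : w ^+ 2 = 4 * v ^+ 2 by rewrite -(real_normK (num_real w)) wv; ring.
have -> : w ^+ 4 = (4 * v ^+ 2) ^+ 2 by rewrite -w2 -exprM.
by rewrite w2; field; rewrite gt_eqF.
Qed.

Lemma gap_energy_le_mobius z h : velocity z h -> (forall t, enorm (h t) = 1) ->
  (mobius_energy z < +oo)%E ->
  (gap_energy h 4^-1 <= 8%:E * mobius_energy z)%E.
Proof.
move=> vz h1 Efin; have [_ ph bh _] := vz.
have mh := bounded_measurable_rV_measurable bh.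
have hb t : 1 <= enorm (h t) <= 1 by rewrite h1 lexx.
rewrite (mobius_energy_repr vz ltr01 hb (injective_chord vz h1 Efin)).
rewrite (@tonelli_in _ _ _ _ R mu mu _ _
  (fun p : R * R => (energy_density z h p.1 (p.1 + p.2))%:E))//; last 2 first.
- apply/measurable_EFinP; apply: measurable_energy_density => //.
  exact: measurable_funD.
- by move=> p; rewrite lee_fin energy_density_ge0.
pose f w := (((4 * w ^+ 2)^-1)%:E * shift_gap h (w / 2)%R)%E.
have f0 w : (0 <= f w)%E.
  by rewrite mule_ge0 ?shift_gap_ge0// lee_fin invr_ge0 mulr_ge0// sqr_ge0.
have mf : measurable_fun setT f.
  apply: emeasurable_funM.
    apply/measurable_EFinP/measurable_invr/measurable_funM => //.
  apply: measurableT_comp; first exact: measurable_shift_gap.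
  exact: measurable_funM.
have mE : measurable_fun setT (fun w => \int[mu]_(x in `[0%R, 1%R])
    (energy_density z h x (x + w)%R)%:E)%E.
  apply: (@measurable_integral_snd _ _ _ _ R mu _
    (fun p : R * R => (energy_density z h p.2 (p.2 + p.1))%:E)) => //.
  - apply/measurable_EFinP; apply: measurable_energy_density => //.
    exact: measurable_funD.
  - by move=> p; rewrite lee_fin energy_density_ge0.
apply: (@le_trans _ _ (8%:E * \int[mu]_(w in `[(- 2^-1)%R, 2^-1%R]) f w)%E); last first.
  apply: lee_wpmul2l => //; apply: le_integral_itv => // w w12.
  by apply: density_slice_ge => //; rewrite ler_norml.
(* The substitution [w = 2 u] turns [(4 w^2)^-1 dw] into [(8 u^2)^-1 du]: this is the constant [8],
   and the reason for the range [1/4]. *)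
have -> : (2 : R)^-1 = 2 * 4^-1 by field.
rewrite (@ge0_integral_dilate2 4^-1 f mf f0) muleA -EFinM -integralZl_itv//; last first.
  by apply: measurableT_comp mf _; exact: mulrl_measurable.
rewrite le_eqVlt; apply/orP; left; apply/eqP; apply: eq_integral => u _.
rewrite /f (_ : 2 * u / 2 = u); last by rewrite mulrAC divff ?mul1r.
rewrite muleA -EFinM muleC; congr (_%:E * _)%E.
have [->|u0] := eqVneq u 0; first by rewrite !mulr0 expr0n/= mulr0 !invr0 mulr0.
by field.
Qed.

(** The energy reaches only gaps up to [1/4], whereas the Sobolev seminorm needs [1/2]. In between
    [u^-2 <= 16] and the gap is at most [4 M], so nothing infinite is added. *)
Lemma gap_energy_half_fin h : bounded_measurable_rV h -> periodic h 1 ->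
  (gap_energy h 4^-1 < +oo)%E -> (gap_energy h 2^-1 < +oo)%E.
Proof.
move=> bh ph; have mh := bounded_measurable_rV_measurable bh.
have [_ [M hM]] := bounded_measurable_sqn bh.
have M0 : 0 <= M by rewrite (le_trans _ (hM 0)).
have Fle u : (shift_gap h u <= (4 * M)%:E)%E.
  rewrite /shift_gap (@le_trans _ _ (\int[mu]_(x in `[0%R, 1%R]) (4 * M)%:E)%E)//.
    apply: le_integral_itv => //.
    - by apply: measurable_gap => //; exact: measurable_funD.
    - by move=> x; rewrite lee_fin sqn_ge0.
    - move=> x _; rewrite lee_fin (le_trans (sqnB_le _ _))//.
      have := le_trans (ler_norm _) (hM x); have := le_trans (ler_norm _) (hM (x + u)).
      by lra.
  by rewrite integral_cst//= lebesgue_measure_itv/= lte_fin ltr01 -EFinB subr0 mule1.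
pose g u := (shift_gap h u * ((u ^+ 2)^-1)%:E)%E.
have g0 u : (0 <= g u)%E.
  by rewrite mule_ge0 ?shift_gap_ge0// lee_fin invr_ge0 sqr_ge0.
have mg : measurable_fun setT g.
  apply: emeasurable_funM; first exact: measurable_shift_gap.
  by apply/measurable_EFinP/measurable_invr/measurable_funX.
have outer a b : a <= b -> b - a <= 1 -> (forall u, a <= u <= b -> 4^-1 <= `|u|) ->
    (\int[mu]_(u in `[a, b]) g u < +oo)%E.
  move=> ab ba1 hab.
  apply: (@le_lt_trans _ _ (\int[mu]_(u in `[a, b]) (64 * M)%:E)%E).
    apply: le_integral_itv => // u /hab u4.
    apply: (@le_trans _ _ ((4 * M)%:E * ((u ^+ 2)^-1)%:E)%E).
      by apply: lee_wpmul2r => //; rewrite lee_fin invr_ge0 sqr_ge0.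
    rewrite -EFinM lee_fin.
    have u16 : (u ^+ 2)^-1 <= 16.
      rewrite -[leRHS]invrK lef_pV2 ?posrE ?invr_gt0//.
        by rewrite -(real_normK (num_real u)); nra.
      by rewrite -(real_normK (num_real u)) exprn_gt0// (lt_le_trans _ u4)// invr_gt0.
    rewrite (@le_trans _ _ (4 * M * 16))//; first by rewrite ler_wpM2l// mulr_ge0.
    by lra.
  rewrite integral_cst//= lebesgue_measure_itv/= lte_fin.
  by case: ifPn => _; rewrite -?EFinB ?mule0 -?EFinM ltry.
rewrite {2}/gap_energy (@ge0_integral_itv_cat _ _ (- 4^-1))//; last 2 first.
- by rewrite lerN2; lra.
- by lra.
rewrite (@ge0_integral_itv_cat _ _ (4^-1) (2^-1))//; last 2 first.
- by lra.
- by lra.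
move=> Gfin; apply: lte_add_pinfty; last apply: lte_add_pinfty.
- apply: outer; [lra|lra|].
  by move=> u /andP[_ u4]; rewrite ler0_norm; lra.
- exact: Gfin.
- apply: outer; [lra|lra|].
  by move=> u /andP[u4 _]; rewrite ger0_norm; lra.
Qed.

(** The right side of [arc_excess] divided by [|w|^4], the order of chord squared times distance
    squared. *)
Definition near_kernel h (x w : R) : \bar R :=
  (((`|w| ^+ 3)^-1)%:E * \int[mu]_(u in `[(- `|w|)%R, `|w|%R]) (sqn (h (x + u)%R - h x))%:E)%E.

Lemma near_kernel_ge0 h x w : (0 <= near_kernel h x w)%E.
Proof.
apply: mule_ge0; first by rewrite lee_fin invr_ge0 exprn_ge0.
by apply: integral_ge0 => u _; rewrite lee_fin sqn_ge0.
Qed.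

Lemma near_kernel_measurable h : measurable_rV h ->
  measurable_fun setT (fun p : R * R => near_kernel h p.1 p.2).
Proof.
move=> mh; apply: emeasurable_funM.
  apply/measurable_EFinP/measurable_invr/measurable_funX.
  exact: measurableT_comp.
pose k (p : (R * R) * R) : \bar R :=
  (if `|p.2| <= `|p.1.2| then sqn (h (p.1.1 + p.2) - h p.1.1) else 0)%:E.
have -> : (fun p : R * R => \int[mu]_(u in `[(- `|p.2|)%R, `|p.2|%R])
    (sqn (h (p.1 + u)%R - h p.1))%:E)%E = (fun p => \int[mu]_(u in setT) k (p, u))%E.
  apply/funext => p; rewrite integral_mkcond; apply: eq_integral => u _.
  rewrite /patch /k/= (_ : (u \in _) = (`|u| <= `|p.2|)).
    by case: ifPn.
  by apply/idP/idP; rewrite inE/= in_itv/= ler_norml.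
apply: (@measurable_integral_snd _ _ _ _ R mu setT k) => //.
- apply/measurable_EFinP/measurable_fun_ifT => //.
  + by apply: measurable_fun_ler; do ?exact: measurableT_comp;
      apply: measurableT_comp => //; exact: measurableT_comp.
  + apply: measurable_sqnB; apply: measurable_rV_comp => //;
      [apply: measurable_funD => //; exact: measurableT_comp|exact: measurableT_comp].
- by move=> p; rewrite lee_fin; case: ifP => // _; exact: sqn_ge0.
Qed.

Lemma near_kernel_integral_le h d : measurable_rV h ->
  (\int[mu]_(x in `[0%R, 1%R]) \int[mu]_(w in `[(- d)%R, d]) near_kernel h x w
   <= gap_energy h d)%E.
Proof.
move=> mh; rewrite (@tonelli_in _ _ _ _ R mu mu _ _
  (fun p : R * R => near_kernel h p.1 p.2))//; last 2 first.
- exact: near_kernel_measurable.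
- by move=> p; exact: near_kernel_ge0.
apply: le_trans (hardy_gap_le d mh).
rewrite le_eqVlt; apply/orP; left; apply/eqP; apply: eq_integral => w _.
pose D (p : R * R) := (sqn (h (p.1 + p.2) - h p.1))%:E.
have mD : measurable_fun setT D by apply: measurable_gap => //; exact: measurable_funD.
have D0 p : (0 <= D p)%E by rewrite lee_fin sqn_ge0.
transitivity (\int[mu]_(x in `[0%R, 1%R]) (((`|w| ^+ 3)^-1)%:E *
    \int[mu]_(u in `[(- `|w|)%R, `|w|%R]) D (x, u)))%E; first by [].
have T := @tonelli_in _ _ _ _ R mu mu `[0%R, 1%R]%classic `[(- `|w|)%R, `|w|%R]%classic D
  (measurable_itv _) (measurable_itv _) mD D0.
rewrite integralZl_itv.
- by rewrite T.
- exact: (@measurable_integral_snd _ _ _ _ R mu _ D).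
- by move=> x; apply: integral_ge0 => u _; exact: (D0 (x, u)).
- by rewrite invr_ge0 exprn_ge0.
Qed.

(** For squared chord [A] and distance [D], [A^-1 - D^-2 = (D^2 - A) / (A D^2)]. Both [A] and [D^2]
    are at least [(c |w|)^2], and [rdist_spec] bounds the numerator. *)
Lemma density_le_near_kernel z h c x w : velocity z h -> 0 < c ->
  (forall t, c <= enorm (h t) <= 1) -> `|w| <= 2^-1 ->
  c * `|w| <= enorm (z (x + w) - z x) ->
  ((energy_density z h x (x + w))%:E <= ((c ^+ 4)^-1)%:E * near_kernel h x w)%E.
Proof.
move=> vz c0 hc w12 czw.
have [/andP[rc rw] zr near] := rdist_spec x vz (ltW c0) hc w12.
have rd0 : 0 <= rdist h x (x + w) by rewrite (le_trans _ rc)// mulr_ge0// ltW.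
set A := sqn _ in near; set D := rdist _ _ _ in rc rw zr near rd0.
have AE : A = enorm (z (x + w) - z x) ^+ 2 by rewrite enorm_sqr.
have AD : A <= D ^+ 2 by rewrite AE lerXn2r ?nnegrE ?enorm_ge0.
(* On the diagonal both inverses are [0^-1 = 0], so the density vanishes. *)
have [w0|w0] := eqVneq w 0.
  have A0 : sqn (z x - z (x + w)) = 0 by rewrite w0 addr0 subrr sqn0.
  have D0 : D = 0 by apply/eqP; rewrite eq_le rd0 (le_trans rw)// w0 normr0.
  rewrite /energy_density -/D A0 D0 expr0n/= invr0 subrr mul0r maxxx.
  by rewrite mule_ge0 ?near_kernel_ge0// lee_fin invr_ge0 exprn_ge0// ltW.
have wn0 : 0 < `|w| by rewrite normr_gt0.
have cw0 : 0 < c * `|w| by rewrite mulr_gt0.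
have A0 : 0 < A by rewrite AE exprn_gt0// (lt_le_trans cw0).
have D0 : 0 < D by rewrite (lt_le_trans cw0).
have AcW : (c * `|w|) ^+ 2 <= A.
  by rewrite AE lerXn2r ?nnegrE ?enorm_ge0// ltW.
have DcW : (c * `|w|) ^+ 2 <= D ^+ 2 by rewrite lerXn2r// nnegrE ltW.
have c4 : 0 <= (c ^+ 4)^-1 by rewrite invr_ge0 exprn_ge0// ltW.
have w4 : 0 <= (`|w| ^+ 4)^-1 by rewrite invr_ge0 exprn_ge0.
have DA0 : 0 <= D ^+ 2 - A by rewrite subr_ge0.
have AD0 : 0 < A * D ^+ 2 by rewrite mulr_gt0// exprn_gt0.
have cw20 : 0 < (c * `|w|) ^+ 2 by rewrite exprn_gt0.
apply: (@le_trans _ _ ((c ^+ 4)^-1%:E * (((`|w| ^+ 4)^-1)%:E * (D ^+ 2 - A)%:E))%E).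
  rewrite -!EFinM lee_fin /energy_density -/D sqnB -/A ge_max; apply/andP; split.
    by rewrite !mulr_ge0.
  have -> : A^-1 - (D ^+ 2)^-1 = (A * D ^+ 2)^-1 * (D ^+ 2 - A).
    by field; rewrite !gt_eqF.
  apply: (@le_trans _ _ ((A * D ^+ 2)^-1 * (D ^+ 2 - A))).
    rewrite -[leRHS]mulr1 ler_wpM2l//.
      by rewrite mulr_ge0// invr_ge0 ltW.
    have /andP[_ a1] := hc x; have /andP[_ a2] := hc (x + w).
    by rewrite -[leRHS]mulr1 ler_pM// enorm_ge0.
  rewrite mulrA ler_wpM2r// -invfM.
  have -> : c ^+ 4 * `|w| ^+ 4 = (c * `|w|) ^+ 2 * (c * `|w|) ^+ 2 by ring.
  have cw4 : 0 < (c * `|w|) ^+ 2 * (c * `|w|) ^+ 2 by rewrite mulr_gt0.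
  by rewrite lef_pV2 ?posrE// ler_pM// ltW.
apply: lee_wpmul2l; first by rewrite lee_fin.
rewrite /near_kernel.
have -> : ((`|w| ^+ 3)^-1)%:E = (((`|w| ^+ 4)^-1)%:E * `|w|%:E)%E.
  by rewrite -EFinM; congr EFin; field; rewrite gt_eqF.
rewrite -muleA; apply: lee_wpmul2l; last exact: near.
by rewrite lee_fin.
Qed.

End EnergyBounds.

(** * Smooth functions of compact support and convolution *)

Section Bumps.
Context {R : realType}.
Notation mu := (@lebesgue_measure R).
Implicit Types (f phi : R -> R).

Definition bump (e : R) phi : Prop := smooth phi /\ forall x, e < `|x| -> phi x = 0.

Lemma smooth_is_derive phi x : smooth phi -> is_derive x (1 : R) phi (derive1 phi x).
Proof. by move=> sp; apply: DeriveDef; [exact: (sp 0 x)|rewrite derive1E]. Qed.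

Lemma smooth_continuous phi : smooth phi -> continuous phi.
Proof.
by move=> sp x; apply/differentiable_continuous/derivable1_diffP; exact: (sp 0 x).
Qed.

Lemma smooth_derive1 phi : smooth phi -> smooth (derive1 phi).
Proof. by move=> sp k x; rewrite -derive1Sn; exact: sp. Qed.

Lemma bump_derive1 e phi : bump e phi -> bump e (derive1 phi).
Proof.
move=> [sp p0]; split; first exact: smooth_derive1.
move=> x ex; rewrite derive1E.
have near0 : \forall y \near x, (cst 0 : R -> R) y = phi y.
  apply/nbhs_ballP; exists (`|x| - e) => /=; first by rewrite subr_gt0.
  move=> y; rewrite /ball/= => xy; apply/esym/p0.
  by have := ler_normD (x - y) y; rewrite subrK; lra.
by rewrite -(near_eq_derive _ near0) derive_cst.
Qed.

Lemma bump_bounded e phi : bump e phi -> exists2 M, 0 < M & forall x, `|phi x| <= M.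
Proof.
move=> [sp p0]; have cp := smooth_continuous sp.
have e0 : - `|e| <= `|e| by rewrite ge0_cp.
have cn : continuous (fun x => `|phi x|).
  by move=> x; apply: cvg_norm; exact: cp.
have [c _ Hc] := EVT_max e0 (continuous_subspaceT cn).
exists (`|phi c| + 1) => [|x]; first by rewrite ltr_wpDl.
have [xe|ex] := leP `|x| `|e|.
  by rewrite (le_trans (Hc x _)) ?lerDl// in_itv/= -ler_norml.
have -> : phi x = 0 by apply: p0; exact: le_lt_trans (ler_norm e) ex.
by rewrite normr0 addr_ge0.
Qed.

Lemma bump_lipschitz e phi : bump e phi ->
  exists2 L, 0 < L & forall s t, `|phi s - phi t| <= L * `|s - t|.
Proof.
move=> bp; have [L L0 HL] := bump_bounded (bump_derive1 bp); exists L => //.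
have [sp _] := bp.
have H s t : s <= t -> `|phi s - phi t| <= L * `|s - t|.
  move=> st; have [c _] := @MVT_segment _ phi (derive1 phi) s t st
    (fun x _ => smooth_is_derive x sp) (continuous_subspaceT (smooth_continuous sp)).
  by move=> E; rewrite distrC E normrM (distrC s) ler_wpM2r.
move=> s t; have [st|ts] := leP s t; first exact: H.
by rewrite distrC (distrC s) H// ltW.
Qed.

Lemma bump_weight_integrable e phi f : bump e phi -> bounded_measurable f ->
  mu.-integrable setT (EFin \o (fun y => f y * phi y)).
Proof.
move=> bp bf; have [M M0 HM] := bump_bounded bp; have [sp p0] := bp.
have bphi : bounded_measurable phi.
  split; last by exists M.
  by apply: continuous_measurable_fun; exact: smooth_continuous.
apply: eq_integrable (weighted_integrable (weight_indic (- `|e|) `|e|)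
  (bounded_measurableM bf bphi)) => // y _ /=.
rewrite indicE; have [ye|ey] := leP `|y| `|e|.
  by rewrite mem_set ?mulr1//= in_itv/= -ler_norml.
by rewrite p0 ?mulr0 ?mul0r// (le_lt_trans _ ey)// ler_norm.
Qed.

Definition conv f phi (x : R) : R := \int[mu]_y (f (x - y) * phi y).

Lemma convE f phi x : bounded_measurable f -> measurable_fun setT phi ->
  conv f phi x = \int[mu]_y (f y * phi (x - y)).
Proof.
move=> [mf _] mp; rewrite [RHS](integral_comp_opp_shift x).
  by apply: eq_Rintegral => y _; rewrite subKr.
apply: measurable_funM => //; apply: measurableT_comp => //.
exact: measurable_funB.
Qed.

(** After reflection the parameter sits in [phi] alone, so [f] need only be bounded and
    measurable. *)
Lemma is_derive_conv e f phi x : bounded_measurable f -> bump e phi ->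
  is_derive x (1 : R) (conv f phi) (conv f (derive1 phi) x).
Proof.
move=> bf bp; have bp' := bump_derive1 bp; have [sp p0] := bp.
have [sp' p0'] := bp'.
have mp : measurable_fun setT phi by apply: continuous_measurable_fun; exact: smooth_continuous.
have mp' : measurable_fun setT (derive1 phi).
  by apply: continuous_measurable_fun; exact: smooth_continuous.
(* For all [s] within [1] of [x] the support of [phi (s - y)] lies in this window; cutting off there
   gives the Lipschitz bound an integrable majorant. *)
pose A : set R := `[x - 1 - `|e|, x + 1 + `|e|]%classic.
have phiA (s y : R) : `|s - x| < 1 -> y \notin A -> phi (s - y) = 0 /\ derive1 phi (s - y) = 0.
  move=> sx yA; have H : e < `|s - y|.
    rewrite ltNge; apply/negP => sye; move/negP: yA; apply; rewrite inE /A/= in_itv/=.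
    have le_e := ler_norm e.
    have /andP[? ?] : - `|e| <= s - y <= `|e| by rewrite -ler_norml (le_trans sye).
    by move: sx; rewrite ltr_norml => /andP[? ?]; apply/andP; split; lra.
  by split; [exact: p0|exact: p0'].
have [L L0 HL] := bump_lipschitz bp.
have [mf [M fM]] := bf.
have M0 : 0 <= M by rewrite (le_trans _ (fM 0)).
pose F (s y : R) := f y * phi (s - y) * \1_A y.
have bs (k : R -> R) e' s : bump e' k -> bounded_measurable (fun y => f y * k (s - y)).
  move=> bk; apply: bounded_measurableM => //; have [sk _] := bk; split.
    apply: measurableT_comp; last exact: measurable_funB.
    by apply: continuous_measurable_fun; exact: smooth_continuous.
  by have [N _ kN] := bump_bounded bk; exists N => y; exact: kN.
have dF : is_derive x (1 : R) (fun s => \int[mu]_y F s y)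
    (\int[mu]_y (f y * derive1 phi (x - y) * \1_A y)).
  apply: (is_derive_integral (G := fun y => M * L * \1_A y)).
  - move=> s; exact: (weighted_integrable (weight_indic _ _) (bs _ _ _ bp)).
  - exact: (weighted_integrable (weight_indic _ _) (bounded_measurable_cst (M * L))).
  - move=> s y; rewrite /F -mulrBl -mulrBr !normrM [`|\1_A y|]ger0_norm//.
    rewrite [leRHS](_ : _ = M * (L * `|s - x|) * \1_A y); last by ring.
    rewrite ler_wpM2r// ler_pM//.
    by rewrite (le_trans (HL _ _))// (_ : s - y - (x - y) = s - x)//; ring.
  - by case: (bounded_measurableM (bs _ _ x bp')
      (bounded_measurable_indic (measurable_itv `[x - 1 - `|e|, x + 1 + `|e|]))).
  - apply: aeW => y.
    have H : is_derive x (1 : R) (fun s => phi (s - y)) (derive1 phi (x - y)).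
      by apply: is_derive_comp_addr; exact: smooth_is_derive.
    have := is_deriveZ (f y * \1_A y) H.
    rewrite (_ : (_ \*: _) = F^~ y); last first.
      by apply/funext => s; rewrite /F /= -[_ *: _]/(_ * _); ring.
    by rewrite (_ : _ *: _ = f y * derive1 phi (x - y) * \1_A y)// -[_ *: _]/(_ * _); ring.
have E (k : R -> R) s : measurable_fun setT k -> (forall y, y \notin A -> k (s - y) = 0) ->
    conv f k s = \int[mu]_y (f y * k (s - y) * \1_A y).
  move=> mk k0; rewrite convE//; apply: eq_Rintegral => y _; rewrite indicE.
  by have [yA|yA] := boolP (y \in A); rewrite ?mulr1// k0// mulr0 mul0r.
rewrite (E _ x mp'); last by move=> y /(phiA x y) []//; rewrite subrr normr0.
apply: (near_eq_is_derive _ dF).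
apply/nbhs_ballP; exists 1 => //= s; rewrite /ball/= => xs.
by apply/esym/E => // y /(phiA s y) []//; rewrite distrC.
Qed.

Lemma derive1n_scale (c k : R) phi m x : smooth phi ->
  derive1n m (fun t => c * phi (k * t)) x = c * k ^+ m * derive1n m phi (k * x).
Proof.
move=> sp; elim: m x => [x|m IHm x]; first by rewrite expr0 mulr1.
rewrite derive1nS derive1E.
have -> : derive1n m (fun t => c * phi (k * t)) =
    (fun t => c * k ^+ m * derive1n m phi (k * t)) by apply/funext.
have dk : is_derive x (1 : R) (fun t : R => k * t) k.
  by have := is_deriveZ k (is_derive_id x (1 : R)); rewrite -[_ *: _]/(_ * _) mulr1.
have dp : is_derive (k * x) (1 : R) (derive1n m phi) (derive1n m.+1 phi (k * x)).
  by apply: DeriveDef; [exact: sp|rewrite derive1nS derive1E].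
have := is_deriveZ (c * k ^+ m) (is_derive1_comp dp dk).
move=> [_ ->]; rewrite -[_ *: _]/(_ * _) exprSr; ring.
Qed.

Lemma smooth_scale (c k : R) phi : smooth phi -> smooth (fun t => c * phi (k * t)).
Proof.
move=> sp m x.
have -> : derive1n m (fun t => c * phi (k * t)) =
    (fun t => c * k ^+ m * derive1n m phi (k * t)).
  by apply/funext => t; exact: derive1n_scale.
have dk : is_derive x (1 : R) (fun t : R => k * t) k.
  by have := is_deriveZ k (is_derive_id x (1 : R)); rewrite -[_ *: _]/(_ * _) mulr1.
have dp : is_derive (k * x) (1 : R) (derive1n m phi) (derive1n m.+1 phi (k * x)).
  by apply: DeriveDef; [exact: sp|rewrite derive1nS derive1E].
by have [] := is_deriveZ (c * k ^+ m) (is_derive1_comp dp dk).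
Qed.

Lemma ae_reflect (P : R -> Prop) (c : R) :
  {ae mu, forall x, P x} -> {ae mu, forall y, P (c - y)}.
Proof.
move=> [N [mN N0 NP]].
have mN' : measurable [set y : R | N (- 1 * y + c)].
  rewrite -[X in measurable X]setTI.
  apply: (measurable_funD (f := fun y : R => -1 * y) (g := fun=> c)) => //.
  exact: mulrl_measurable.
exists [set y | N (- 1 * y + c)]; split => //.
- have k0 : (-1 : R) != 0 by rewrite oppr_eq0 oner_eq0.
  have := @ge0_integral_affine_set _ (-1) c N (cst 1%E) k0 mN (measurable_cst _)
    (fun _ _ => lee01); rewrite !integral_cst// normrN1 !mul1e => <-; exact: N0.
- by move=> y /= Py; apply: NP => /=; rewrite mulN1r addrC.
Qed.

End Bumps.

(** * Rescaled mollifiers as weights of mass one *)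

Section Mollifier.
Context {R : realType}.
Notation mu := (@lebesgue_measure R).
Context (eta : R -> R).
Context (heta : is_mollifier eta).

Lemma bump_rescale e : 0 < e -> bump e (rescale eta e).
Proof.
move=> e0; have [se _ eta0 _] := heta; split.
  rewrite (_ : rescale eta e = fun x => e^-1 * eta (e^-1 * x)).
    exact: smooth_scale.
  by apply/funext => x; rewrite /rescale mulrC [x / e]mulrC mulrC.
move=> x ex; rewrite /rescale eta0 ?mulr0// -ltr_norml normrM normfV (gtr0_norm e0).
by rewrite -leNgt ler_pdivlMr// mul1r ltW.
Qed.

Lemma rescale_ge0 e x : 0 < e -> 0 <= rescale eta e x.
Proof. by move=> e0; case: heta => _ eta_ge0 _ _; rewrite mulr_ge0// invr_ge0 ltW. Qed.

Lemma measurable_rescale e : 0 < e -> measurable_fun setT (rescale eta e).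
Proof.
move=> e0; apply: continuous_measurable_fun; apply: smooth_continuous.
by case: (bump_rescale e0).
Qed.

Lemma weight_rescale e : 0 < e -> weight (rescale eta e).
Proof.
move=> e0; split; first exact: measurable_rescale.
- by move=> x; exact: rescale_ge0.
- apply: eq_integrable
    (bump_weight_integrable (bump_rescale e0) (bounded_measurable_cst 1)) => // x _ /=.
  by rewrite mul1r.
Qed.

(** By scaling one [M], a bound of [eta], serves all [e]; this lets averages against the mollifier
    be compared with averages over intervals of length [2 e]. *)
Lemma mollifier_bound : exists2 M, 0 < M &
  forall e x, 0 < e -> rescale eta e x <= M / e * \1_`[- e, e] x.
Proof.
have b1 := bump_rescale ltr01; have [M M0 HM] := bump_bounded b1; exists M => // e x e0.
have etaE y : eta y = rescale eta 1 y by rewrite /rescale invr1 mul1r mulr1.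
rewrite indicE; have [xe|ex] := leP `|x| e.
  rewrite mem_set /=; last by rewrite in_itv/= -ler_norml.
  rewrite mulr1 /rescale mulrC ler_pM2r ?invr_gt0// etaE.
  exact: le_trans (ler_norm _) (HM _).
have [_ H] := bump_rescale e0.
by rewrite H// mulr_ge0// divr_ge0// ltW.
Qed.

Lemma Rintegral_rescale e : 0 < e -> \int[mu]_x rescale eta e x = 1.
Proof.
move=> e0; have [se eta_ge0 _ eta1] := heta.
have me : measurable_fun setT eta.
  by apply: continuous_measurable_fun; exact: smooth_continuous.
have ei : e^-1 != 0 by rewrite invr_neq0// gt_eqF.
have := @ge0_integral_affine _ e^-1 0 (EFin \o eta) ei.
rewrite eta1 gtr0_norm ?invr_gt0// => H.
rewrite /Rintegral (_ : integral _ _ _ = 1%E)// [RHS]H; last 2 first.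
- exact/measurable_EFinP.
- by move=> x /=; rewrite lee_fin.
rewrite -ge0_integralZl//; last 3 first.
- apply/measurable_EFinP; apply: measurableT_comp me _.
  by apply: measurable_funD => //; exact: mulrl_measurable.
- by move=> x _ /=; rewrite lee_fin.
- by rewrite lee_fin invr_ge0 ltW.
by apply: eq_integral => x _ /=; rewrite -EFinM addr0 [_ * x]mulrC.
Qed.

End Mollifier.

(** * The mollified curve, its velocity and its gaps *)

Section MollifiedCurve.
Context {R : realType} {n : nat}.
Notation mu := (@lebesgue_measure R).
Context (eta : R -> R).
Context (heta : is_mollifier eta).
Implicit Types (z h k : R -> 'rV[R]_n) (e : R).

Lemma mollifyE e h x : mollify eta e h x = wmean (rescale eta e) (fun y => h (x - y)).
Proof. by []. Qed.

Lemma bounded_measurable_rV_reflect h (x : R) :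
  bounded_measurable_rV h -> bounded_measurable_rV (fun y => h (x - y)).
Proof.
by move=> bh i; apply: bounded_measurable_comp (bh i); exact: measurable_funB.
Qed.

Lemma wmean_cst (rho : R -> R) (c : 'rV[R]_n) : weight rho ->
  \int[mu]_x rho x = 1 -> wmean rho (fun=> c) = c.
Proof.
move=> [_ _ ir] r1; apply/rowP => i; rewrite mxE RintegralZl// r1 mulr1 //.
Qed.

Lemma wmeanB (rho : R -> R) h k : weight rho -> bounded_measurable_rV h ->
  bounded_measurable_rV k ->
  wmean rho (fun x => h x - k x) = wmean rho h - wmean rho k.
Proof.
move=> wr bh bk; apply/rowP => i; rewrite !mxE -RintegralB//; last 2 first.
- exact: weighted_integrable.
- exact: weighted_integrable.
by apply: eq_Rintegral => x _; rewrite !mxE mulrBl.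
Qed.

Lemma sqn_mollify_le e h x : 0 < e -> bounded_measurable_rV h ->
  sqn (mollify eta e h x) <= \int[mu]_y (sqn (h (x - y)) * rescale eta e y).
Proof.
move=> e0 bh; rewrite mollifyE.
have := sqn_wmean_le (weight_rescale heta e0) (bounded_measurable_rV_reflect x bh).
by rewrite (Rintegral_rescale heta e0) mul1r; apply.
Qed.

Lemma sqn_mollify_bound e h x B : 0 < e -> bounded_measurable_rV h ->
  (forall t, sqn (h t) <= B) -> sqn (mollify eta e h x) <= B.
Proof.
move=> e0 bh hB; apply: (le_trans (sqn_mollify_le x e0 bh)).
have wr := weight_rescale heta e0; have [_ r0 ir] := wr.
have -> : B = \int[mu]_y (B * rescale eta e y).
  by rewrite RintegralZl// (Rintegral_rescale heta e0) mulr1.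
apply: le_Rintegral => //.
- exact/(weighted_integrable wr)/bounded_measurable_sqn/bounded_measurable_rV_reflect.
- exact: (weighted_integrable wr (bounded_measurable_cst B)).
- by move=> y _; rewrite ler_wpM2r.
Qed.

Lemma bounded_measurable_mollify e h : 0 < e -> bounded_measurable_rV h ->
  bounded_measurable_rV (mollify eta e h).
Proof.
move=> e0 bh i; split.
  apply: continuous_measurable_fun => x.
  have -> : (fun t => mollify eta e h t 0 i) = conv (fun t => h t 0 i) (rescale eta e).
    by apply/funext => t; rewrite mxE.
  apply/differentiable_continuous/derivable1_diffP.
  by case: (is_derive_conv x (bh i) (bump_rescale heta e0)).
have [_ [B hB]] := bounded_measurable_sqn bh.
exists (Num.sqrt B) => x; rewrite (le_trans (coord_le_enorm _ _))// ler_wsqrtr//.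
by apply: sqn_mollify_bound => // t; exact: le_trans (ler_norm _) (hB t).
Qed.

Lemma mollify_periodic e h : periodic h 1 -> periodic (mollify eta e h) 1.
Proof.
move=> ph x; apply/rowP => i; rewrite !mxE; apply: eq_Rintegral => y _.
by rewrite addrAC ph.
Qed.

Lemma velocity_bounded z h : velocity z h -> bounded_measurable_rV z.
Proof.
move=> vz i; split; first exact: velocity_measurable vz i.
have [[pz [K zK]] _ _ _] := vz.
exists (`|z 0 0 i| + `|K|) => x.
have [k xk] := fractE x.
have -> : z x = z (fract x) by rewrite xk (period_int k x pz).
have -> : z (fract x) 0 i = z 0 0 i + (z (fract x) - z 0) 0 i by rewrite !mxE; ring.
rewrite (le_trans (ler_normD _ _))// lerD2l (le_trans (coord_le_enorm _ _))//.
rewrite (le_trans (zK _ _))// subr0.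
have /andP[f0 f1] := fract_itv x; rewrite (ger0_norm f0).
rewrite (@le_trans _ _ (`|K| * fract x))//; first by rewrite ler_wpM2r// ler_norm.
by rewrite -[leRHS]mulr1 ler_wpM2l// ltW.
Qed.

Lemma mollify_lipschitz e z h : 0 < e -> velocity z h ->
  closed_lipschitz (mollify eta e z).
Proof.
move=> e0 vz; have [[pz [K zK]] _ _ _] := vz; split; first exact: mollify_periodic.
have wr := weight_rescale heta e0; have [_ r0 ir] := wr.
have bz := velocity_bounded vz.
exists K => s t; rewrite !mollifyE -wmeanB//; try exact: bounded_measurable_rV_reflect.
have bd : bounded_measurable_rV (fun y => z (s - y) - z (t - y)).
  move=> i; under eq_fun do rewrite !mxE.
  by apply: bounded_measurableB; exact: (bounded_measurable_rV_reflect _ bz i).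
apply: (le_trans (enorm_wmean_le wr bd)).
have -> : K * `|s - t| = \int[mu]_y (K * `|s - t| * rescale eta e y).
  by rewrite RintegralZl// (Rintegral_rescale heta e0) mulr1.
apply: le_Rintegral => //.
- exact/(weighted_integrable wr)/bounded_measurable_enorm.
- exact: (weighted_integrable wr (bounded_measurable_cst (K * `|s - t|))).
- move=> y _; rewrite ler_wpM2r//.
  by have := zK (s - y) (t - y); rewrite (_ : s - y - (t - y) = s - t)//; ring.
Qed.

(** Here the derivative falls on the curve, which is what identifies the velocity of the mollified
    curve as the mollification of [h]; in [smooth_mollify] it falls on the kernel instead. *)
Lemma is_derive_mollify e z h x i : 0 < e -> velocity z h ->
  is_derive x (1 : R) (fun t => mollify eta e z t 0 i) (mollify eta e h x 0 i).
Proof.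
move=> e0 vz; have [[pz [K zK]] ph bh dz] := vz.
have wr := weight_rescale heta e0; have [mr r0 ir] := wr.
have bz := velocity_bounded vz.
have -> : (fun t => mollify eta e z t 0 i) =
    (fun t => \int[mu]_y (z (t - y) 0 i * rescale eta e y)).
  by apply/funext => t; rewrite mxE.
rewrite mxE; apply: (is_derive_integral (G := fun y => K * rescale eta e y)).
- move=> t; exact: (weighted_integrable wr (bounded_measurable_rV_reflect t bz i)).
- exact: (weighted_integrable wr (bounded_measurable_cst K)).
- move=> t y; rewrite -mulrBl normrM (ger0_norm (r0 y)) [leRHS]mulrA ler_wpM2r//.
  have := zK (t - y) (x - y); rewrite (_ : t - y - (x - y) = t - x); last by ring.
  rewrite mulrC; apply: le_trans.
  by have := coord_le_enorm (z (t - y) - z (x - y)) i; rewrite !mxE.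
- by apply: measurable_funM => //; case: (bounded_measurable_rV_reflect x bh i).
- have := ae_reflect x dz; apply: ae_imply => y /is_derive_rV/(_ i) H.
  have H' : is_derive x (1 : R) (fun t => z (t - y) 0 i) (h (x - y) 0 i).
    exact: (@is_derive_comp_addr _ (fun t => z t 0 i) (- y)).
  have := is_deriveZ (rescale eta e y) H'.
  rewrite (_ : (_ \*: _) = (fun t => z (t - y) 0 i * rescale eta e y)); last first.
    by apply/funext => t; rewrite /= mulrC.
  by rewrite -[_ *: _]/(_ * _) mulrC.
Qed.

Lemma derive_mollify e z h x : 0 < e -> velocity z h ->
  derivable (mollify eta e z) x 1 /\ derive1 (mollify eta e z) x = mollify eta e h x.
Proof. by move=> e0 vz; apply/is_derive_rV => i; exact: is_derive_mollify. Qed.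

Lemma velocity_mollify e z h : 0 < e -> velocity z h ->
  velocity (mollify eta e z) (mollify eta e h).
Proof.
move=> e0 vz; have [_ ph bh _] := vz; split.
- exact: mollify_lipschitz vz.
- exact: mollify_periodic.
- exact: bounded_measurable_mollify.
- by apply: aeW => x; exact: derive_mollify.
Qed.

Lemma smooth_mollify e z h : 0 < e -> velocity z h -> smooth (mollify eta e z).
Proof.
move=> e0 vz; have bz := velocity_bounded vz.
have bk (k : nat) : bump e (derive1n k (rescale eta e)).
  elim: k => [|k IHk]; first exact: bump_rescale.
  by rewrite derive1nS; exact: bump_derive1.
have dm (k : nat) x : derivable (fun t => \row_i conv (fun y => z y 0 i)
      (derive1n k (rescale eta e)) t) x 1 /\
    derive1 (fun t => \row_i conv (fun y => z y 0 i) (derive1n k (rescale eta e)) t) x =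
    \row_i conv (fun y => z y 0 i) (derive1n k.+1 (rescale eta e)) x.
  apply/is_derive_rV => i; rewrite mxE; under eq_fun do rewrite mxE.
  by rewrite derive1nS; exact: (is_derive_conv x (bz i) (bk k)).
have E (k : nat) : derive1n k (mollify eta e z) =
    (fun t => \row_i conv (fun y => z y 0 i) (derive1n k (rescale eta e)) t).
  elim: k => [|k IHk]; first by apply/funext => t; apply/rowP => i; rewrite !mxE.
  by rewrite derive1nS IHk; apply/funext => t; case: (dm k t).
by move=> k x; rewrite E; case: (dm k x).
Qed.

Lemma mollify_sub_le e z h x : 0 < e -> velocity z h -> (forall t, enorm (h t) <= 1) ->
  enorm (mollify eta e z x - z x) <= e.
Proof.
move=> e0 vz h1; have bz := velocity_bounded vz.
have wr := weight_rescale heta e0; have [_ r0 ir] := wr.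
have bx := bounded_measurable_rV_reflect x bz.
have bc : bounded_measurable_rV (fun=> z x : 'rV[R]_n).
  by move=> i; exact: bounded_measurable_cst.
rewrite mollifyE -[X in _ - X](wmean_cst (z x) wr (Rintegral_rescale heta e0)) -wmeanB//.
have bd : bounded_measurable_rV (fun y => z (x - y) - z x).
  exact: bounded_measurable_rVB.
apply: (le_trans (enorm_wmean_le wr bd)).
rewrite -[leRHS]mulr1 -(Rintegral_rescale heta e0) -RintegralZl//.
apply: le_Rintegral => //.
- exact/(weighted_integrable wr)/bounded_measurable_enorm.
- exact: (weighted_integrable wr (bounded_measurable_cst e)).
have [_ _ bh _] := vz.
have step a b : a <= b -> enorm (z b - z a) <= b - a.
  move=> ab; apply: (le_trans (chord_le_arc vz ab)).
  by have := arc_real_le bh ab h1; rewrite mul1r.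
move=> y _; have [ye|ey] := leP `|y| e; last first.
  by have [_ ->] := bump_rescale heta e0; rewrite ?mulr0.
rewrite ler_wpM2r// (le_trans _ ye)//.
have [y0|y0] := leP 0 y.
  have yx : x - y <= x by rewrite gerBl.
  have := step _ _ yx; rewrite -enormN opprB (_ : x - (x - y) = y); last by ring.
  by rewrite ger0_norm.
have yx : x <= x - y by rewrite lerDl oppr_ge0 ltW.
have := step _ _ yx; rewrite (_ : x - y - x = - y); last by ring.
by rewrite ltr0_norm.
Qed.

Lemma shift_gap_mollify_le e h u : 0 < e -> bounded_measurable_rV h -> periodic h 1 ->
  (shift_gap (mollify eta e h) u <= shift_gap h u)%E.
Proof.
move=> e0 bh ph; have mh := bounded_measurable_rV_measurable bh.
have wr := weight_rescale heta e0; have [mr r0 ir] := wr.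
pose D (p : R * R) := ((sqn (h (p.1 - p.2 + u) - h (p.1 - p.2)))%:E * (rescale eta e p.2)%:E)%E.
have D0 p : (0 <= D p)%E by rewrite mule_ge0// lee_fin ?sqn_ge0.
have mD : measurable_fun setT D.
  apply: emeasurable_funM.
    apply: measurable_gap => //; first apply: measurable_funD => //; exact: measurable_funB.
  by apply/measurable_EFinP; exact: (measurableT_comp mr measurable_snd).
apply: (@le_trans _ _ (\int[mu]_(x in `[0%R, 1%R]) \int[mu]_(y in setT) D (x, y))%E).
  apply: le_integral_itv.
  - apply: measurable_gap; [|exact: measurable_funD|by []].
    by apply: bounded_measurable_rV_measurable; exact: bounded_measurable_mollify.
  - exact: (@measurable_integral_snd _ _ _ _ R mu setT D).
  - by move=> x; rewrite lee_fin sqn_ge0.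
  - move=> x _; pose k y := h (y + u) - h y.
    have bk : bounded_measurable_rV k.
      move=> i; rewrite /k; under eq_fun do rewrite !mxE.
      apply: bounded_measurableB => //; apply: bounded_measurable_comp (bh i).
      exact: measurable_funD.
    (* Mollification commutes with translation, so the new gap is the mollification of the old gap
       [k], and Jensen applies to [k]. *)
    have -> : mollify eta e h (x + u) - mollify eta e h x = mollify eta e k x.
      rewrite !mollifyE -wmeanB//; try exact: bounded_measurable_rV_reflect.
      by congr (wmean _ _); apply/funext => y; rewrite /k addrAC.
    have bkx := bounded_measurable_sqn (bounded_measurable_rV_reflect x bk).
    apply: (@le_trans _ _ (\int[mu]_y (sqn (k (x - y)) * rescale eta e y))%:E).
      by rewrite lee_fin sqn_mollify_le.
    by rewrite EFin_Rintegral.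
rewrite (@tonelli_in _ _ _ _ R mu mu _ setT D)//.
have mgy y : measurable_fun setT (fun x : R => (sqn (h (x - y + u)%R - h (x - y)%R))%:E).
  apply: measurable_gap => //; last exact: measurable_funB.
  by apply: measurable_funD => //; exact: measurable_funB.
have Fu : (\int[mu]_(y in setT) ((rescale eta e y)%:E * shift_gap h u) = shift_gap h u)%E.
  rewrite ge0_integralZr//; last 3 first.
  - exact/measurable_EFinP.
  - by move=> y _; rewrite lee_fin.
  - exact: shift_gap_ge0.
  have := Rintegral_rescale heta e0; rewrite /Rintegral => r1.
  rewrite -[X in (X * _)%E]fineK ?r1 ?mul1e//.
  exact: integrable_fin_num.
rewrite -[leRHS]Fu le_eqVlt; apply/orP; left; apply/eqP; apply: eq_integral => y _.
rewrite /D/= ge0_integralZr//; last 3 first.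
- by apply: measurable_funTS; exact: mgy.
- by move=> x _; rewrite lee_fin sqn_ge0.
- by rewrite lee_fin.
by rewrite shift_gap_translate// muleC.
Qed.

Lemma shift_gap_sub_le h k u : measurable_rV h -> measurable_rV k ->
  (shift_gap (fun x => (k x - h x)%R) u <= 2%:E * shift_gap k u + 2%:E * shift_gap h u)%E.
Proof.
move=> mh mk.
have mS (f : R -> 'rV[R]_n) : measurable_rV f ->
    measurable_fun setT (fun x : R => (sqn (f (x + u)%R - f x))%:E).
  by move=> mf; apply: measurable_gap => //; exact: measurable_funD.
have mkh : measurable_rV (fun x => k x - h x).
  by move=> i; under eq_fun do rewrite !mxE; exact: measurable_funB.
have D0 (f : R -> 'rV[R]_n) (x : R) : (0 <= 2%:E * (sqn (f (x + u)%R - f x))%:E)%E.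
  by rewrite mule_ge0// lee_fin sqn_ge0.
have mD (f : R -> 'rV[R]_n) : measurable_rV f ->
    measurable_fun `[(0 : R), 1]%classic (fun x : R => 2%:E * (sqn (f (x + u)%R - f x))%:E)%E.
  by move=> mf; apply: measurable_funTS; apply: measurable_funeM; exact: mS.
have Z (f : R -> 'rV[R]_n) : measurable_rV f -> (2%:E * shift_gap f u =
    \int[mu]_(x in `[0%R, 1%R]) (2%:E * (sqn (f (x + u)%R - f x))%:E))%E.
  move=> mf; rewrite integralZl_itv//; first exact: mS.
  by move=> x; rewrite lee_fin sqn_ge0.
rewrite (Z k mk) (Z h mh).
rewrite -(@ge0_integralD _ _ _ mu _ (measurable_itv _) _ _
  (fun x _ => D0 k x) (mD k mk) (fun x _ => D0 h x) (mD h mh)).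
apply: le_integral_itv.
- exact: (mS _ mkh).
- by apply: emeasurable_funD; apply: measurable_funeM; exact: mS.
- by move=> x; rewrite lee_fin sqn_ge0.
- move=> x _; rewrite -!EFinM -EFinD lee_fin.
  have -> : k (x + u) - h (x + u) - (k x - h x) = (k (x + u) - k x) - (h (x + u) - h x).
    by apply/rowP => i; rewrite !mxE; ring.
  exact: sqnB_le.
Qed.

Lemma shift_gap_mollify_sub_le e h u : 0 < e -> bounded_measurable_rV h -> periodic h 1 ->
  (shift_gap (fun x => (mollify eta e h x - h x)%R) u <= 4%:E * shift_gap h u)%E.
Proof.
move=> e0 bh ph; have mh := bounded_measurable_rV_measurable bh.
have mm := bounded_measurable_rV_measurable (bounded_measurable_mollify e0 bh).
apply: (le_trans (shift_gap_sub_le u mh mm)).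
apply: (@le_trans _ _ (2%:E * shift_gap h u + 2%:E * shift_gap h u)%E).
  by apply: leeD => //; apply: lee_wpmul2l => //; exact: shift_gap_mollify_le.
rewrite -ge0_muleDl ?lee_fin// -EFinD le_eqVlt; apply/orP; left; apply/eqP.
by congr (_%:E * _)%E; ring.
Qed.

(* [\int |mollify h - h|^2 <= \int rho_e F <= (M / e) \int_{|u| <= e} F] and
   [F <= e^2 F u ^- 2] there, so the error is [O(e)] times the gap energy. *)
Lemma mollify_L2_le : exists2 M, 0 < M & forall e h, 0 < e ->
  bounded_measurable_rV h -> periodic h 1 ->
  (sqr_norm2 (fun x => mollify eta e h x - h x)%R <= (M * e)%:E * gap_energy h e)%E.
Proof.
have [M M0 HM] := mollifier_bound heta; exists M => // e h e0 bh ph.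
have mh := bounded_measurable_rV_measurable bh.
have wr := weight_rescale heta e0; have [mr r0 ir] := wr.
pose D (p : R * R) := ((sqn (h (p.1 - p.2) - h p.1))%:E * (rescale eta e p.2)%:E)%E.
have D0 p : (0 <= D p)%E by rewrite mule_ge0// lee_fin ?sqn_ge0.
have mD : measurable_fun setT D.
  apply: emeasurable_funM.
    by apply: measurable_gap => //; exact: measurable_funB.
  by apply/measurable_EFinP; exact: (measurableT_comp mr measurable_snd).
have mm := bounded_measurable_rV_measurable (bounded_measurable_mollify e0 bh).
apply: (@le_trans _ _ (\int[mu]_(x in `[0%R, 1%R]) \int[mu]_(y in setT) D (x, y))%E).
  rewrite /sqr_norm2; under eq_integral do rewrite enorm_sqr.
  apply: le_integral_itv.
  - by apply/measurable_EFinP; exact: measurable_sqnB.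
  - exact: (@measurable_integral_snd _ _ _ _ R mu setT D).
  - by move=> x; rewrite lee_fin sqn_ge0.
  - move=> x _; have bx := bounded_measurable_rV_reflect x bh.
    have bc : bounded_measurable_rV (fun=> h x : 'rV[R]_n).
      by move=> i; exact: bounded_measurable_cst.
    have bd := bounded_measurable_rVB (h x) bx.
    rewrite mollifyE -[X in _ - X](wmean_cst (h x) wr (Rintegral_rescale heta e0)) -wmeanB//.
    apply: (@le_trans _ _ (\int[mu]_y (sqn (h (x - y) - h x) * rescale eta e y))%:E).
      have := sqn_wmean_le wr bd; rewrite (Rintegral_rescale heta e0) mul1r lee_fin.
      by apply.
    rewrite EFin_Rintegral//; exact: bounded_measurable_sqn.
rewrite (@tonelli_in _ _ _ _ R mu mu _ setT D)//.
have mF := measurable_shift_gap mh.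
have mr' : measurable_fun setT (fun y => (rescale eta e y)%:E) by exact/measurable_EFinP.
apply: (@le_trans _ _ (\int[mu]_(y in setT) (shift_gap h y * (rescale eta e y)%:E))%E).
  rewrite le_eqVlt; apply/orP; left; apply/eqP; apply: eq_integral => y _.
  rewrite /D/= ge0_integralZr//; last 3 first.
  - by apply: measurable_funTS; apply: measurable_gap => //; exact: measurable_funB.
  - by move=> x _; rewrite lee_fin sqn_ge0.
  - by rewrite lee_fin.
  by congr (_ * _)%E; rewrite -(shift_gapN y mh ph).
have mG : measurable_fun setT (fun u => shift_gap h u * ((u ^+ 2)^-1)%:E)%E.
  by apply: emeasurable_funM => //; apply/measurable_EFinP/measurable_invr/measurable_funX.
have G0 u : (0 <= shift_gap h u * ((u ^+ 2)^-1)%:E)%E.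
  by rewrite mule_ge0 ?shift_gap_ge0// lee_fin invr_ge0 sqr_ge0.
rewrite /gap_energy -integralZl_itv//; last by rewrite mulr_ge0// ltW.
rewrite [leRHS]integral_mkcond; apply: ge0_le_integral => //.
- by move=> y _; rewrite mule_ge0 ?shift_gap_ge0// lee_fin.
- exact: emeasurable_funM.
- apply/(measurable_restrictT _ _).1 => //; apply: measurable_funTS.
  exact: measurable_funeM.
- move=> y _; rewrite /patch; case: ifPn => [/set_mem/=|/negP yA].
    rewrite in_itv/= -ler_norml => ye.
    (* The comparison of the mollifier with [M * e / y ^+ 2] fails at [y = 0], where the right side
       is [0] by convention; the gap vanishes there. *)
    have [->|y0] := eqVneq y 0; first by rewrite shift_gap0 !mul0e mule0.
    rewrite muleCA; apply: lee_wpmul2l; first exact: shift_gap_ge0.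
    rewrite -EFinM lee_fin (le_trans (HM e y e0))// indicE mem_set/=; last first.
      by rewrite in_itv/= -ler_norml.
    rewrite mulr1 ler_pdivlMr ?exprn_even_gt0//.
    rewrite -(ler_pM2r e0) mulrAC divfK ?gt_eqF// -mulrA ler_pM2l// -expr2.
    by rewrite -(real_normK (num_real y)) lerXn2r// nnegrE ltW.
  have [_ ->] := bump_rescale heta e0; first by rewrite mule0.
  by rewrite ltNge; apply/negP => ye; apply: yA; rewrite inE/= in_itv/= -ler_norml.
Qed.

(** [weighted_mean_gap] for the mollifier reflected at [x]: its mass is [1], its height at most
    [M / e] and its window has length [2 e], whence the constant [2 M]. *)
Lemma mollify_speed_ge : exists2 M, 0 < M & forall e h, 0 < e -> e <= 2^-1 ->
  bounded_measurable_rV h -> periodic h 1 -> (forall t, sqn (h t) = 1) ->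
  forall x, ((1 - sqn (mollify eta e h x))%:E <= M%:E * gap_energy h (2 * e))%E.
Proof.
have [M M0 HM] := mollifier_bound heta; exists (M * 2); first by rewrite mulr_gt0.
move=> e h e0 e12 bh ph h1 x.
have [mr r0 ir] := weight_rescale heta e0.
pose rho y := rescale eta e (x - y).
have mrho : measurable_fun setT rho.
  by apply: measurableT_comp mr _; exact: measurable_funB.
have rhoE : forall y, rho y <= M / e * \1_`[x - e, x - e + 2 * e] y.
  move=> y; apply: (le_trans (HM e (x - y) e0)).
  rewrite le_eqVlt; apply/orP; left; apply/eqP; congr (_ * _).
  rewrite !indicE; congr (nat_of_bool _)%:R.
  by apply/idP/idP; rewrite !inE/= !in_itv/= => /andP[? ?]; apply/andP; split; lra.
have rhoI : \int[mu]_y rho y = 1.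
  by rewrite -(Rintegral_rescale heta e0) [RHS](integral_comp_opp_shift x).
have wr : weight rho.
  split => // [y|]; first exact: r0.
  have [_ _ /(integrableZl measurableT (M / e)) ig] := weight_indic (x - e) (x - e + 2 * e).
  apply: (@le_integrable _ _ _ mu setT measurableT _ _ _ _ ig).
  - exact/measurable_EFinP.
  - by move=> y _ /=; rewrite lee_fin (ger0_norm (r0 _)) (le_trans (rhoE y))// ler_norm.
have -> : mollify eta e h x = wmean rho h.
  apply/rowP => i; rewrite !mxE [RHS](integral_comp_opp_shift x); last first.
    by apply: measurable_funM => //; case: (bh i).
  by apply: eq_Rintegral => y _; rewrite /rho subKr.
have w01 : 0 < 2 * e <= 1 by rewrite mulr_gt0//=; lra.
have Me : 0 <= M / e by rewrite divr_ge0// ltW.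
have hc t : 1 <= sqn (h t) by rewrite h1.
have := weighted_mean_gap bh ph wr w01 Me rhoE hc.
rewrite rhoI expr1n !mul1r; suff -> : M / e * (2 * e) = M * 2 by [].
by field; rewrite gt_eqF.
Qed.

End MollifiedCurve.

(** * Smooth periodic test functions and periodisation *)

Section PeriodicTestFunctions.
Context {R : realType}.
Notation mu := (@lebesgue_measure R).
Implicit Types (f phi psi : R -> R).

Lemma bounded_measurable_integrable_itv f a b : bounded_measurable f ->
  mu.-integrable `[a, b] (EFin \o f).
Proof.
move=> bf; rewrite integrable_mkcond//.
apply: eq_integrable (weighted_integrable (weight_indic a b) bf) => // x _.
by rewrite restrict_EFin/= patch_indic.
Qed.

Lemma periodic_derive1 phi : periodic phi 1 -> periodic (derive1 phi) 1.
Proof.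
move=> pp x; rewrite /derive1.
suff -> : (fun h => h^-1 *: (phi (h + (x + 1)) - phi (x + 1))) =
    (fun h => h^-1 *: (phi (h + x) - phi x)) by [].
by apply/funext => h; rewrite addrA !pp.
Qed.

Lemma periodic_bounded phi : continuous phi -> periodic phi 1 ->
  exists M, forall x, `|phi x| <= M.
Proof.
move=> cp pp; have cn : continuous (fun x => `|phi x|).
  by move=> x; apply: cvg_norm; exact: cp.
have [c _ Hc] := EVT_max (@ler01 R) (continuous_subspaceT cn).
exists `|phi c| => x; have [k xk] := fractE x.
have /andP[f0 f1] := fract_itv x.
have -> : phi x = phi (fract x) by rewrite xk (period_int k x pp).
by apply: Hc; rewrite in_itv/= f0 ltW.
Qed.

Lemma smooth_periodic_bounded phi : smooth phi -> periodic phi 1 ->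
  bounded_measurable phi.
Proof.
move=> sp pp; have cp := smooth_continuous sp; split.
  exact: continuous_measurable_fun.
exact: periodic_bounded.
Qed.

Lemma smooth_periodic_lipschitz phi : smooth phi -> periodic phi 1 ->
  exists2 L, 0 <= L & forall s t, `|phi s - phi t| <= L * `|s - t|.
Proof.
move=> sp pp.
have [_ [L HL]] := smooth_periodic_bounded (smooth_derive1 sp) (periodic_derive1 pp).
have L0 : 0 <= L by rewrite (le_trans _ (HL 0)).
exists L => //.
have H s t : s <= t -> `|phi s - phi t| <= L * `|s - t|.
  move=> st; have [c _] := @MVT_segment _ phi (derive1 phi) s t st
    (fun x _ => smooth_is_derive x sp) (continuous_subspaceT (smooth_continuous sp)).
  by move=> E; rewrite distrC E normrM (distrC s) ler_wpM2r.
move=> s t; have [st|ts] := leP s t; first exact: H.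
by rewrite distrC (distrC s) H// ltW.
Qed.

Definition supported_in (a b : R) psi := forall y, psi y != 0 -> a <= y <= b.

Lemma supported_derive1 a b psi : supported_in a b psi -> supported_in a b (derive1 psi).
Proof.
move=> spsi y; apply: contraR => yab.
have H : \forall t \near y, (cst 0 : R -> R) t = psi t.
  have [ya|ay] := ltP y a.
    apply/nbhs_ballP; exists (a - y) => /=; first by rewrite subr_gt0.
    move=> t; rewrite /ball/= ltr_norml => /andP[t1 t2].
    apply/esym/eqP; apply: contraT => /spsi /andP[at_ _].
    by lra.
  have yb : b < y by move: yab; rewrite ay/= -ltNge.
  apply/nbhs_ballP; exists (y - b) => /=; first by rewrite subr_gt0.
  move=> t; rewrite /ball/= ltr_norml => /andP[t1 t2].
  apply/esym/eqP; apply: contraT => /spsi /andP[_ tb].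
  by lra.
by rewrite derive1E -(near_eq_derive _ H) derive_cst.
Qed.

(* Near an integer the periodisation [psi \o fract] vanishes; elsewhere [fract]
   is a translation. *)
Lemma is_derive_periodisation a b psi x : 0 < a -> b < 1 -> smooth psi ->
  supported_in a b psi ->
  is_derive x (1 : R) (psi \o @fract R) (derive1 psi (fract x)).
Proof.
move=> a0 b1 sp spsi; have /andP[f0 f1] := fract_itv x.
have [k xk] := fractE x.
have z0 y : ~~ (a <= y <= b) -> psi y = 0.
  by move=> yab; apply/eqP; apply: contraR yab => /spsi.
have [fa|af] := ltP (fract x) a.
  have -> : derive1 psi (fract x) = 0.
    apply/eqP; apply: contraT => /(supported_derive1 spsi)/andP[afx _].
    by move: fa; rewrite ltNge afx.
  have H : \forall t \near x, (cst 0 : R -> R) t = (psi \o @fract R) t.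
    (* Within [r] of [x], [fract t] stays below [a], or it jumps above [b] if an integer is crossed
       to the left; [psi] vanishes in both cases. *)
    pose r := Num.min (a - fract x) (Num.min (1 - b) (1 - fract x)).
    have r0 : 0 < r by rewrite !lt_min !subr_gt0 fa b1.
    have r1 : r <= a - fract x by rewrite ge_min lexx.
    have r2 : r <= 1 - b by rewrite !ge_min lexx orbT.
    have r3 : r <= 1 - fract x by rewrite !ge_min lexx !orbT.
    apply/nbhs_ballP; exists r => //= t; rewrite /ball/= ltr_norml => /andP[t1 t2].
    apply/esym/z0; have [xt|tx] := leP 0 (t + k%:~R).
      have -> : fract t = t + k%:~R.
        by rewrite -(fract_int t k) fract_id//; apply/andP; split; lra.
      by rewrite negb_and -!ltNge; apply/orP; left; lra.
    have -> : fract t = t + k%:~R + 1.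
      by rewrite -(fract_int t k) -fract1 fract_id//; apply/andP; split; lra.
    by rewrite negb_and -!ltNge; apply/orP; right; lra.
  by apply: (near_eq_is_derive H); exact: is_derive_cst.
have H : \forall t \near x, psi (t + k%:~R) = (psi \o @fract R) t.
  pose r := Num.min a (1 - fract x).
  have r0 : 0 < r by rewrite lt_min subr_gt0 a0.
  have r1 : r <= a by rewrite ge_min lexx.
  have r2 : r <= 1 - fract x by rewrite ge_min lexx orbT.
  apply/nbhs_ballP; exists r => //= t; rewrite /ball/= ltr_norml => /andP[t1 t2].
  rewrite -(fract_int t k) fract_id//; apply/andP; split; lra.
apply: (near_eq_is_derive H); apply: is_derive_comp_addr; rewrite -xk.
exact: smooth_is_derive.
Qed.

Lemma smooth_periodisation a b psi : 0 < a -> b < 1 -> smooth psi ->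
  supported_in a b psi -> smooth (psi \o @fract R).
Proof.
move=> a0 b1 sp spsi k.
have -> : derive1n k (psi \o @fract R) = derive1n k psi \o @fract R.
  elim: k psi sp spsi => [//|k IHk] psi sp spsi.
  rewrite !derive1Sn -IHk; [|exact: smooth_derive1|exact: supported_derive1].
  congr (derive1n k); apply/funext => x; rewrite derive1E.
  by case: (is_derive_periodisation x a0 b1 sp spsi).
move=> x; have spk : smooth (derive1n k psi).
  by elim: k => [//|k IHk]; rewrite derive1nS; exact: smooth_derive1.
have supk : supported_in a b (derive1n k psi).
  by elim: (k) => [//|k' IHk]; rewrite derive1nS; exact: supported_derive1.
by case: (is_derive_periodisation x a0 b1 spk supk).
Qed.

End PeriodicTestFunctions.

(** * Weak derivatives and their uniqueness *)

Section WeakDerivatives.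
Context {R : realType} {n : nat}.
Notation mu := (@lebesgue_measure R).
Implicit Types z h f g : R -> 'rV[R]_n.

(** Each product of a coordinate of [z] with [phi] is Lipschitz and periodic, so [lipschitz_FTC]
    over [[0, 1]] yields integration by parts without boundary term. *)
Lemma velocity_weak_deriv z h : velocity z h -> is_weak_deriv z h.
Proof.
move=> vz; have [[pz [K zK]] ph bh dz] := vz; have bz := velocity_bounded vz.
split.
- by split=> // i; exact: bounded_measurable_integrable_itv.
- by split=> // i; exact: bounded_measurable_integrable_itv.
move=> phi i sp pp.
have bp := smooth_periodic_bounded sp pp.
have bp' := smooth_periodic_bounded (smooth_derive1 sp) (periodic_derive1 pp).
have [L L0 HL] := smooth_periodic_lipschitz sp pp.
have [_ [M pM]] := bp; have [_ [N zN]] := bz i.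
have N0 : 0 <= N by rewrite (le_trans _ (zN 0)).
have M0 : 0 <= M by rewrite (le_trans _ (pM 0)).
have zKi s t : `|z s 0 i - z t 0 i| <= K * `|s - t|.
  apply: le_trans (zK s t).
  by have := coord_le_enorm (z s - z t) i; rewrite !mxE.
pose P t := z t 0 i * phi t.
have PL s t : `|P s - P t| <= (N * L + M * K) * `|s - t|.
  have -> : P s - P t = z s 0 i * (phi s - phi t) + phi t * (z s 0 i - z t 0 i).
    by rewrite /P; ring.
  rewrite (le_trans (ler_normD _ _))// mulrDl -!mulrA !normrM lerD// ler_pM//.
have bQ : bounded_measurable (fun t => h t 0 i * phi t + z t 0 i * derive1 phi t).
  by apply: bounded_measurableD; exact: bounded_measurableM.
have := @lipschitz_FTC _ P _ (N * L + M * K) 0 1 ler01 PL bQ.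
have -> : P 1 - P 0 = 0.
  by rewrite /P -[in X in X * _](add0r 1) pz -[in X in _ * X - _](add0r 1) pp subrr.
move=> H.
have {}H : \int[mu]_(t in `[0, 1]) (h t 0 i * phi t + z t 0 i * derive1 phi t) = 0.
  apply: H; apply: ae_imply dz => x /is_derive_rV/(_ i) dzx.
  have := is_deriveM dzx (smooth_is_derive x sp).
  rewrite (_ : _ + _ = h x 0 i * phi x + z x 0 i * derive1 phi x)//.
  by rewrite -[_ *: _]/(_ * _) -[_ *: _]/(_ * _); ring.
move: H; rewrite RintegralD//.
- by move/eqP; rewrite addrC addr_eq0 => /eqP.
- by apply: bounded_measurable_integrable_itv; exact: bounded_measurableM.
- by apply: bounded_measurable_integrable_itv; exact: bounded_measurableM.
Qed.

(** A [psi] supported inside []0, 1[] is not periodic, so its periodisation is used as the test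
    function. *)
Lemma weak_deriv_bump f g1 g2 (a b : R) psi i : is_weak_deriv f g1 -> is_weak_deriv f g2 ->
  0 < a -> b < 1 -> smooth psi -> supported_in a b psi ->
  \int[mu]_(x in `[0, 1]) ((g1 x 0 i - g2 x 0 i) * psi x) = 0.
Proof.
move=> [_ [_ i1] H1] [_ [_ i2] H2] a0 b1 sp spsi.
have sf := smooth_periodisation a0 b1 sp spsi.
have pf : periodic (psi \o @fract R) 1 by move=> x; rewrite /= fract1.
have E : \int[mu]_(x in `[0, 1]) (g1 x 0 i * (psi \o @fract R) x) =
    \int[mu]_(x in `[0, 1]) (g2 x 0 i * (psi \o @fract R) x).
  by apply: oppr_inj; rewrite -H1// -H2.
(* At the endpoint [1] the fractional part jumps to [0], but [psi] vanishes at both points. *)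
have fE x : x \in `[0, 1]%classic -> (psi \o @fract R) x = psi x.
  rewrite inE/= in_itv/= => /andP[x0]; rewrite le_eqVlt => /predU1P[->|x1].
    rewrite /= (_ : fract 1 = 0); last by rewrite -[1]add0r fract1 fract_id// lexx/=.
    have p0 y : ~~ (a <= y <= b) -> psi y = 0.
      by move=> yab; apply/eqP; apply: contraR yab => /spsi.
    rewrite !p0// negb_and -!ltNge; first by rewrite b1 orbT.
    by rewrite a0.
  by rewrite /= fract_id// x0.
have bf := smooth_periodic_bounded sf pf.
have II g : mu.-integrable `[0, 1] (fun x => (g x 0 i)%:E) ->
    mu.-integrable `[0, 1] (EFin \o (fun x => g x 0 i * (psi \o @fract R) x)).
  move=> ig; have [mf [M fM]] := bf.
  have bM : [bounded (psi \o @fract R) x | x in `[0, 1]%classic].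
    exists M; split => [|t Mt x _ /=]; first exact: num_real.
    exact: le_trans (fM x) (ltW Mt).
  have mf' : measurable_fun (`[0, 1]%classic : set R) (psi \o @fract R).
    exact: measurable_funTS mf.
  have := @integrableMl _ _ _ mu _ (measurable_itv _) (fun x => (g x 0 i)%:E) _ ig mf' bM.
  by apply: eq_integrable => // x _; rewrite /= EFinM.
transitivity (\int[mu]_(x in `[0, 1]) (g1 x 0 i * (psi \o @fract R) x
    - g2 x 0 i * (psi \o @fract R) x)).
  by apply: eq_Rintegral => x x01; rewrite fE// mulrBl.
by rewrite RintegralB//; [rewrite E subrr|exact: II|exact: II].
Qed.

(* At a Lebesgue point [x] of [d], testing against the rescaled mollifiers at [x]
   bounds [|d x|] by averages of [|d - d x|] over shrinking balls. *)
Lemma ae_eq0_of_lebesgue (eta : R -> R) (d : R -> R) : is_mollifier eta ->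
  mu.-integrable `[0, 1] (EFin \o d) ->
  (forall a b psi, 0 < a -> b < 1 -> smooth psi -> supported_in a b psi ->
     \int[mu]_(x in `[0, 1]) (d x * psi x) = 0) ->
  {ae mu, forall x, `[0, 1]%classic x -> d x = 0}.
Proof.
move=> heta id dpsi.
have [M M0 HM] := mollifier_bound heta.
pose D := d \_ `[0, 1]%classic.
have lD : locally_integrable setT D by exact: integrable_locally.
have iD : mu.-integrable setT (EFin \o D).
  by move: id; rewrite integrable_mkcond// restrict_EFin.
have mD : measurable_fun setT D by case/integrableP: iD => /measurable_EFinP.
have := lebesgue_differentiation lD.
(* Away from the endpoints a small mollifier centred at [x] is supported inside []0, 1[]. *)
have N01 : {ae mu, forall x, x != 0 /\ x != 1}.
  exists [set 0; 1]; split => //.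
  - exact: measurableU.
  - rewrite measureU0//; exact: lebesgue_measure_set1.
  - move=> x /= H; have [->|x0] := eqVneq x 0; first by left.
    by have [->|x1] := eqVneq x 1; [right|exfalso; apply: H].
move=> Hleb; have := @filterI _ _ (ae_filter_ringOfSetsType mu) _ _ N01 Hleb.
apply: ae_imply => x [[x0 x1] lx] /=; rewrite in_itv/= => /andP[x0' x1'].
have {x0 x0'} x0 : 0 < x by rewrite lt_def x0.
have {x1 x1'} x1 : x < 1 by rewrite lt_def eq_sym x1.
have DxE : D x = d x by rewrite /D /patch mem_set//= in_itv/= !ltW.
rewrite -DxE.
(* The mollifier at [x] has integral [1] against constants and [0] against [D]. It is at most
   [M / e], and the open ball of radius [2 e], large enough to contain the closed support, has
   measure [4 e]; hence [4 * M]. *)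
have key e : 0 < e -> e < x -> e < 1 - x -> (`|D x|%:E <= (4 * M)%:E * davg D x (2 * e))%E.
  move=> e0 ex e1; have wr := weight_rescale heta e0; have [mr r0 ir] := wr.
  have brs := bump_rescale heta e0.
  pose psi y := rescale eta e (x - y).
  have spsi : smooth psi.
    have [sr _] := brs.
    have ss : smooth (fun s => rescale eta e (x + s)).
      have dE k s : is_derive s (1 : R) (fun t => derive1n k (rescale eta e) (t + x))
          (derive1n k.+1 (rescale eta e) (s + x)).
        by apply: is_derive_comp_addr; apply: DeriveDef; [exact: sr|rewrite derive1nS derive1E].
      move=> k; have -> : derive1n k (fun s => rescale eta e (x + s)) =
          (fun s => derive1n k (rescale eta e) (s + x)).
        elim: k => [|k IHk]; first by apply/funext => s; rewrite /= addrC.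
        by rewrite derive1nS IHk; apply/funext => s; rewrite derive1E; case: (dE k s).
      by move=> s; case: (dE k s).
    have := smooth_scale (c := 1) (k := -1) ss; congr smooth; apply/funext => t.
    by rewrite /psi mul1r mulN1r.
  have supp : supported_in (x - e) (x + e) psi.
    move=> y; apply: contraR => yx; apply/eqP; apply: brs.2.
    rewrite ltNge; apply: contra yx; rewrite ler_norml => /andP[? ?].
    by apply/andP; split; lra.
  have I0 : \int[mu]_y (D y * psi y) = 0.
    rewrite -(dpsi (x - e) (x + e) psi)//; [|lra|lra].
    rewrite [RHS]Rintegral_mkcond; apply: eq_Rintegral => y _.
    by rewrite /D /patch; case: ifPn => // _; rewrite mul0r.
  have mpsi : measurable_fun setT psi.
    by apply: measurableT_comp mr _; exact: measurable_funB.
  have psi1 : \int[mu]_y psi y = 1.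
    by rewrite -(Rintegral_rescale heta e0) [RHS](integral_comp_opp_shift x).
  have psiM y : psi y <= M / e * \1_(ball x (2 * e)) y.
    apply: (le_trans (HM e (x - y) e0)); rewrite ler_wpM2l ?divr_ge0 ?(ltW M0) ?(ltW e0)//.
    rewrite !indicE; have [xy|xy] := boolP (x - y \in _); last by rewrite ler0n.
    rewrite mem_set//; move: xy; rewrite inE/= in_itv/= -ler_norml /ball/= => xy.
    by rewrite (le_lt_trans xy)//; lra.
  have psi0 y : 0 <= psi y by exact: r0.
  have ipsi : mu.-integrable setT (EFin \o psi).
    have [_ _ /(integrableZl measurableT (M / e)) ig] := weight_indic (x - 2 * e) (x + 2 * e).
    apply: (@le_integrable _ _ _ mu setT measurableT _ _ _ _ ig).
    - exact/measurable_EFinP.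
    - move=> y _ /=; rewrite lee_fin (ger0_norm (psi0 y)) (le_trans (psiM y))//.
      rewrite (le_trans _ (ler_norm _))// ler_wpM2l ?divr_ge0 ?(ltW M0) ?(ltW e0)//.
      rewrite !indicE; have [xy|xy] := boolP (y \in (ball x (2 * e) : set R)); last by rewrite ler0n.
      rewrite mem_set//; move: xy; rewrite inE/= in_itv/= /ball/= ltr_norml => /andP[? ?].
      by apply/andP; split; lra.
  have bpsi : bounded_measurable psi.
    split => //; exists (M / e) => y; rewrite ger0_norm// (le_trans (psiM y))//.
    rewrite -[leRHS]mulr1; apply: ler_wpM2l; first by rewrite divr_ge0 ?(ltW M0) ?(ltW e0).
    by rewrite indicE; case: (_ \in _); rewrite ?ler01.
  have iDpsi : mu.-integrable setT (EFin \o (fun y => D y * psi y)).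
    have [_ [B HB]] := bpsi.
    apply: (@integrableMl _ _ _ mu setT measurableT (EFin \o D) psi iD mpsi).
    by exists B; split => [|t Bt y _ /=]; [exact: num_real|exact: le_trans (HB y) (ltW Bt)].
  have icpsi : mu.-integrable setT (EFin \o (fun y => D x * psi y)).
    exact: (integrableZl measurableT (D x) ipsi).
  have E : D x = \int[mu]_y (D x * psi y - D y * psi y).
    by rewrite RintegralB// I0 subr0 RintegralZl// psi1 mulr1.
  have iE : mu.-integrable setT (EFin \o (fun y => D x * psi y - D y * psi y)).
    exact: (integrableB measurableT icpsi iDpsi).
  rewrite [in leLHS]E.
  apply: (@le_trans _ _ (\int[mu]_y (`|D x * psi y - D y * psi y|)%:E)%E).
    rewrite EFin_normr_Rintegral//; apply: le_abse_integral => //.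
    by case/integrableP: iE.
  rewrite /davg /iavg.
  have -> : mu (ball x (2 * e)) = (4 * e)%:E.
    have e20 : 0 <= 2 * e by rewrite mulr_ge0// ltW.
    by rewrite (lebesgue_measure_ball _ e20) mulr2n; congr EFin; ring.
  have mball : measurable (ball x (2 * e)) by exact: measurable_ball.
  have mDx : measurable_fun setT (fun y : R => (`|D y - D x|)%:E).
    apply/measurable_EFinP; apply: measurableT_comp => //; exact: measurable_funB.
  rewrite inver gt_eqF ?mulr_gt0// muleA -EFinM.
  have -> : 4 * M * (4 * e)^-1 = M / e by field; rewrite gt_eqF.
  have -> : (\int[mu]_(y in ball x (2 * e)) `| ((center (D x) \o D) y)%:E | =
      \int[mu]_(y in ball x (2 * e)) (`|D y - D x|)%:E)%E by [].
  have mDx' : measurable_fun (ball x (2 * e)) (fun y : R => (`|D y - D x|)%:E).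
    exact: measurable_funTS.
  rewrite -(@ge0_integralZl _ _ _ mu _ mball _ mDx'); last 2 first.
  - by move=> y _; rewrite lee_fin.
  - by rewrite lee_fin divr_ge0// ltW.
  rewrite [leRHS]integral_mkcond; apply: ge0_le_integral => //.
  - by apply/measurable_EFinP; apply: measurableT_comp => //;
      apply: measurable_funB; apply: measurable_funM.
  - apply/(measurable_restrictT _ _).1 => //; exact: measurable_funeM.
  - move=> y _; have := psiM y; rewrite /patch indicE.
    rewrite -mulrBl normrM (ger0_norm (psi0 y)) distrC.
    case: (_ \in _) => /=; rewrite ?mulr1 ?mulr0 => psiMy.
      by rewrite -EFinM lee_fin mulrC ler_wpM2r.
    have -> : psi y = 0 by apply/eqP; rewrite eq_le psiMy psi0.
    by rewrite mulr0.
apply/eqP; rewrite -normr_eq0 eq_le normr_ge0 andbT.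
apply/ler_addgt0Pr => t t0; rewrite add0r.
have s0 : 0 < t / (4 * M) by rewrite divr_gt0// mulr_gt0.
move: lx => /fine_cvgP[lfin /cvgrPdist_lt /(_ _ s0) lx].
have xe : 0 < Num.min x (1 - x) by rewrite lt_min x0 subr_gt0.
near (0 : R)^'+ => r.
have r0 : 0 < r by near: r; exact: nbhs_right_gt.
have rx : r < Num.min x (1 - x) by near: r; exact: nbhs_right_lt.
have dfin : davg D x r \is a fin_num by near: r; exact: lfin.
have dlt : `|0 - fine (davg D x r)| < t / (4 * M) by near: r; exact: lx.
move: rx; rewrite lt_min => /andP[rx rx1].
have r20 : 0 < r / 2 by rewrite divr_gt0.
have rr : 2 * (r / 2) = r by rewrite mulrC divfK.
have := key (r / 2) r20; rewrite rr -(fineK dfin) -EFinM lee_fin => H.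
apply: (le_trans (H _ _)); [clear -rx r0; lra|clear -rx1 r0; lra|].
move: dlt; rewrite sub0r normrN => /(le_lt_trans (ler_norm _)).
by rewrite ltr_pdivlMr ?mulr_gt0// mulrC => /ltW.
Unshelve. all: by end_near. Qed.

Lemma weak_deriv_unique (eta : R -> R) f g1 g2 : is_mollifier eta ->
  is_weak_deriv f g1 -> is_weak_deriv f g2 ->
  {ae mu, forall x, `[0, 1]%classic x -> g1 x = g2 x}.
Proof.
move=> heta w1 w2.
have Hi i : {ae mu, forall x, `[0, 1]%classic x -> g1 x 0 i - g2 x 0 i = 0}.
  apply: (ae_eq0_of_lebesgue heta) => [|a b psi a0 b1 sp spsi].
    have [_ [_ i1] _] := w1; have [_ [_ i2] _] := w2.
    have := @integrableB _ _ _ mu _ (measurable_itv _) _ _ (i1 i) (i2 i).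
    by apply: eq_integrable => // x _; rewrite /= EFinB.
  exact: weak_deriv_bump w1 w2 a0 b1 sp spsi.
have := @filter_forall _ _ _ _ (ae_filter_ringOfSetsType mu) Hi.
apply: ae_imply => x H x01; apply/rowP => i; apply/eqP.
by rewrite -subr_eq0 H.
Qed.

Lemma weak_deriv_velocity (eta : R -> R) z h : is_mollifier eta -> velocity z h ->
  {ae mu, forall x, `[0, 1]%classic x -> weak_deriv z x = h x}.
Proof.
move=> heta vz; have wz := velocity_weak_deriv vz.
apply: (weak_deriv_unique heta (f := z)) => //.
by rewrite /weak_deriv; apply: (@getPex _ (is_weak_deriv z)); exists h.
Qed.

End WeakDerivatives.

(** * The Sobolev seminorm as a gap energy *)

Section SobolevSeminorm.
Context {R : realType} {n : nat}.
Notation mu := (@lebesgue_measure R).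
Implicit Types z h f g : R -> 'rV[R]_n.

Lemma circle_dist_near (x w : R) : `|w| <= 2^-1 -> circle_dist x (w + x) = `|w|.
Proof.
rewrite /circle_dist (_ : x - (w + x) = - w); last by ring.
have [w0|w0] := leP w 0.
  rewrite ler0_norm// => w2; rewrite fract_id; last by apply/andP; split; lra.
  by apply/min_idPl; lra.
rewrite gtr0_norm// => w2; rewrite -fract1 fract_id; last by apply/andP; split; lra.
by rewrite (_ : 1 - (- w + 1) = w); [apply/min_idPr; lra|ring].
Qed.

(** Centring the period in [y] at [x] makes the circle distance equal to [|w|]; Tonelli then
    integrates over [x] first. *)
Lemma circle_energyE h : measurable_rV h -> periodic h 1 ->
  (\int[mu]_(x in `[0%R, 1%R]) \int[mu]_(y in `[0%R, 1%R])
     (enorm (h x - h y) ^+ 2 / circle_dist x y ^+ 2)%:E)%E = gap_energy h 2^-1.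
Proof.
move=> mh ph.
pose K (p : R * R) := ((sqn (h (p.1 + p.2) - h p.1))%:E * ((p.2 ^+ 2)^-1)%:E)%E.
have mK : measurable_fun setT K.
  apply: emeasurable_funM; first by apply: measurable_gap => //; exact: measurable_funD.
  by apply/measurable_EFinP/measurable_invr/measurable_funX.
have K0 p : (0 <= K p)%E.
  by rewrite mule_ge0// lee_fin ?sqn_ge0// invr_ge0 sqr_ge0.
transitivity (\int[mu]_(x in `[0%R, 1%R]) \int[mu]_(w in `[(- 2^-1)%R, 2^-1%R]) K (x, w))%E.
  apply: eq_integral => x _.
  pose f y := (enorm (h x - h y) ^+ 2 / circle_dist x y ^+ 2)%:E.
  have mfr : measurable_fun setT (fun y : R => fract (x - y)).
    by apply: measurable_fract; exact: measurable_funB.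
  have mf : measurable_fun setT f.
    apply/measurable_EFinP; apply: measurable_funM.
      under eq_fun do rewrite enorm_sqr.
      by apply: measurable_sqnB.
    apply: measurable_invr; apply: measurable_funX.
    by apply: (measurable_minr mfr); exact: measurable_funB.
  have f0 y : (0 <= f y)%E by rewrite lee_fin divr_ge0 ?sqr_ge0.
  have pf y : f (y + 1) = f y.
    rewrite /f ph /circle_dist -[in fract (x - (y + 1))]fract1.
    by rewrite (_ : x - (y + 1) + 1 = x - y)//; ring.
  rewrite -/f -(@ge0_integral_period _ (x - 2^-1) f)//.
  have -> : x - 2^-1 + 1 = 2^-1 + x by field.
  rewrite (addrC x) -ge0_integral_shift//; apply: eq_integral => w.
  rewrite inE/= in_itv/= -ler_norml => w2.
  rewrite /f /K/= circle_dist_near// enorm_sqr sqnB (addrC x) -EFinM.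
  by rewrite (real_normK (num_real w)).
rewrite (@tonelli_in _ _ _ _ R mu mu _ _ K)//.
apply: eq_integral => w _; rewrite /K/= ge0_integralZr//.
- by apply: measurable_funTS; apply: measurable_gap => //; exact: measurable_funD.
- by move=> x _; rewrite lee_fin sqn_ge0.
- by rewrite lee_fin invr_ge0 sqr_ge0.
Qed.

Lemma seminorm_W_halfE h : measurable_rV h -> periodic h 1 ->
  seminorm_W_half h = (gap_energy h 2^-1 `^ 2^-1)%E.
Proof. by move=> mh ph; rewrite /seminorm_W_half circle_energyE. Qed.

Lemma eq_ae_sqr_norm2 h k : {ae mu, forall x, `[0, 1]%classic x -> h x = k x} ->
  sqr_norm2 h = sqr_norm2 k.
Proof.
by move=> hk; apply: eq_integral_ae; apply: ae_imply hk => x H /H ->.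
Qed.

Lemma eq_ae_seminorm_W_half h k : {ae mu, forall x, `[0, 1]%classic x -> h x = k x} ->
  seminorm_W_half h = seminorm_W_half k.
Proof.
move=> hk; pose I f := (\int[mu]_(x in `[0%R, 1%R]) \int[mu]_(y in `[0%R, 1%R])
    (enorm (f x - f y) ^+ 2 / circle_dist x y ^+ 2)%:E)%E.
have E f : seminorm_W_half f = (I f `^ 2^-1)%E by [].
rewrite !E; suff -> : I h = I k by [].
apply: eq_integral_ae; apply: ae_imply (hk) => x H /H ->.
by apply: eq_integral_ae; apply: ae_imply hk => y H' /H' ->.
Qed.

Lemma bounded_in_L2 h : bounded_measurable_rV h -> periodic h 1 -> in_L2 h.
Proof.
move=> bh ph; split => //.
  by move=> i; apply: measurable_funTS; case: (bh i).
have [mS [M hM]] := bounded_measurable_sqn bh.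
apply: (@le_lt_trans _ _ (\int[mu]_(x in `[0%R, 1%R]) M%:E)%E).
  apply: le_integral_itv => //.
  - by apply/measurable_EFinP; under eq_fun do rewrite enorm_sqr.
  - by move=> x; rewrite lee_fin sqr_ge0.
  - by move=> x _; rewrite lee_fin enorm_sqr (le_trans (ler_norm _)).
by rewrite integral_cst//= lebesgue_measure_itv/= lte_fin ltr01 -EFinB subr0 mule1 ltry.
Qed.

Lemma velocityB z h z' h' : velocity z h -> velocity z' h' ->
  velocity (fun x => z x - z' x) (fun x => h x - h' x).
Proof.
move=> [[pz [K zK]] ph bh dz] [[pz' [K' zK']] ph' bh' dz']; split.
- split => [x|]; first by rewrite pz pz'.
  exists (K + K') => s t.
  have -> : z s - z' s - (z t - z' t) = (z s - z t) - (z' s - z' t).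
    by apply/rowP => i; rewrite !mxE; ring.
  by rewrite mulrDl (le_trans (enormB _ _))// lerD.
- by move=> x; rewrite ph ph'.
- move=> i; have -> : (fun x => (h x - h' x) 0 i) = (fun x => h x 0 i - h' x 0 i).
    by apply/funext => x; rewrite !mxE.
  exact: bounded_measurableB.
- have := @filterI _ _ (ae_filter_ringOfSetsType mu) _ _ dz dz'.
  apply: ae_imply => x [/is_derive_rV d1 /is_derive_rV d2].
  apply/is_derive_rV => i; rewrite !mxE.
  have -> : (fun t => (z t - z' t) 0 i) = (fun t => z t 0 i) \- (fun t => z' t 0 i).
    by apply/funext => t; rewrite !mxE.
  exact: is_deriveB (d1 i) (d2 i).
Qed.

Lemma sqr_norm2_ge0 h : (0 <= sqr_norm2 h)%E.
Proof. by apply: integral_ge0 => x _; rewrite lee_fin sqr_ge0. Qed.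

Lemma shift_gap_le_norm h u : measurable_rV h -> periodic h 1 ->
  (shift_gap h u <= 4%:E * sqr_norm2 h)%E.
Proof.
move=> mh ph.
have mS : measurable_fun setT (fun x => (sqn (h x))%:E).
  have m0 : measurable_rV (fun=> 0 : 'rV[R]_n) by move=> i; exact: measurable_cst.
  have /measurable_EFinP := measurable_sqnB mh m0.
  by under eq_fun do rewrite subr0.
have S0 x : (0 <= (sqn (h x))%:E)%E by rewrite lee_fin sqn_ge0.
have SE : sqr_norm2 h = (\int[mu]_(x in `[0%R, 1%R]) (sqn (h x))%:E)%E.
  by apply: eq_integral => x _; rewrite enorm_sqr.
have SuE : (\int[mu]_(x in `[0%R, 1%R]) (sqn (h (x + u)%R))%:E)%E = sqr_norm2 h.
  rewrite SE (@ge0_integral_periodic_shift _ u (fun x => (sqn (h x))%:E))//.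
  by move=> x; rewrite ph.
have mSu : measurable_fun setT (fun x : R => (sqn (h (x + u)))%:E).
  by apply: (measurableT_comp mS); exact: measurable_funD.
have S20 x : (0 <= 2%:E * (sqn (h x))%:E)%E by rewrite mule_ge0.
apply: (@le_trans _ _ (\int[mu]_(x in `[0%R, 1%R])
    (2%:E * (sqn (h (x + u)%R))%:E + 2%:E * (sqn (h x))%:E))%E).
  apply: le_integral_itv.
  - by apply: measurable_gap => //; exact: measurable_funD.
  - by apply: emeasurable_funD; exact: measurable_funeM.
  - by move=> x; rewrite lee_fin sqn_ge0.
  - by move=> x _; rewrite -!EFinM -EFinD lee_fin sqnB_le.
rewrite ge0_integralD//; last 2 first.
- by apply: measurable_funTS; exact: measurable_funeM.
- by apply: measurable_funTS; exact: measurable_funeM.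
rewrite !integralZl_itv//.
rewrite SuE -SE -ge0_muleDl ?lee_fin// -EFinD le_eqVlt; apply/orP; left; apply/eqP.
by congr (_%:E * _)%E; ring.
Qed.

Lemma gap_energy_split h (d : R) : measurable_rV h -> periodic h 1 -> 0 < d ->
  (gap_energy h 2^-1 <= gap_energy h d + (4 / d ^+ 2)%:E * sqr_norm2 h)%E.
Proof.
move=> mh ph d0.
pose k u := (shift_gap h u * ((u ^+ 2)^-1)%:E)%E.
have k0 u : (0 <= k u)%E.
  by rewrite mule_ge0 ?shift_gap_ge0// lee_fin invr_ge0 sqr_ge0.
have mk : measurable_fun setT k.
  apply: emeasurable_funM; first exact: measurable_shift_gap.
  by apply/measurable_EFinP/measurable_invr/measurable_funX.
pose kd := k \_ `[(- d), d]%classic.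
have kd0 u : (0 <= kd u)%E by rewrite /kd /patch; case: ifP.
have mkd : measurable_fun setT kd.
  by apply/(measurable_restrictT _ _).1 => //; exact: measurable_funTS.
have C0 : (0 <= (4 / d ^+ 2)%:E * sqr_norm2 h)%E.
  by rewrite mule_ge0 ?sqr_norm2_ge0// lee_fin divr_ge0 ?sqr_ge0.
(* The far bound is added as a constant over the whole window, which costs nothing extra because the
   window has length [1]. *)
apply: (@le_trans _ _ (\int[mu]_(u in `[(- 2^-1)%R, 2^-1%R])
    (kd u + (4 / d ^+ 2)%:E * sqr_norm2 h))%E).
  apply: le_integral_itv => //; first exact: emeasurable_funD.
  move=> u _; rewrite /kd /patch; case: ifPn => [_|/negP ud].
    by rewrite leeDl.
  rewrite add0e; have {}ud : d < `|u|.
    by rewrite ltNge; apply/negP => H; apply: ud; rewrite inE/= in_itv/= -ler_norml.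
  apply: (@le_trans _ _ (4%:E * sqr_norm2 h * ((u ^+ 2)^-1)%:E)%E).
    apply: lee_wpmul2r; first by rewrite lee_fin invr_ge0 sqr_ge0.
    exact: shift_gap_le_norm.
  rewrite muleAC -EFinM; apply: lee_wpmul2r; first exact: sqr_norm2_ge0.
  have u0 : 0 < u ^+ 2 by rewrite -(real_normK (num_real u)) exprn_gt0// (lt_trans d0).
  rewrite lee_fin ler_wpM2l// lef_pV2 ?posrE// ?exprn_gt0//.
  by rewrite -(real_normK (num_real u)) lerXn2r// ?nnegrE ltW.
rewrite ge0_integralD//; [|exact: measurable_funTS].
apply: leeD.
  rewrite /gap_energy [leRHS]integral_mkcond -/kd.
  by apply: ge0_subset_integral.
rewrite integral_cst//= lebesgue_measure_itv/= lte_fin.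
rewrite (_ : - 2^-1 < 2^-1 = true); last by rewrite gtrN// invr_gt0.
by rewrite -EFinB (_ : 2^-1 - - 2^-1 = 1) ?mule1//; field.
Qed.

End SobolevSeminorm.

(** * Convergence in the Sobolev norm *)

Section SobolevLimits.
Context {R : realType} {n : nat}.
Notation mu := (@lebesgue_measure R).
Context (eta : R -> R).
Context (heta : is_mollifier eta).
Implicit Types z h f g : R -> 'rV[R]_n.

Lemma in_W32_velocity z h : velocity z h -> (gap_energy h 2^-1 < +oo)%E -> in_W32 z.
Proof.
move=> vz hfin; have [[pz _] ph bh _] := vz.
have mh := bounded_measurable_rV_measurable bh.
split.
  split; first exact: bounded_in_L2 (velocity_bounded vz) pz.
  by exists h; [exact: velocity_weak_deriv|exact: bounded_in_L2].
rewrite (eq_ae_seminorm_W_half (weak_deriv_velocity heta vz)) seminorm_W_halfE//.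
exact: poweR_lty.
Qed.

Lemma norm_W32E z h : velocity z h ->
  norm_W32 z = ((sqr_norm2 z + sqr_norm2 h) `^ 2^-1 + gap_energy h 2^-1 `^ 2^-1)%E.
Proof.
move=> vz; have [_ ph bh _] := vz; have wz := weak_deriv_velocity heta vz.
rewrite /norm_W32 /norm_W12 (eq_ae_seminorm_W_half wz) (eq_ae_sqr_norm2 wz).
by rewrite seminorm_W_halfE//; exact: bounded_measurable_rV_measurable.
Qed.

Lemma poweR_half_le (x : \bar R) (t : R) : 0 <= t -> (0 <= x <= (t ^+ 2)%:E)%E ->
  (x `^ 2^-1 <= t%:E)%E.
Proof.
move=> t0 /andP[x0 xt]; have -> : t%:E = ((t ^+ 2)%:E `^ 2^-1)%E.
  by rewrite poweR12_sqrt ?lee_fin ?sqr_ge0//= sqrtr_sqr ger0_norm.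
apply: gt0_ler_poweR => //; rewrite in_itv/= ?x0 ?leey//.
by rewrite lee_fin sqr_ge0.
Qed.

Lemma cvg_ereal_right0 (f : R -> \bar R) (l : R) :
  (forall t, 0 < t -> \forall e \near 0^'+, ((l - t)%:E <= f e <= (l + t)%:E)%E) ->
  f e @[e --> 0^'+] --> l%:E.
Proof.
move=> H; apply/fine_cvgP; split.
  near=> e; have : ((l - 1)%:E <= f e <= (l + 1)%:E)%E by near: e; exact: H.
  by move=> /andP[l1 l2]; rewrite fin_numElt (lt_le_trans (ltNyr _) l1) (le_lt_trans l2 (ltry _)).
apply/cvgrPdist_le => t t0; near=> e.
have : ((l - t)%:E <= f e <= (l + t)%:E)%E by near: e; exact: H.
rewrite /=; case: (f e) => [r| |]/=; rewrite ?lee_fin ?leey ?leye_eq ?leNye ?leeNy_eq ?andbF//.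
by move=> /andP[r1 r2]; rewrite ler_norml; apply/andP; split; lra.
Unshelve. all: by end_near. Qed.

Lemma mollify_norm_cvg z h : velocity z h -> (forall t, enorm (h t) <= 1) ->
  (gap_energy h 2^-1 < +oo)%E ->
  norm_W32 (fun x => mollify eta e z x - z x) @[e --> 0^'+] --> 0%E.
Proof.
move=> vz h1 hfin; have [_ ph bh _] := vz.
have mh := bounded_measurable_rV_measurable bh.
have [M M0 HM] := mollify_L2_le (n := n) heta.
have Pfin : gap_energy h 2^-1 \is a fin_num by rewrite ge0_fin_numE// gap_energy_ge0.
pose P := fine (gap_energy h 2^-1).
have PE : gap_energy h 2^-1 = P%:E by rewrite fineK.
have P0 : 0 <= P by rewrite fine_ge0// gap_energy_ge0.
apply: cvg_ereal_right0 => t t0.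
(* The norm is a sum of two square roots, each to be at most [t / 2]. For the first, [e < 1/2] and
   [e < s / 8] make [e ^+ 2 <= s / 2], and [c3] makes the derivative term at most [s / 2]. For the
   second, [4 * (s / 8)] bounds the near part and [c4] the far part. The [1] in [M * P + 1] keeps
   the denominators positive. *)
pose s := (t / 2) ^+ 2.
have s0 : 0 < s by rewrite exprn_gt0// divr_gt0.
have s8 : 0 < s / 8 by rewrite divr_gt0.
have h2 : 0 < 2^-1 :> R by rewrite invr_gt0.
have [d [d0 d2 Pd]] := gap_energy_small mh h2 hfin s8.
have MP : 0 < M * P + 1 by rewrite ltr_wpDl// mulr_ge0// ltW.
have c3 : 0 < s / (2 * (M * P + 1)) by rewrite divr_gt0// mulr_gt0.
have c4 : 0 < s * d ^+ 2 / (8 * (M * P + 1)).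
  by rewrite divr_gt0 ?mulr_gt0 ?exprn_gt0.
near=> e.
have e0 : 0 < e by near: e; exact: nbhs_right_gt.
have e1 : e < 2^-1 by near: e; exact: nbhs_right_lt.
have e2 : e < s / 8 by near: e; exact: nbhs_right_lt.
have e3 : e < s / (2 * (M * P + 1)) by near: e; exact: nbhs_right_lt.
have e4 : e < s * d ^+ 2 / (8 * (M * P + 1)) by near: e; exact: nbhs_right_lt.
have vg := velocityB (velocity_mollify heta e0 vz) vz.
have [_ pg bg _] := vg; have mg := bounded_measurable_rV_measurable bg.
have MeP : M * e * P <= e * (M * P + 1) by rewrite mulrDr mulr1; clear -heta e0; lra.
have S1 : (sqr_norm2 (fun x => mollify eta e h x - h x)%R <= (e * (M * P + 1))%:E)%E.
  apply: (le_trans (HM e h e0 bh ph)).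
  apply: (@le_trans _ _ ((M * e)%:E * P%:E)%E); last by rewrite -EFinM lee_fin.
  apply: lee_wpmul2l; first by rewrite lee_fin mulr_ge0// ltW.
  by rewrite -PE; apply: gap_energy_le => //; exact: ltW.
have S0 : (sqr_norm2 (fun x => mollify eta e z x - z x)%R <= (e ^+ 2)%:E)%E.
  apply: (@le_trans _ _ (\int[mu]_(x in `[0%R, 1%R]) (e ^+ 2)%:E)%E).
    apply: le_integral_itv => //.
    - apply/measurable_EFinP; under eq_fun do rewrite enorm_sqr.
      by case: (bounded_measurable_sqn (velocity_bounded vg)).
    - by move=> x; rewrite lee_fin sqr_ge0.
    - move=> x _; rewrite lee_fin lerXn2r ?nnegrE ?enorm_ge0 ?(ltW e0)//.
      exact: (mollify_sub_le heta x e0 vz h1).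
  by rewrite integral_cst//= lebesgue_measure_itv/= lte_fin ltr01 -EFinB subr0 mule1.
rewrite (norm_W32E vg) !add0r; apply/andP; split.
  apply: (@le_trans _ _ 0%E); first by rewrite lee_fin; clear -heta t0; lra.
  by rewrite adde_ge0// poweR_ge0.
have t2 : 0 <= t / 2 by rewrite divr_ge0// ltW.
have -> : t = t / 2 + t / 2 by field.
rewrite EFinD; apply: leeD; apply: poweR_half_le => //; apply/andP; split.
- by rewrite adde_ge0// sqr_norm2_ge0.
- apply: (le_trans (leeD S0 S1)); rewrite -EFinD lee_fin -/s.
  move: e3; rewrite ltr_pdivlMr ?mulr_gt0// => e3.
  by nra.
- exact: gap_energy_ge0.
- apply: (le_trans (gap_energy_split mg pg d0)).
  have G : (gap_energy (fun x => mollify eta e h x - h x)%R d <= (s / 2)%:E)%E.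
    apply: (@le_trans _ _ (4%:E * gap_energy h d)%E).
      by apply: gap_energy_mono => // u; exact: shift_gap_mollify_sub_le.
    have -> : s / 2 = 4 * (s / 8) by field.
    by rewrite [leRHS]EFinM; apply: lee_wpmul2l => //; exact: ltW.
  apply: (@le_trans _ _ ((s / 2)%:E + (s / 2)%:E)%E).
    apply: leeD => //.
    apply: (@le_trans _ _ ((4 / d ^+ 2)%:E * (e * (M * P + 1))%:E)%E).
      by apply: lee_wpmul2l => //; rewrite lee_fin divr_ge0// sqr_ge0.
    rewrite -EFinM lee_fin mulrAC ler_pdivrMr ?exprn_gt0//.
    by move: e4; rewrite ltr_pdivlMr ?mulr_gt0//; clear -heta; lra.
  by rewrite -EFinD lee_fin -/s; clear -heta; lra.
Unshelve. all: by end_near. Qed.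

Lemma mollify_cvg_W32 z h : velocity z h -> (forall t, enorm (h t) <= 1) ->
  (gap_energy h 2^-1 < +oo)%E -> cvg_W32 (fun e => mollify eta e z) z.
Proof.
move=> vz h1 hfin; split; first exact: in_W32_velocity hfin.
  near=> e; have e0 : 0 < e by near: e; exact: nbhs_right_gt.
  apply: (in_W32_velocity (velocity_mollify heta e0 vz)).
  have [_ ph bh _] := vz; have mh := bounded_measurable_rV_measurable bh.
  have mm := bounded_measurable_rV_measurable (bounded_measurable_mollify heta e0 bh).
  apply: (le_lt_trans _ hfin); rewrite -[leRHS]mul1e; apply: gap_energy_mono => // u.
  by rewrite mul1e; exact: shift_gap_mollify_le.
exact: (mollify_norm_cvg vz h1 hfin).
Unshelve. all: by end_near. Qed.

End SobolevLimits.

(** * A unit periodic version of the derivative *)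

Section UnitVelocity.
Context {R : realType} {n : nat}.
Notation mu := (@lebesgue_measure R).

Lemma ae_translate (P : R -> Prop) (c : R) :
  {ae mu, forall x, P x} -> {ae mu, forall x, P (x + c)}.
Proof.
move=> /(ae_reflect c)/(ae_reflect 0); apply: ae_imply => x.
by rewrite sub0r opprK addrC.
Qed.

(* The derivative off a null set, filled in there with a fixed unit vector, and
   pulled back from [0, 1[. *)
Lemma unit_velocity (z : R -> 'rV[R]_n) : closed_lipschitz z ->
  arc_length_parametrized z ->
  exists2 h, velocity z h & forall t, enorm (h t) = 1.
Proof.
move=> lz harc; have [pz [K zK]] := lz.
have czi i : continuous (fun x => z x 0 i).
  apply: (@lipschitz_continuous _ _ K) => s t; apply: le_trans (zK s t).
  by have := coord_le_enorm (z s - z t) i; rewrite !mxE.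
have [N [mN N0 NP]] := harc.
have dN x : ~ N x -> derivable z x 1 /\ enorm (derive1 z x) = 1.
  by move=> xN; apply: contrapT => H; apply: xN; exact: NP.
(* The derivative at such a point provides a unit vector, so no case distinction on [n] is required
   to have one. *)
have [x0 x0N] : exists x, ~ N x.
  apply/not_existsP => H; have NT : [set` `[0%R, 1%R]] `<=` N.
    by move=> x _; apply: contrapT; exact: H.
  have : (mu [set` `[0%R, 1%R]] <= mu N)%E by apply: le_measure; rewrite ?inE.
  rewrite N0 lebesgue_measure_itv/= lte_fin ltr01 -EFinB subr0 lee_fin.
  by rewrite leNgt ltr01.
pose v0 := derive1 z x0.
pose g0 t := if t \in N then v0 else derive1 z t.
pose h t := g0 (fract t).
have h1 t : enorm (h t) = 1.
  rewrite /h /g0; case: ifPn => [_|/negP tN]; first exact: (dN x0 x0N).2.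
  by apply: (dN _ _).2 => H; apply: tN; rewrite inE.
have mNb : measurable_fun setT (fun t : R => t \in N).
  apply: (measurable_fun_bool true) => //; rewrite setTI.
  by rewrite (_ : _ @^-1` _ = N)//; apply/seteqP; split => x; [exact: set_mem|exact: mem_set].
have mg0 i : measurable_fun setT (fun t => g0 t 0 i).
  (* Difference quotients along [1 / (m + 1)], constant on [N]: measurable functions converging to
     the coordinate of [g0] everywhere. *)
  pose q m t : R := if t \in N then v0 0 i else
    ((m.+1%:R)^-1)^-1 * (z ((m.+1%:R)^-1 *: 1 + t) 0 i - z t 0 i).
  apply: (@measurable_fun_cvg _ _ R setT q).
    move=> m; apply: measurable_fun_ifT => //.
    apply: measurable_funM => //; apply: measurable_funB.
      apply: (measurableT_comp (continuous_measurable_fun (czi i))).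
      exact: measurable_funD.
    exact: continuous_measurable_fun.
  move=> t _; rewrite /q /g0; case: ifPn => [_|/negP tN]; first exact: cvg_cst.
  have /dN[dt _] : ~ N t by move=> H; apply: tN; rewrite inE.
  have [/cvg_ex[/= l hl] e] : is_derive t (1 : R) (fun s => z s 0 i) (derive1 z t 0 i).
    by have /is_derive_rV : derivable z t 1 /\ derive1 z t = derive1 z t by [].
  have le : l = derive1 z t 0 i by rewrite -e; apply/esym/cvg_lim.
  move/cvgr_dnbhsP : hl; rewrite -le; apply; split => [m|].
    by rewrite invr_eq0 pnatr_eq0.
  exact: cvg_harmonic.
have ph : periodic h 1 by move=> t; rewrite /h fract1.
exists h => //; split => //.
  move=> i; split.
    have mfr : measurable_fun setT (@fract R).
      exact: (measurable_fract (@measurable_id _ R setT)).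
    by have := measurableT_comp (mg0 i) mfr; exact.
  by exists 1 => x; rewrite -(h1 x); exact: coord_le_enorm.
have HN : {ae mu, forall x, ~ N x}.
  by exists N; split => // x /= /contrapT.
(* As [h] is pulled back by [fract], its exceptional set consists of the integer translates of [N],
   in both directions. *)
have H1 := ae_foralln (fun m : nat => ae_translate (m%:R : R) HN).
have H2 := ae_foralln (fun m : nat => ae_translate (- m%:R : R) HN).
have := @filterI _ _ (ae_filter_ringOfSetsType mu) _ _ H1 H2.
apply: ae_imply => x [xN1 xN2]; apply/is_derive_rV => i.
have [k xk] := fractE x.
have xN : ~ N (fract x).
  rewrite xk; case: k {xk} => m; first exact: xN1.
  by rewrite NegzE intrN; exact: xN2.
have -> : h x = derive1 z (fract x).
  by rewrite /h /g0 memNset.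
have -> : (fun t => z t 0 i) = (fun t => z (t + k%:~R) 0 i).
  by apply/funext => t; rewrite period_int.
apply: (@is_derive_comp_addr R (fun t => z t 0 i) (k%:~R) x); rewrite -xk.
have [dx _] := dN _ xN.
by have /is_derive_rV : derivable z (fract x) 1 /\ derive1 z (fract x) = derive1 z (fract x) by [].
Qed.

End UnitVelocity.

(** * Convergence of the energies *)

Section EnergyConvergence.
Context {R : realType} {n : nat}.
Notation mu := (@lebesgue_measure R).
Context (eta : R -> R).
Context (heta : is_mollifier eta).
Implicit Types z h : R -> 'rV[R]_n.

Lemma gap_energy_lty z h : velocity z h -> (forall t, enorm (h t) = 1) ->
  (mobius_energy z < +oo)%E -> (gap_energy h 2^-1 < +oo)%E.
Proof.
move=> vz h1 zfin; have [_ ph bh _] := vz; apply: gap_energy_half_fin => //.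
apply: (le_lt_trans (gap_energy_le_mobius vz h1 zfin)).
by rewrite lte_mul_pinfty.
Qed.

(** Pointwise [f <= g + t + C k], with [k] cut off to [|w| <= d]. Both ranges have length [1], so
    the additive error [t] passes through the two integrations unchanged. *)
Lemma integral2_compare (f g k : R * R -> \bar R) (d t C : R) :
  measurable_fun setT f -> measurable_fun setT g -> measurable_fun setT k ->
  (forall p, 0 <= f p)%E -> (forall p, 0 <= g p)%E -> (forall p, 0 <= k p)%E ->
  0 <= t -> 0 <= C ->
  (forall x w, `|w| <= 2^-1 -> d < `|w| -> (f (x, w) <= g (x, w) + t%:E)%E) ->
  (forall x w, `|w| <= 2^-1 -> `|w| <= d -> (f (x, w) <= C%:E * k (x, w))%E) ->
  (\int[mu]_(x in `[0%R, 1%R]) \int[mu]_(w in `[(- 2^-1)%R, 2^-1%R]) f (x, w) <=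
   \int[mu]_(x in `[0%R, 1%R]) \int[mu]_(w in `[(- 2^-1)%R, 2^-1%R]) g (x, w) + t%:E +
   C%:E * \int[mu]_(x in `[0%R, 1%R]) \int[mu]_(w in `[(- d)%R, d]) k (x, w))%E.
Proof.
move=> mf mg mk f0 g0 k0 t0 C0 far near.
have slice (u : R * R -> \bar R) x : measurable_fun setT u ->
    measurable_fun setT (fun w => u (x, w)).
  by move=> mu'; apply: measurableT_comp mu' _; exact: measurable_pair1.
have I (u : R * R -> \bar R) (a b : R) : measurable_fun setT u -> (forall p, 0 <= u p)%E ->
    measurable_fun setT (fun x => \int[mu]_(w in `[a, b]) u (x, w))%E.
  by move=> mu' u0; exact: (@measurable_integral_snd _ _ _ _ R mu `[a, b]%classic u).
have I0 (u : R * R -> \bar R) (a b : R) : (forall p, 0 <= u p)%E ->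
    forall x, (0 <= \int[mu]_(w in `[a, b]) u (x, w))%E.
  by move=> u0 x; apply: integral_ge0 => w _; exact: u0.
pose F x := (\int[mu]_(w in `[(- 2^-1)%R, 2^-1%R]) f (x, w))%E.
pose G x := (\int[mu]_(w in `[(- 2^-1)%R, 2^-1%R]) g (x, w))%E.
pose K x := (\int[mu]_(w in `[(- d)%R, d]) k (x, w))%E.
have mF : measurable_fun setT F by exact: I.
have mG : measurable_fun setT G by exact: I.
have mK : measurable_fun setT K by exact: I.
have F0 x : (0 <= F x)%E by exact: I0.
have G0 x : (0 <= G x)%E by exact: I0.
have K0 x : (0 <= K x)%E by exact: I0.
have FGK x : (F x <= G x + t%:E + C%:E * K x)%E.
  pose kd := (fun w => k (x, w)) \_ `[(- d), d]%classic.
  have kd0 w : (0 <= kd w)%E by rewrite /kd /patch; case: ifP.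
  have mkd : measurable_fun setT kd.
    by apply/(measurable_restrictT _ _).1 => //; apply: measurable_funTS; exact: slice.
  have mgx := slice g x mg.
  apply: (@le_trans _ _ (\int[mu]_(w in `[(- 2^-1)%R, 2^-1%R])
      (g (x, w) + t%:E + C%:E * kd w))%E).
    apply: le_integral_itv => //.
    - exact: slice.
    - by apply: emeasurable_funD; [exact: emeasurable_funD|exact: measurable_funeM].
    - move=> w; rewrite -ler_norml => w2; rewrite /kd /patch; case: ifPn => [|/negP wd].
        rewrite inE/= in_itv/= -ler_norml => wd.
        apply: (le_trans (near x w w2 wd)); rewrite leeDr//.
        by rewrite adde_ge0.
      rewrite mule0 adde0; apply: far => //.
      by rewrite ltNge; apply/negP => H; apply: wd; rewrite inE/= in_itv/= -ler_norml.
  rewrite ge0_integralD//; last 4 first.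
  - by move=> w _; rewrite adde_ge0.
  - by apply: measurable_funTS; exact: emeasurable_funD.
  - by move=> w _; rewrite mule_ge0.
  - by apply: measurable_funTS; exact: measurable_funeM.
  rewrite ge0_integralD//; last exact: measurable_funTS.
  rewrite integralZl_itv// integral_cst//= lebesgue_measure_itv/= lte_fin.
  rewrite (_ : - 2^-1 < 2^-1 = true); last by rewrite gtrN// invr_gt0.
  rewrite -EFinB (_ : 2^-1 - - 2^-1 = 1) ?mule1//; last by field.
  apply: leeD => //; apply: lee_wpmul2l => //.
  rewrite /K [leRHS]integral_mkcond -/kd.
  by apply: ge0_subset_integral.
apply: (@le_trans _ _ (\int[mu]_(x in `[0%R, 1%R]) (G x + t%:E + C%:E * K x))%E).
  apply: le_integral_itv => //.
  - by apply: emeasurable_funD; [exact: emeasurable_funD|exact: measurable_funeM].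
  - by move=> x _; exact: FGK.
rewrite ge0_integralD//; last 4 first.
- by move=> w _; rewrite adde_ge0.
- by apply: measurable_funTS; exact: emeasurable_funD.
- by move=> w _; rewrite mule_ge0.
- by apply: measurable_funTS; exact: measurable_funeM.
rewrite ge0_integralD//; last exact: measurable_funTS.
by rewrite integralZl_itv// integral_cst//= lebesgue_measure_itv/= lte_fin ltr01
  -EFinB subr0 mule1.
Qed.

Lemma chord_ge_abs z h c2 x w : velocity z h -> w != 0 -> `|w| <= 1 ->
  (forall t, c2 <= sqn (h t)) ->
  ((w ^+ 2 * c2)%:E <= (sqn (z (x + w) - z x))%:E + (w ^+ 2)%:E * gap_energy h `|w|)%E.
Proof.
move=> vz w0 w1 hc; rewrite -(real_normK (num_real w)).
have aw0 : 0 < `|w| <= 1 by rewrite normr_gt0 w0.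
have [w_ge0|w_lt0] := leP 0 w.
  by rewrite -[in z (x + w)](ger0_norm w_ge0); exact: chord_ge hc.
have := chord_ge (x + w) vz aw0 hc.
by rewrite [in z (x + w + _)]ltr0_norm// addrK sqnB.
Qed.

(** The factor is the square root of [3/4 - 1/2]. The bound [3 / 4] on the squared speed, instead of
    [1], leaves room for mollified curves. *)
Lemma chord_half_le z h d x w : velocity z h -> `|w| <= 1 -> `|w| <= d ->
  (forall t, 3 / 4 <= sqn (h t)) -> (gap_energy h d <= (2^-1)%:E)%E ->
  2^-1 * `|w| <= enorm (z (x + w) - z x).
Proof.
move=> vz w1 wd h34 gd; have [_ _ bh _] := vz.
have [->|w0] := eqVneq w 0; first by rewrite normr0 mulr0 enorm_ge0.
have mh := bounded_measurable_rV_measurable bh.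
have w20 : 0 < w ^+ 2 by rewrite exprn_even_gt0.
have : ((w ^+ 2 * (3 / 4))%:E <=
    (sqn (z (x + w) - z x))%:E + (w ^+ 2)%:E * (2^-1)%:E)%E.
  apply: (le_trans (chord_ge_abs x vz w0 w1 h34)); apply: leeD => //.
  apply: lee_wpmul2l; first by rewrite lee_fin ltW.
  by apply: le_trans gd; exact: gap_energy_le.
rewrite -EFinM -EFinD lee_fin => H.
rewrite -(@ler_pXn2r _ 2)// ?nnegrE ?enorm_ge0//.
rewrite enorm_sqr exprMn (real_normK (num_real w)); lra.
Qed.

Lemma chord_lower_bound_abs z d rho : periodic z 1 ->
  (forall x r, d <= r <= 1 - d -> rho <= enorm (z (x + r) - z x)) ->
  d <= 2^-1 ->
  forall x w, d <= `|w| <= 2^-1 -> rho <= enorm (z (x + w) - z x).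
Proof.
move=> pz H d2 x w /andP[dw w2]; have [w0|w0] := leP 0 w.
  by apply: H; move: dw w2; rewrite ger0_norm// => dw w2; apply/andP; split; lra.
rewrite -pz -addrA; apply: H.
by move: dw w2; rewrite ltr0_norm// => dw w2; apply/andP; split; lra.
Qed.

Lemma speed_lower_bound h s : bounded_measurable_rV h -> periodic h 1 ->
  (forall t, enorm (h t) = 1) -> (gap_energy h 2^-1 < +oo)%E -> 0 < s ->
  exists2 e0, 0 < e0 <= 2^-1 & forall e, 0 < e < e0 -> forall t,
    1 - s <= enorm (mollify eta e h t) <= 1.
Proof.
move=> bh ph h1 hfin s0; have mh := bounded_measurable_rV_measurable bh.
have hs t : sqn (h t) = 1 by rewrite -enorm_sqr h1 expr1n.
have [M M0 HM] := mollify_speed_ge (n := n) heta.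
have h2 : 0 < 2^-1 :> R by rewrite invr_gt0.
have [d [d0 d2 gd]] := gap_energy_small mh h2 hfin (divr_gt0 s0 M0).
(* The estimate of the speed involves the gap energy at scale [2 e]. *)
exists (d / 2); first by rewrite divr_gt0//=; lra.
move=> e /andP[e0 ed] t.
have sle : sqn (mollify eta e h t) <= 1 by apply: sqn_mollify_bound => // u; rewrite hs.
have nle : enorm (mollify eta e h t) <= 1.
  by rewrite -(@ler_pXn2r _ 2)// ?nnegrE ?enorm_ge0// enorm_sqr expr1n.
rewrite nle andbT.
have : ((1 - sqn (mollify eta e h t))%:E <= (M * (s / M))%:E)%E.
  apply: le_trans (HM e h e0 _ bh ph hs t) _; first by lra.
  rewrite EFinM; apply: lee_wpmul2l; first by rewrite lee_fin ltW.
  by apply: le_trans (ltW gd); apply: gap_energy_le => //; lra.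
rewrite mulrC divfK ?gt_eqF// lee_fin -enorm_sqr => H.
(* For a speed [v] in [[0, 1]], [1 - v <= 1 - v^2 <= s]. *)
have := enorm_ge0 (mollify eta e h t); nra.
Qed.

(** The difference is [(b - a) (b + a) / (a^2 b^2)], with [|b - a| <= 2 e], [a + b <= 1],
    [a^-2 <= rho^-2] and [b^-2 <= 4 rho^-2]. *)
Lemma inv_sqr_dist (a b rho e : R) : 0 < rho -> rho <= a <= 2^-1 ->
  rho / 2 <= b <= 2^-1 -> `|a - b| <= 2 * e ->
  `|(a ^+ 2)^-1 - (b ^+ 2)^-1| <= 8 * e / rho ^+ 4.
Proof.
move=> r0 /andP[ra a2] /andP[rb b2] ab.
have a0 : 0 < a by exact: lt_le_trans ra.
have b0 : 0 < b by rewrite (lt_le_trans _ rb)// divr_gt0.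
have -> : (a ^+ 2)^-1 - (b ^+ 2)^-1 = (b - a) * (b + a) * ((a ^+ 2)^-1 * (b ^+ 2)^-1).
  by field; rewrite !gt_eqF.
rewrite !normrM (distrC b) -mulrA.
have -> : 8 * e / rho ^+ 4 = 2 * e * (1 * ((rho ^+ 2)^-1 * ((rho / 2) ^+ 2)^-1)).
  by field; rewrite gt_eqF.
apply: ler_pM => //; apply: ler_pM => //.
  by rewrite ger0_norm; lra.
have ia : (a ^+ 2)^-1 <= (rho ^+ 2)^-1.
  by rewrite lef_pV2 ?posrE ?exprn_gt0// lerXn2r ?nnegrE// ltW.
have r2 : 0 < rho / 2 by rewrite divr_gt0.
have ib : (b ^+ 2)^-1 <= ((rho / 2) ^+ 2)^-1.
  by rewrite lef_pV2 ?posrE ?exprn_gt0// lerXn2r ?nnegrE// ltW.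
by rewrite !ger0_norm ?invr_ge0 ?sqr_ge0//; apply: ler_pM; rewrite ?invr_ge0 ?sqr_ge0.
Qed.

Lemma inv_sqr_le (a b : R) : 0 < a -> a <= b -> (b ^+ 2)^-1 <= (a ^+ 2)^-1.
Proof.
move=> a0 ab; have b0 : 0 < b by exact: lt_le_trans ab.
by rewrite lef_pV2 ?posrE ?exprn_gt0// lerXn2r// nnegrE ltW.
Qed.

(** [A] and [X] stand for the inverse squared chords of the old and the new curve, [V] and [Y] for
    the inverse squared distances, [s] for the product of the new speeds. From above, [s <= 1] and
    [V <= Y] leave only [X - A]. From below, [s >= c] costs [(1 - c) X], and [c Y <= V] settles the
    distances. *)
Lemma excess_compare (A X Y V s c q r : R) : V <= A -> V <= Y -> Y <= X -> c * Y <= V ->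
  0 <= c -> X <= r -> c <= s <= 1 -> `|A - X| <= q -> 0 <= X ->
  `|Num.max 0 ((X - Y) * s) - Num.max 0 (A - V)| <= q + (1 - c) * r.
Proof.
move=> VA VY YX cY c0 Xr /andP[cs s1]; rewrite ler_norml => /andP[AX1 AX2] X0.
have c1 : 0 <= 1 - c by lra.
have XY0 : 0 <= X - Y by lra.
rewrite !max_r; [|lra|by rewrite mulr_ge0//; lra].
have cr : (1 - c) * X <= (1 - c) * r by rewrite ler_wpM2l.
have cX : 0 <= (1 - c) * X by rewrite mulr_ge0.
have s_le : (X - Y) * s <= X - Y by rewrite -[leRHS]mulr1 ler_wpM2l.
have s_ge : (X - Y) * c <= (X - Y) * s by rewrite ler_wpM2l.
by rewrite ler_norml; apply/andP; split; lra.
Qed.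

(** [excess_compare] with [c ^+ 2] for its [c]: speeds in [[c, 1]] put their product above [c ^+ 2]
    and the new distance between [c |w|] and [|w|]. Chords move by at most [2 e], so the new one is
    at least [rho / 2]. *)
Lemma density_compare z h z' h' c rho e x w : velocity z h -> velocity z' h' ->
  (forall t, enorm (h t) = 1) -> 0 < c -> (forall t, c <= enorm (h' t) <= 1) ->
  (forall y, enorm (z' y - z y) <= e) -> 0 < rho -> 2 * e <= rho / 2 ->
  `|w| <= 2^-1 -> rho <= enorm (z (x + w) - z x) ->
  `|energy_density z' h' x (x + w) - energy_density z h x (x + w)|
    <= 8 * e / rho ^+ 4 + (1 - c ^+ 2) * (4 / rho ^+ 2).
Proof.
move=> vz vz' h1 c0 hc ze r0 er w2 za.
have hc1 t : 1 <= enorm (h t) <= 1 by rewrite h1 lexx.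
have [/andP[rd1 rd2] ard _] := rdist_spec x vz ler01 hc1 w2.
have [/andP[rc1 rc2] brd _] := rdist_spec x vz' (ltW c0) hc w2.
have rdE : rdist h x (x + w) = `|w| by apply/le_anti; rewrite rd2 -[leLHS]mul1r rd1.
rewrite /energy_density rdE (sqnB (z x)) (sqnB (z' x)) -!enorm_sqr !h1 !mulr1.
rewrite rdE in ard; set a := enorm (z _ - _) in za ard *.
set b := enorm (z' _ - _) in brd *; set r := rdist _ _ _ in rc1 rc2 brd *.
have ab : `|a - b| <= 2 * e.
  apply: (le_trans (ler_dist_enorm _ _)).
  have -> : z (x + w) - z x - (z' (x + w) - z' x) =
      - (z' (x + w) - z (x + w)) + (z' x - z x).
    by apply/rowP => i; rewrite !mxE; ring.
  rewrite (le_trans (enormD _ _))// enormN.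
  by have := ze (x + w); have := ze x; lra.
have a0 : 0 < a by exact: lt_le_trans za.
have ab' := ab; move: ab'; rewrite ler_norml => /andP[_ ab'].
have rb : rho / 2 <= b by lra.
have b0 : 0 < b by rewrite (lt_le_trans _ rb)// divr_gt0.
have w0 : 0 < `|w| by exact: lt_le_trans ard.
have r_gt0 : 0 < r by exact: lt_le_trans brd.
have := @inv_sqr_dist a b rho e r0 _ _ ab.
have -> : rho <= a <= 2^-1 by rewrite za (le_trans ard).
have -> : rho / 2 <= b <= 2^-1 by rewrite rb (le_trans brd)// (le_trans rc2).
move=> /(_ isT isT).
have Xr : (b ^+ 2)^-1 <= 4 / rho ^+ 2.
  have -> : 4 / rho ^+ 2 = ((rho / 2) ^+ 2)^-1 by field; rewrite gt_eqF.
  by apply: inv_sqr_le => //; rewrite divr_gt0.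
have cY : c ^+ 2 * (r ^+ 2)^-1 <= (`|w| ^+ 2)^-1.
  rewrite -[leRHS]mul1r ler_pdivlMr ?exprn_gt0// mulrAC ler_pdivrMr ?exprn_gt0//.
  by rewrite mul1r -exprMn lerXn2r// nnegrE ?mulr_ge0// ltW.
have s12 : c ^+ 2 <= enorm (h' x) * enorm (h' (x + w)) <= 1.
  have /andP[u1 u2] := hc x; have /andP[v1 v2] := hc (x + w).
  rewrite expr2 ler_pM ?(ltW c0)//= -[leRHS]mulr1.
  by apply: ler_pM => //; exact: enorm_ge0.
move=> AX; apply: (excess_compare _ _ _ cY _ Xr s12 AX).
- exact: inv_sqr_le.
- exact: inv_sqr_le.
- exact: inv_sqr_le.
- by rewrite sqr_ge0.
- by rewrite invr_ge0 sqr_ge0.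
Qed.

(** A one-sided estimate, applied later with the two curves in either order. The near part of [z]
    alone is at most [16 * g <= t / 2], where [16] is the inverse fourth power of the chord constant
    [1/2]; the far part costs the other [t / 2]. *)
Lemma mobius_energy_le_add z h z' h' (d g t : R) : velocity z h -> velocity z' h' ->
  (forall u, 2^-1 <= enorm (h u) <= 1) -> (forall u, 2^-1 <= enorm (h' u) <= 1) ->
  (forall x w, w != 0 -> `|w| <= 2^-1 -> 0 < sqn (z (x + w) - z x)) ->
  (forall x w, w != 0 -> `|w| <= 2^-1 -> 0 < sqn (z' (x + w) - z' x)) ->
  (forall u, 3 / 4 <= sqn (h u)) -> g <= 2^-1 -> g <= t / 32 ->
  (gap_energy h d <= g%:E)%E ->
  (forall x w, `|w| <= 2^-1 -> d < `|w| ->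
    energy_density z h x (x + w) - energy_density z' h' x (x + w) <= t / 2) ->
  (mobius_energy z <= mobius_energy z' + t%:E)%E.
Proof.
move=> vz vz' h12 h12' inj inj' h34 g12 gt32 gd far.
have h2 : 0 < 2^-1 :> R by rewrite invr_gt0.
rewrite (mobius_energy_repr vz h2 h12 inj) (mobius_energy_repr vz' h2 h12' inj').
have [_ _ bh _] := vz; have mh := bounded_measurable_rV_measurable bh.
pose f (k y : R -> 'rV[R]_n) (p : R * R) := (energy_density k y p.1 (p.1 + p.2))%:E.
have mf (k y : R -> 'rV[R]_n) : velocity k y -> measurable_fun setT (f k y).
  move=> vk; apply/measurable_EFinP; apply: measurable_energy_density => //.
  exact: measurable_funD.
have f0 (k y : R -> 'rV[R]_n) p : (0 <= f k y p)%E.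
  by rewrite lee_fin energy_density_ge0.
have gd2 : (gap_energy h d <= (2^-1)%:E)%E by apply: le_trans gd _; rewrite lee_fin.
have near x w : `|w| <= 2^-1 -> `|w| <= d ->
    (f z h (x, w) <= 16%:E * near_kernel h x w)%E.
  move=> w2 wd; have w1 : `|w| <= 1 by rewrite (le_trans w2)// invf_le1// ler1n.
  have := density_le_near_kernel (x := x) vz h2 h12 w2 (chord_half_le x vz w1 wd h34 gd2).
  by have -> : ((2^-1 : R) ^+ 4)^-1 = 16 by field.
have g0 : 0 <= g by rewrite -lee_fin (le_trans _ gd)// gap_energy_ge0.
have t2 : 0 <= t / 2 by clear -g0 gt32; lra.
have g16 : 16 * g <= t / 2 by clear -gt32; lra.
have tE : t%:E = ((t / 2)%:E + (t / 2)%:E)%E by rewrite -EFinD; congr EFin; field.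
rewrite [in leRHS]tE addeA.
apply: le_trans (@integral2_compare (f z h) (f z' h') (fun p => near_kernel h p.1 p.2) d (t / 2) 16
  (mf _ _ vz) (mf _ _ vz') (near_kernel_measurable mh) (f0 _ _) (f0 _ _)
  (fun p => near_kernel_ge0 h p.1 p.2) t2 (ler0n _ _) _ near) _.
  move=> x w w2 dw; rewrite -EFinD lee_fin -lerBlDl.
  exact: far.
apply: leeD => //; apply: (@le_trans _ _ (16%:E * g%:E)%E).
  apply: lee_wpmul2l => //; apply: le_trans (near_kernel_integral_le d mh) _.
  exact: gd.
by rewrite -EFinM lee_fin.
Qed.

Lemma mobius_energy_mollify_cvg z h : velocity z h -> (forall t, enorm (h t) = 1) ->
  (mobius_energy z < +oo)%E ->
  mobius_energy (mollify eta e z) @[e --> 0^'+] --> mobius_energy z.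
Proof.
move=> vz h1 zfin; have [[pz _] ph bh _] := vz.
have mh := bounded_measurable_rV_measurable bh.
have inj0 := injective_chord vz h1 zfin.
have hc1 t : 1 <= enorm (h t) <= 1 by rewrite h1 lexx.
have hle t : enorm (h t) <= 1 by rewrite h1.
have hfin := gap_energy_lty vz h1 zfin.
have E0 := mobius_energy_repr vz ltr01 hc1 inj0.
have zge0 : (0 <= mobius_energy z)%E.
  rewrite E0; apply: integral_ge0 => x _; apply: integral_ge0 => w _.
  by rewrite lee_fin energy_density_ge0.
have zfn : mobius_energy z \is a fin_num by rewrite ge0_fin_numE.
rewrite -(fineK zfn); apply: cvg_ereal_right0 => t t0.
have h2 : 0 < 2^-1 :> R by rewrite invr_gt0.
(* [t / 32] serves [mobius_energy_le_add], and [2^-1] serves [chord_half_le]. *)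
pose g := Num.min (t / 32) 2^-1.
have g0 : 0 < g by rewrite lt_min divr_gt0//.
have gt32 : g <= t / 32 by rewrite ge_min lexx.
have g12 : g <= 2^-1 by rewrite ge_min lexx orbT.
have [d [d0 d2 gd]] := gap_energy_small mh h2 hfin g0.
have d12 : 0 < d <= 2^-1 by rewrite d0.
have [rho r0 Hrho] := chord_lower_bound vz h1 zfin d12.
(* With [s <= 8^-1] the squared speeds are at least [49/64 >= 3/4]; the other bound makes the speed
   error [2 s * (4 / rho^2)] at most [t / 4]. *)
pose s := Num.min 8^-1 (t * rho ^+ 2 / 32).
have s0 : 0 < s.
  rewrite lt_min invr_gt0 ltr0n/= divr_gt0//; apply: mulr_gt0 => //; exact: exprn_gt0.
have s8 : s <= 8^-1 by rewrite ge_min lexx.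
have sr : s <= t * rho ^+ 2 / 32 by rewrite ge_min lexx orbT.
have [e0 /andP[e0_gt0 e02] He0] := speed_lower_bound bh ph h1 hfin s0.
have r4 : 0 < rho ^+ 4 by rewrite exprn_gt0.
(* The first threshold makes [8 e / rho^4] at most [t / 4]; the second keeps the change [2 e] of a
   chord below [rho / 2]. *)
have c1 : 0 < t * rho ^+ 4 / 32 by rewrite divr_gt0// mulr_gt0.
have c2 : 0 < rho / 4 by rewrite divr_gt0.
near=> e.
have e_gt0 : 0 < e by near: e; exact: nbhs_right_gt.
have ee0 : e < e0 by near: e; exact: nbhs_right_lt.
have e1 : e < t * rho ^+ 4 / 32 by near: e; exact: nbhs_right_lt.
have e2 : e < rho / 4 by near: e; exact: nbhs_right_lt.
have er : 2 * e <= rho / 2 by clear -heta e2; lra.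
set z' := mollify eta e z; pose h' := mollify eta e h.
have vz' : velocity z' h' by exact: velocity_mollify.
have [[pz' _] ph' bh' _] := vz'; have mh' := bounded_measurable_rV_measurable bh'.
have hc : forall u, 1 - s <= enorm (h' u) <= 1 by apply: He0; rewrite e_gt0.
have zz' y : enorm (z' y - z y) <= e by exact: (mollify_sub_le heta y e_gt0 vz hle).
have cs0 : 0 < 1 - s by clear -heta s8; lra.
have q2 : 8 * e / rho ^+ 4 + (1 - (1 - s) ^+ 2) * (4 / rho ^+ 2) <= t / 2.
  have q1 : 8 * e / rho ^+ 4 <= t / 4 by rewrite ler_pdivrMr//; clear -heta e1; lra.
  have : (1 - (1 - s) ^+ 2) * (4 / rho ^+ 2) <= (2 * s) * (4 / rho ^+ 2).
    by apply: ler_wpM2r; [rewrite divr_ge0// sqr_ge0|clear -heta; nra].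
  have : (2 * s) * (4 / rho ^+ 2) <= t / 4.
    by rewrite mulrA ler_pdivrMr ?exprn_gt0//; clear -heta sr; lra.
  by clear -heta q1; lra.
have h34 u : 3 / 4 <= sqn (h u) by rewrite -enorm_sqr h1 expr1n; clear -heta; lra.
have h34' u : 3 / 4 <= sqn (h' u).
  by rewrite -enorm_sqr; have /andP[hu _] := hc u; clear -heta hu s8; nra.
have h12 u : 2^-1 <= enorm (h u) <= 1 by rewrite h1 lexx andbT; clear -heta; lra.
have h12' u : 2^-1 <= enorm (h' u) <= 1.
  by have /andP[hu ->] := hc u; rewrite andbT; clear -heta hu s8; lra.
have gle : (gap_energy h' d <= gap_energy h d)%E.
  rewrite -[leRHS]mul1e; apply: gap_energy_mono => // u.
  by rewrite mul1e; exact: shift_gap_mollify_le.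
have gd2 : (gap_energy h d <= (2^-1)%:E)%E.
  by apply: le_trans (ltW gd) _; rewrite lee_fin.
have gd2' : (gap_energy h' d <= (2^-1)%:E)%E by exact: le_trans gle gd2.
have far x w : `|w| <= 2^-1 -> d < `|w| -> rho <= enorm (z (x + w) - z x).
  by move=> w2 dw; apply: (chord_lower_bound_abs pz Hrho d2); rewrite (ltW dw).
(* Injectivity of the mollified curve: up to [|w| = d] by the small gap energy, beyond it because
   the chord of [z] is at least [rho] and changes by less than [rho / 2]. *)
have inj' x w : w != 0 -> `|w| <= 2^-1 -> 0 < sqn (z' (x + w) - z' x).
  move=> w0 w2; rewrite -enorm_sqr exprn_gt0//.
  have [wd|dw] := leP `|w| d.
    have w1 : `|w| <= 1 by clear -heta w2; lra.
    apply: lt_le_trans (chord_half_le x vz' w1 wd h34' gd2').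
    by rewrite mulr_gt0// normr_gt0.
  have := ler_dist_enorm (z (x + w) - z x) (z' (x + w) - z' x).
  have -> : z (x + w) - z x - (z' (x + w) - z' x) =
      - (z' (x + w) - z (x + w)) + (z' x - z x).
    by apply/rowP => i; rewrite !mxE; ring.
  move=> /le_trans/(_ (enormD _ _)); rewrite enormN ler_norml => /andP[_ H].
  have := zz' (x + w); have := zz' x; have := far x w w2 dw; clear -heta H e2 r0; lra.
have cmp x w : `|w| <= 2^-1 -> d < `|w| ->
    `|energy_density z' h' x (x + w) - energy_density z h x (x + w)| <= t / 2.
  move=> w2 dw; apply: le_trans q2.
  exact: (density_compare vz vz' h1 cs0 hc zz' r0 er w2 (far x w w2 dw)).
have gd' : (gap_energy h d <= g%:E)%E by exact: ltW.
have up : (mobius_energy z' <= mobius_energy z + t%:E)%E.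
  apply: (mobius_energy_le_add vz' vz h12' h12 inj' inj0 h34' g12 gt32 (le_trans gle gd')).
  by move=> x w w2 dw; apply: le_trans (cmp x w w2 dw); exact: ler_norm.
have lo : (mobius_energy z <= mobius_energy z' + t%:E)%E.
  apply: (mobius_energy_le_add vz vz' h12 h12' inj0 inj' h34 g12 gt32 gd').
  by move=> x w w2 dw; apply: le_trans (cmp x w w2 dw); rewrite distrC; exact: ler_norm.
have zE := fineK zfn.
apply/andP; split; last by rewrite EFinD zE; exact: up.
by rewrite EFinB zE leeBlDr//; exact: lo.
Unshelve. all: by end_near. Qed.

End EnergyConvergence.

Theorem theorem1p3 (R : realType) (n : nat) (eta : R -> R)
    (gamma : R -> 'rV[R]_n) (heta : is_mollifier eta)
    (hlip : closed_lipschitz gamma) (harc : arc_length_parametrized gamma)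
    (hfin : (mobius_energy gamma < +oo)%E) :
  (exists2 e0 : R, 0 < e0 & forall e : R, 0 < e < e0 ->
     smooth (mollify eta e gamma) /\ regular_curve (mollify eta e gamma)) /\
  cvg_W32 (fun e => mollify eta e gamma) gamma /\
  mobius_energy (mollify eta e gamma) @[e --> 0^'+] --> mobius_energy gamma.
Proof.
have [h vz h1] := unit_velocity hlip harc.
have hle t : enorm (h t) <= 1 by rewrite h1.
have gfin := gap_energy_lty vz h1 hfin.
have [_ ph bh _] := vz.
split; last by split; [exact: mollify_cvg_W32 hle gfin|exact: mobius_energy_mollify_cvg h1 hfin].
have h2 : 0 < 2^-1 :> R by rewrite invr_gt0.
(* Regularity asks only for some positive lower bound on the speed; the defect [1/2] is an arbitrary
   choice below [1]. *)
have [e0 /andP[e0_gt0 _] He0] := speed_lower_bound heta bh ph h1 gfin h2.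
exists e0 => // e ee0; have /andP[e_gt0 _] := ee0.
have ve := velocity_mollify heta e_gt0 vz.
split; first exact: smooth_mollify vz.
have [le _ _ _] := ve; split => //; exists 2^-1 => //.
apply: aeW => x; have [dx ->] := derive_mollify heta x e_gt0 vz; split => //.
by have /andP[sx _] := He0 e ee0 x; lra.
Qed.
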